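(* Let $m,n\ge1$ be integers. Suppose that $0<\alpha<n$, $q>0$, $1<p_1,\dots,p_m<\infty$, $$\frac1{p_1}+\cdots+\frac1{p_m}=\frac1q+\frac{\alpha}{n},$$ and $$\min\left\{\frac{\max_i p_i'}{q},\ \min_j\frac{\max\big(\{q\}\cup\{p_i':i\neq j\}\big)}{p_j'}\right\}\le 1-\frac{\alpha}{n}.$$ Then there is a constant $C=C_{m,n,\vec P,q}$, depending only on $m,n,\vec P=(p_1,\dots,p_m)$ and $q$, such that for every $\vec w=(w_1,\dots,w_m)\in A_{\vec P,q}$ and all $f_i\in L^{p_i}(w_i^{p_i})$, $i=1,\dots,m$, $$\|\mathcal I_\alpha(\vec f)\|_{L^q(u_{\vec w})}\le C\,[\vec w]_{A_{\vec P,q}}^{(1-\frac{\alpha}{n})\gamma}\prod_{i=1}^m\|f_i\|_{L^{p_i}(w_i^{p_i})},\qquad \gamma:=\max\Big\{1,\frac{p_1'}{q},\dots,\frac{p_m'}{q}\Big\}.$$ Moreover, the exponent of $[\vec w]_{A_{\vec P,q}}$ is sharp: for no $r<1$ does there exist a constant $C$ such that the inequality with exponent $r(1-\frac{\alpha}{n})\gamma$ in place of $(1-\frac{\alpha}{n})\gamma$ holds for all $\vec w\in A_{\vec P,q}$ and all $f_i\in L^{p_i}(w_i^{p_i})$.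
   Context: $p'$ denotes the conjugate exponent, $1/p+1/p'=1$. Cubes are cubes in $\mathbb R^n$ with sides parallel to the axes; $|Q|$ is Lebesgue measure. A weight is a non-negative locally integrable function on $\mathbb R^n$ (positive a.e., so that negative powers make sense). For a weight $v$ and $s>0$, $\|f\|_{L^s(v)}=(\int_{\mathbb R^n}|f|^s v\,dx)^{1/s}$. For a tuple of weights $\vec w=(w_1,\dots,w_m)$ put $u_{\vec w}=(\prod_{i=1}^m w_i)^q$ and $\sigma_i=w_i^{-p_i'}$. We say $\vec w\in A_{\vec P,q}$ if $$[\vec w]_{A_{\vec P,q}}:=\sup_Q\left(\frac1{|Q|}\int_Q u_{\vec w}\right)\prod_{i=1}^m\left(\frac1{|Q|}\int_Q\sigma_i\right)^{q/p_i'}<\infty,$$ the supremum being over all cubes $Q$. For $\vec f=(f_1,\dots,f_m)$ the multilinear fractional integral operator is $$\mathcal I_\alpha(\vec f)(x)=\int_{\mathbb R^{mn}}\frac{f_1(y_1)\cdots f_m(y_m)}{(|x-y_1|+\cdots+|x-y_m|)^{mn-\alpha}}\,dy_1\cdots dy_m .$$ *)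

(* Defs.v *)
From HB Require Import structures.
From mathcomp Require Import all_boot all_order all_algebra.
From mathcomp Require Import all_classical all_reals all_analysis.

Set Implicit Arguments.
Unset Strict Implicit.
Unset Printing Implicit Defensive.

Import Order.TTheory GRing.Theory Num.Theory.
Import numFieldNormedType.Exports.

Local Open Scope classical_set_scope.
Local Open Scope ring_scope.

Section tuple_measure.
Local Open Scope ereal_scope.
Context d (T : measurableType d) (R : realType).

Definition cons_pair n (z : T * n.-tuple T) : n.+1.-tuple T :=
  [tuple of z.1 :: z.2].

Lemma measurable_cons_pair n : measurable_fun setT (@cons_pair n).
Proof. exact: measurable_cons. Qed.

Section tuple_measure_cons.
Variables (mu : {sigma_finite_measure set T -> \bar R}) (n : nat).
Variable nu : {sigma_finite_measure set (n.-tuple T) -> \bar R}.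

Definition tuple_measure_cons : set (n.+1.-tuple T) -> \bar R :=
  pushforward (mu \x nu) (@cons_pair n).

Let cons0 : tuple_measure_cons set0 = 0.
Proof. by rewrite /tuple_measure_cons /pushforward preimage_set0 measure0. Qed.

Let cons_ge0 A : 0 <= tuple_measure_cons A.
Proof.
rewrite /tuple_measure_cons /pushforward; apply: measure_ge0.
Qed.

Let cons_sigma_additive : semi_sigma_additive tuple_measure_cons.
Proof.
move=> F mF tF mUF; rewrite /tuple_measure_cons /pushforward preimage_bigcup.
have mc := @measurable_cons_pair n.
apply: measure_semi_sigma_additive.
- by move=> k; rewrite -[X in measurable X]setTI; exact: mc.
- apply/trivIsetP => /= i j _ _ ij; rewrite -preimage_setI.
  by move/trivIsetP : tF => /(_ _ _ _ _ ij) ->//; rewrite preimage_set0.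
- by rewrite -preimage_bigcup -[X in measurable X]setTI; exact: mc.
Qed.

HB.instance Definition _ := isMeasure.Build _ _ _ tuple_measure_cons
  cons0 cons_ge0 cons_sigma_additive.

Let cons_sigma_finite : sigma_finite setT tuple_measure_cons.
Proof.
have /sigma_finiteP[F [TF ndF Foo]] := sigma_finiteT mu.
have /sigma_finiteP[G [TG ndG Goo]] := sigma_finiteT nu.
pose g (x : n.+1.-tuple T) : T * n.-tuple T := (thead x, [tuple of behead x]).
have mg : measurable_fun setT g.
  apply/measurable_fun_pairP; split; last exact: measurable_behead.
  exact: (@measurable_tnth _ T n.+1 ord0).
have gK z : g (cons_pair z) = z.
  by case: z => a b; rewrite /g /cons_pair theadE; congr pair; exact: val_inj.
exists (fun k => g @^-1` (F k `*` G k)).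
  rewrite -preimage_bigcup -[LHS](preimage_setT g); congr (_ @^-1` _).
  rewrite -setXTT TF TG predeqE => -[x y]; split.
    move=> [/= [i _ Fix] [k _ Gky]]; exists (maxn i k) => //; split.
    - by move: x Fix; exact/subsetPset/ndF/leq_maxl.
    - by move: y Gky; exact/subsetPset/ndG/leq_maxr.
  by move=> [i _ []/= ? ?]; split; exists i.
move=> k; have [mF Fk] := Foo k; have [mG Gk] := Goo k.
have mFG : measurable (F k `*` G k) by exact: measurableX.
split; first by rewrite -[X in measurable X]setTI; exact: mg.
rewrite /tuple_measure_cons /pushforward -comp_preimage.
rewrite (_ : g \o _ = id) ?preimage_id; last exact/funext.
by rewrite product_measure1E// lte_mul_pinfty// ge0_fin_numE.
Qed.

HB.instance Definition _ := Measure_isSigmaFinite.Build _ _ _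
  tuple_measure_cons cons_sigma_finite.

End tuple_measure_cons.

(* The n-fold product measure mu x ... x mu on T^n = n.-tuple T (with its
   product sigma-algebra); T^0 is a point, of mass 1. *)
Fixpoint tuple_measure (mu : {sigma_finite_measure set T -> \bar R}) (n : nat) :
    {sigma_finite_measure set (n.-tuple T) -> \bar R} :=
  if n is k.+1 then tuple_measure_cons mu (tuple_measure mu k)
  else \d_([tuple] : 0.-tuple T).

End tuple_measure.

Section multilinear_fractional_integral.
Variable R : realType.

Local Notation euclid n := (n.-tuple (measurableTypeR R)).

Definition leb (n : nat) : {sigma_finite_measure set (euclid n) -> \bar R} :=
  tuple_measure (@lebesgue_measure R) n.

(* Lebesgue measure on R^{mn}, seen as (R^n)^m. *)
Definition lebm (m n : nat) :
    {sigma_finite_measure set (m.-tuple (euclid n)) -> \bar R} :=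
  tuple_measure (leb n) m.

Definition eucl_dist n (x y : euclid n) : R :=
  Num.sqrt (\sum_(k < n) (tnth x k - tnth y k) ^+ 2).

(* The product sigma-algebra is the Borel one; a function is Lebesgue
   measurable iff it agrees almost everywhere with a Borel function.  The
   library integral of such a function is that of its Borel representative. *)
Definition lebesgue_measurable n (f : euclid n -> R) : Prop :=
  exists2 g : euclid n -> R,
    measurable_fun setT g & {ae leb n, forall x, f x = g x}.

Definition cube n (a : euclid n) (l : R) : set (euclid n) :=
  [set x | forall k : 'I_n, tnth a k <= tnth x k <= tnth a k + l].

Definition is_cube n (Q : set (euclid n)) : Prop :=
  exists a : euclid n, exists2 l : R, 0 < l & Q = cube a l.

Definition weight n (w : euclid n -> R) : Prop :=
  [/\ lebesgue_measurable w,
      forall x, 0 <= w x,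
      {ae leb n, forall x, 0 < w x} &
      forall Q, is_cube Q -> (\int[leb n]_(x in Q) (w x)%:E < +oo)%E].

Definition conj_exp (p : R) : R := p / (p - 1).

Definition wnorm n (s : R) (v : euclid n -> R) (f : euclid n -> \bar R) : \bar R :=
  ((\int[leb n]_x (`|f x| `^ s * (v x)%:E)) `^ s^-1)%E.

Definition in_wLp n (s : R) (v f : euclid n -> R) : Prop :=
  lebesgue_measurable f /\ (wnorm s v (EFin \o f) < +oo)%E.

Definition average n (Q : set (euclid n)) (g : euclid n -> R) : \bar R :=
  ((fine (leb n Q))^-1%:E * \int[leb n]_(x in Q) (g x)%:E)%E.

Definition u_weight m n (q : R) (w : 'I_m -> euclid n -> R) (x : euclid n) : R :=
  (\prod_(i < m) w i x) `^ q.

Definition sigma_weight m n (p : 'I_m -> R) (w : 'I_m -> euclid n -> R)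
    (i : 'I_m) (x : euclid n) : R :=
  w i x `^ (- conj_exp (p i)).

Definition ApqC m n (p : 'I_m -> R) (q : R) (w : 'I_m -> euclid n -> R) : \bar R :=
  ereal_sup
    [set (average Q (u_weight q w) *
          \prod_(i < m) (average Q (sigma_weight p w i) `^ (q / conj_exp (p i))))%E
    | Q in @is_cube n].

Definition Apq m n (p : 'I_m -> R) (q : R) (w : 'I_m -> euclid n -> R) : Prop :=
  (forall i, weight (w i)) /\ (ApqC p q w < +oo)%E.

Definition Ialpha m n (alpha : R) (f : 'I_m -> euclid n -> R) (x : euclid n) :
    \bar R :=
  (\int[lebm m n]_y
     ((\prod_(i < m) f i (tnth y i)) /
      (\sum_(i < m) eucl_dist x (tnth y i)) `^ ((m * n)%:R - alpha))%:E)%E.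

Definition Ialpha_bound m n (alpha : R) (p : 'I_m -> R) (q e C : R) : Prop :=
  forall w f : 'I_m -> euclid n -> R,
    Apq p q w ->
    (forall i, in_wLp (p i) (fun x => w i x `^ p i) (f i)) ->
    (wnorm q (u_weight q w) (Ialpha alpha f) <=
     C%:E * ApqC p q w `^ e *
     \prod_(i < m) wnorm (p i) (fun x => w i x `^ p i)%R (EFin \o f i))%E.

Definition gammaPq m (p : 'I_m -> R) (q : R) : R :=
  \big[Num.max/1]_(i < m) (conj_exp (p i) / q).

(* 0 is neutral here, as the conjugate exponents are positive. *)
Definition max_conj m (p : 'I_m -> R) : R :=
  \big[Num.max/0]_(i < m) conj_exp (p i).

Definition max_conj_but m (p : 'I_m -> R) (q : R) (j : 'I_m) : R :=
  \big[Num.max/q]_(i < m | i != j) conj_exp (p i).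

(* min {a, min_j b_j}: a is used as the base of the iterated minimum. *)
Definition min_ratio m (p : 'I_m -> R) (q : R) : R :=
  \big[Num.min/max_conj p / q]_(j < m) (max_conj_but p q j / conj_exp (p j)).

End multilinear_fractional_integral.

(* Main.v *)
Require Import Defs.
From mathcomp Require Import all_boot all_order all_algebra.
From mathcomp Require Import all_classical all_reals all_analysis.
From mathcomp Require Import ring lra zify.

(* Upper bound.  Put r_0 = q, v_0 = u_w, r_i = p_i' and v_i = sigma_i, so that
   the product of the v_i ^ (1 / r_i) is 1; the hypothesis on the exponents
   says that one r_j satisfies r_i <= (1 - alpha / n) r_j for all i <> j.
   Translating dyadic grids by a third of their top side bounds I_alpha by
   finitely many dyadic sums over cells Q of |Q|^(alpha/n - m) times the
   masses of the f_i on Q.  Along each chain of cells one stops whenever the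
   product of the averages has grown by a large factor; every stopped cell
   keeps half of its measure disjoint from the next ones.  On a stopped cell
   the A_{P,q} bound is used to the power fixed by r_j, its surplus being
   absorbed by Holder's inequality on the remaining half, and the resulting
   sum is bounded by Doob's maximal inequality for the measures v_i dx (by
   duality in the slot 0 when q > 1).

   Sharpness.  Let N be the sup norm and d = 1/J -> 0.  If gamma = p_j'/q, give
   sigma_j the singularity N^(d-n), and otherwise give it to u_w; all other
   weights are 1 and f_i is N^((d-n)/p_i) / w_i on the unit ball.  Then
   [w] <= C J^(1/gamma), the product of the norms is at most
   C J^(1/q + alpha/n), and the norm of I_alpha f is at least c J^(1 + 1/q). *)

Set Implicit Arguments.
Unset Strict Implicit.
Unset Printing Implicit Defensive.

Import Order.TTheory GRing.Theory Num.Theory.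
Import numFieldNormedType.Exports.
Import measurable_realfun HBNNSimple.

Local Open Scope classical_set_scope.
Local Open Scope ring_scope.

(** * Integrals without measurability *)

(** Write beta = alpha / n and s_i = 1 / r_i. The s_i add up to m - beta, so the factor |Q|^(beta -
    m) of a cell is exactly the one that turns the product of the v_i(Q)^(s_i) into a product of
    averages. The power of the A_{P,q} bound is rho = (1 - beta) / s_j, and rho / q = (1 - beta)
    gamma is the asserted exponent. With this rho nothing is left over in slot j, where the missing
    homogeneity beta is paid by the norm bound of the function; every other slot must keep a
    nonnegative surplus, and this is the condition r_i <= (1 - beta) r_j. The surplus is the
    difference between the mass on the whole cell and on its remaining half.

    A second obstacle is measurability. Weights and functions are Borel only up to null sets, and no
    measurability of I_alpha f is established. Integrals of nonnegative functions are therefore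
    compared through monotonicity and null sets only; additivity and convergence theorems are
    applied to Borel majorants.

    The sharpness claim includes negative r, for which an upper bound on the characteristic says
    nothing; hence the test weights also need a characteristic bounded below uniformly in J. *)

Section integral_tools.
Local Open Scope ereal_scope.
Context d (T : measurableType d) (R : realType) (mu : {measure set T -> \bar R}).

(* The integral of a nonnegative function is a supremum over the simple
   functions below it, measurable or not. *)
Lemma le_integral_nonmeas (D : set T) (f g : T -> \bar R) :
  (forall x, D x -> 0 <= f x) -> (forall x, D x -> f x <= g x) ->
  \int[mu]_(x in D) f x <= \int[mu]_(x in D) g x.
Proof.
move=> f0 fg; rewrite integral_mkcond [leRHS]integral_mkcond.
have f0' x : 0 <= (f \_ D) x.
  by rewrite patchE; case: ifPn => // /set_mem; exact: f0.
have fg' x : (f \_ D) x <= (g \_ D) x.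
  by rewrite !patchE; case: ifPn => // /set_mem; exact: fg.
rewrite !ge0_integralTE//; last by move=> x; exact: le_trans (fg' x).
apply: le_ereal_sup => _ [h /= hf <-]; exists h => // x.
exact: le_trans (fg' x).
Qed.

(** A simple function below [f], set to 0 on the exceptional null set, keeps its integral and lies
    below [g]. *)
Lemma ae_le_integral_nonmeas (f g : T -> \bar R) :
  (forall x, 0 <= f x) -> (forall x, 0 <= g x) ->
  {ae mu, forall x, f x <= g x} -> \int[mu]_x f x <= \int[mu]_x g x.
Proof.
move=> f0 g0 [N [mN N0 sN]].
rewrite [leLHS]ge0_integralTE//; apply: ge_ereal_sup => _ [h /= hf <-].
have mh : measurable_fun [set: T] (EFin \o (h : T -> R)) by exact/measurable_EFinP.
rewrite -integralT_nnsfun (ge0_negligible_integral mN)//; last first.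
  by move=> x _; rewrite lee_fin.
rewrite integral_mkcond; apply: le_integral_nonmeas => x _ //; rewrite patchE.
  by case: ifPn => // _; rewrite lee_fin.
case: ifPn => [|_]//; rewrite inE => -[_ Nx].
apply: le_trans (hf x) _; apply: contrapT => /negP fg.
by apply: Nx; apply: sN => /=; exact/negP.
Qed.

Lemma ae_eq_integral_nonmeas (D : set T) (f g : T -> \bar R) :
  (forall x, 0 <= f x) -> (forall x, 0 <= g x) ->
  {ae mu, forall x, f x = g x} ->
  \int[mu]_(x in D) f x = \int[mu]_(x in D) g x.
Proof.
move=> f0 g0 fg; rewrite integral_mkcond [RHS]integral_mkcond.
have p0 (k : T -> \bar R) : (forall x, 0 <= k x) -> forall x, 0 <= (k \_ D) x.
  by move=> k0 x; rewrite patchE; case: ifPn.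
have H : {ae mu, forall x, (f \_ D) x = (g \_ D) x}.
  by apply: filterS fg => x fgx; rewrite !patchE fgx.
apply/eqP; rewrite eq_le; apply/andP; split;
  apply: ae_le_integral_nonmeas; rewrite //; try exact: p0.
- by apply: filterS H => x ->.
- by apply: filterS H => x ->.
Qed.

(** The positive and the negative part are both below [|f|], and two numbers of [0, c] differ by at
    most c; additivity of the integral is avoided. *)
Lemma abse_integral_le (f : T -> \bar R) :
  `|\int[mu]_x f x| <= \int[mu]_x `|f x|.
Proof.
have h1 : \int[mu]_x f^\+ x <= \int[mu]_x `|f x|.
  by apply: le_integral_nonmeas => x _; rewrite ?funepos_ge0// funeposE ge_max
    abse_ge0 andbT lee_abs.
have h2 : \int[mu]_x f^\- x <= \int[mu]_x `|f x|.
  apply: le_integral_nonmeas => x _; rewrite ?funeneg_ge0//.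
  by rewrite funenegE ge_max abse_ge0 andbT -abseN lee_abs.
rewrite [in leLHS]integralE.
have := integral_ge0 mu (D := setT) (fun x _ => funepos_ge0 f x).
have := integral_ge0 mu (D := setT) (fun x _ => funeneg_ge0 f x).
move: h1 h2; set a := \int[mu]_x _; set b := \int[mu]_x _; set c := integral _ _ _.
move: a b c => [a||] [b||] [c||]//=; rewrite ?lee_fin ?leey// => h1 h2 h3 h4.
rewrite ler_norml; lra.
Qed.

(** Monotone convergence for a function [f] that need not be measurable: only the increasing
    sequence whose supremum dominates it has to be. *)
Lemma integral_le_of_monotone_approx (f : T -> \bar R) (g : nat -> T -> \bar R) B :
  (forall x, 0 <= f x) -> (forall k, measurable_fun setT (g k)) ->
  (forall k x, 0 <= g k x) ->
  (forall x, nondecreasing_seq (g ^~ x)) ->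
  (forall x, f x <= ereal_sup (range (g ^~ x))) ->
  (forall k, \int[mu]_x g k x <= B) -> \int[mu]_x f x <= B.
Proof.
move=> f0 mg g0 ndg fg gB.
apply: (@le_trans _ _ (\int[mu]_x limn (g ^~ x))).
  apply: le_integral_nonmeas => // x _.
  by rewrite (cvg_lim _ (ereal_nondecreasing_cvgn (ndg x))).
rewrite monotone_convergence//.
apply: lime_le; last by near=> k; exact: gB.
apply: ereal_nondecreasing_is_cvgn => i j ij.
by apply: ge0_le_integral => // x _; exact: ndg.
Unshelve. all: by end_near.
Qed.

Lemma integral_gt0_of_pos (D : set T) (f : T -> R) :
  measurable D -> measurable_fun D f -> (forall x, D x -> (0 < f x)%R) ->
  0 < mu D -> 0 < \int[mu]_(x in D) (f x)%:E.
Proof.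
move=> mD mf f0 D0; rewrite lt_neqAle integral_ge0 ?andbT; last first.
  by move=> x Dx; rewrite lee_fin ltW// f0.
apply/negP => /eqP I0.
have : \int[mu]_(x in D) `|(f x)%:E| = 0.
  rewrite [RHS]I0; apply: eq_integral => x /set_mem Dx.
  by rewrite gee0_abs// lee_fin ltW// f0.
move/ae_eq_integral_abs => /(_ mD); case; first exact/measurable_EFinP.
move=> N [mN N0 sN]; move: D0; apply/negP; rewrite -leNgt -N0.
apply: le_measure; rewrite ?inE// => x Dx; apply: sN => /= /(_ Dx) [].
by move=> fx0; have := f0 _ Dx; rewrite fx0 ltxx.
Qed.

(** A simple function below [c * h], divided by [c], lies below [h]. The lemma serves to rescale
    I_alpha, with no measurability in x at hand. *)
Lemma integral_scale_le (c : R) (h : T -> \bar R) : (0 < c)%R ->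
  (forall x, 0 <= h x) -> \int[mu]_x (c%:E * h x) <= c%:E * \int[mu]_x h x.
Proof.
move=> c0 h0; rewrite [leLHS]ge0_integralTE; last first.
  by move=> x; rewrite mule_ge0// lee_fin ltW.
apply: ge_ereal_sup => _ [g /= gh <-]; rewrite -integralT_nnsfun.
have mg : measurable_fun [set: T] (EFin \o (g : T -> R)) by exact/measurable_EFinP.
rewrite -lee_pdivrMl// -ge0_integralZl//; last 2 first.
- by move=> x _; rewrite lee_fin.
- by rewrite lee_fin invr_ge0 ltW.
apply: le_integral_nonmeas => x _.
  by rewrite mule_ge0 ?lee_fin ?invr_ge0 ?(ltW c0).
by rewrite lee_pdivrMl.
Qed.

End integral_tools.

Section real_integral.
Local Open Scope ereal_scope.
Context d (T : measurableType d) (R : realType) (mu : {measure set T -> \bar R}).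
Variables (D : set T) (mD : measurable D).

Lemma integral_EFinD (f g : T -> R) :
  measurable_fun D f -> measurable_fun D g ->
  (forall x, (0 <= f x)%R) -> (forall x, (0 <= g x)%R) ->
  \int[mu]_(x in D) (f x + g x)%:E =
  \int[mu]_(x in D) (f x)%:E + \int[mu]_(x in D) (g x)%:E.
Proof.
move=> mf mg f0 g0; under eq_integral do rewrite EFinD.
apply: ge0_integralD => //; try by move=> x _; rewrite lee_fin.
  exact/measurable_EFinP.
exact/measurable_EFinP.
Qed.

Lemma integral_EFinZ (k : R) (f : T -> R) :
  measurable_fun D f -> (0 <= k)%R -> (forall x, (0 <= f x)%R) ->
  \int[mu]_(x in D) (k * f x)%:E = k%:E * \int[mu]_(x in D) (f x)%:E.
Proof.
move=> mf k0 f0; under eq_integral do rewrite EFinM.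
apply: ge0_integralZl => //; try by move=> x _; rewrite lee_fin.
exact/measurable_EFinP.
Qed.

Lemma integral_EFin_sum (I : Type) (s : seq I) (P : pred I) (f : I -> T -> R) :
  (forall i, measurable_fun D (f i)) -> (forall i x, (0 <= f i x)%R) ->
  \int[mu]_(x in D) (\sum_(i <- s | P i) f i x)%:E =
  \sum_(i <- s | P i) \int[mu]_(x in D) (f i x)%:E.
Proof.
move=> mf f0; under eq_integral do rewrite -sumEFin -big_filter.
rewrite -[RHS]big_filter; apply: ge0_integral_sum => //.
  by move=> i; exact/measurable_EFinP.
by move=> i x _; rewrite lee_fin.
Qed.

Lemma le_integral_EFin (f g : T -> R) :
  (forall x, D x -> (0 <= f x)%R) -> (forall x, D x -> (f x <= g x)%R) ->
  \int[mu]_(x in D) (f x)%:E <= \int[mu]_(x in D) (g x)%:E.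
Proof.
by move=> f0 fg; apply: le_integral_nonmeas => x Dx; rewrite lee_fin ?f0 ?fg.
Qed.

Lemma integral_EFin_ge0 (f : T -> R) :
  (forall x, D x -> (0 <= f x)%R) -> 0 <= \int[mu]_(x in D) (f x)%:E.
Proof. by move=> f0; apply: integral_ge0 => x Dx; rewrite lee_fin f0. Qed.

Lemma integral_EFin_indic (g : T -> R) :
  \int[mu]_x (\1_D x * g x)%:E = \int[mu]_(x in D) (g x)%:E.
Proof.
rewrite [RHS]integral_mkcond; apply: eq_integral => x _.
by rewrite patchE indicE; case: ifP => _; rewrite ?mul1r ?mul0r.
Qed.

End real_integral.

(** * Filtrations and the maximal inequality *)

Section trajectory.
Context (R : realType).

Fixpoint running_max (X : nat -> R) (k : nat) : R :=
  if k is l.+1 then Num.max (running_max X l) (X k) else X 0.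

Lemma running_max_ge (X : nat -> R) k l : (k <= l)%N -> X k <= running_max X l.
Proof.
elim: l => [|l ih]; first by rewrite leqn0 => /eqP ->.
rewrite leq_eqVlt => /predU1P[->|kl] /=; first by rewrite le_max lexx orbT.
by rewrite le_max ih.
Qed.

Lemma running_max_ge0 (X : nat -> R) l : (forall k, 0 <= X k) -> 0 <= running_max X l.
Proof. by move=> X0; apply: le_trans (X0 l) _; exact: running_max_ge. Qed.

Lemma eq_running_max (X Y : nat -> R) l :
  (forall k, (k <= l)%N -> X k = Y k) -> running_max X l = running_max Y l.
Proof.
elim: l => [|l ih] XY /=; first exact: XY.
by rewrite XY// ih// => k kl; apply: XY; exact: leqW.
Qed.

(** The increments of the power p - 1 of the running maximum cut at height [t]. They are nonnegative
    and depend on [X] up to time [k] only; the cut makes integrals finite. *)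
Definition max_incr (p t : R) (X : nat -> R) (k : nat) : R :=
  if k is l.+1 then Num.min (running_max X k) t `^ (p - 1)
                    - Num.min (running_max X l) t `^ (p - 1)
  else Num.min (X 0) t `^ (p - 1).

Lemma sum_max_incr p t X N :
  \sum_(k < N.+1) max_incr p t X k = Num.min (running_max X N) t `^ (p - 1).
Proof.
elim: N => [|N ih]; first by rewrite big_ord1.
by rewrite big_ord_recr ih /= addrC subrK.
Qed.

Lemma max_incr_ge0 p t X k : 1 < p -> 0 <= t -> (forall k, 0 <= X k) ->
  0 <= max_incr p t X k.
Proof.
move=> p1 t0 X0; case: k => [|k]; first exact: powR_ge0.
rewrite /max_incr subr_ge0; apply: ge0_ler_powR.
- by rewrite subr_ge0 ltW.
- by rewrite nnegrE le_min t0 running_max_ge0.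
- by rewrite nnegrE le_min t0 running_max_ge0.
- by rewrite /= le_min !ge_min le_max !lexx /= orbT.
Qed.

(** Young's inequality for b * a^(p-1). *)
Lemma max_incr_step (a b p : R) : 0 <= a -> 0 <= b -> 1 < p ->
  (1 - p^-1) * (b `^ p - a `^ p) <= b * (b `^ (p - 1) - a `^ (p - 1)).
Proof.
move=> a0 b0 p1; have p0 : 0 < p by lra.
have q0 : 0 < p / (p - 1) by rewrite divr_gt0// subr_gt0.
have pE : (p - 1) * (p / (p - 1)) = p by field; apply/eqP => h; lra.
have Y : b * a `^ (p - 1) <= b `^ p / p + a `^ p * ((p - 1) / p).
  have := conjugate_powR b0 (powR_ge0 a (p - 1)) p0 q0.
  rewrite -powRrM pE invf_div; apply.
  by field; apply/eqP => h; lra.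
rewrite [leRHS]mulrBr [b * b `^ _]mulr_powRB1//.
have -> : (1 - p^-1) * (b `^ p - a `^ p) =
  b `^ p - (b `^ p / p + a `^ p * ((p - 1) / p)) by field; apply/eqP => h; lra.
by rewrite lerD2l lerN2.
Qed.

(** By [max_incr_step] the left side grows by at most the truncated maximum times its increment. A
    nonzero increment occurs only when [X] reaches a new maximum, and then [X] is at least the
    truncated maximum. *)
Lemma doob_trajectory p t X N : 1 < p -> 0 <= t -> (forall k, 0 <= X k) ->
  (1 - p^-1) * Num.min (running_max X N) t `^ p <=
  \sum_(k < N.+1) X k * max_incr p t X k.
Proof.
move=> p1 t0 X0; elim: N => [|N ih].
  rewrite big_ord1 /=.
  have m0 : 0 <= Num.min (X 0) t by rewrite le_min X0 t0.
  apply: (@le_trans _ _ (Num.min (X 0) t * Num.min (X 0) t `^ (p - 1))).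
    rewrite mulr_powRB1//; last by lra.
    rewrite ler_piMl ?powR_ge0// gerBl invr_ge0; lra.
  by rewrite ler_wpM2r ?powR_ge0// ge_min lexx.
rewrite big_ord_recr; apply: le_trans (lerD ih (lexx _)).
have m0 : 0 <= Num.min (running_max X N) t by rewrite le_min running_max_ge0.
have m1 : 0 <= Num.min (running_max X N.+1) t by rewrite le_min running_max_ge0.
have := max_incr_step m0 m1 p1; rewrite mulrBr lerBlDl => /le_trans; apply.
rewrite lerD2l [X in _ * X](_ : _ = max_incr p t X N.+1)//.
have [XN|XN] := leP (X N.+1) (running_max X N).
  by rewrite /= (max_idPl XN) subrr !mulr0.
apply: ler_wpM2r; first exact: max_incr_ge0.
by rewrite /= (max_idPr (ltW XN)) ge_min lexx.
Qed.

End trajectory.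

Section filtration.
Context d (T : measurableType d) (R : realType).
Variables (mu : {measure set T -> \bar R}) (pi : nat -> T -> nat).
Hypothesis measurable_pi : forall k i, measurable [set x | pi k x = i].
Hypothesis refine_pi : forall k x y, pi k.+1 x = pi k.+1 y -> pi k x = pi k y.

Definition cell k x : set T := [set y | pi k y = pi k x].

(** Measurability for the k-th sigma-algebra of the filtration, in the pointwise form available
    because the cells of a level are countably many. *)
Definition lconst k {T'} (h : T -> T') := forall x y, pi k x = pi k y -> h x = h y.

Lemma measurable_cell k x : measurable (cell k x).
Proof. exact: measurable_pi. Qed.

Lemma pi_le k l x y : (k <= l)%N -> pi l x = pi l y -> pi k x = pi k y.
Proof.
elim: l => [|l ih]; first by rewrite leqn0 => /eqP ->.
by rewrite leq_eqVlt => /predU1P[->//|kl /refine_pi]; exact: ih.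
Qed.

Lemma lconst_le k l {T'} (h : T -> T') : (k <= l)%N -> lconst k h -> lconst l h.
Proof. by move=> kl hc x y /(pi_le kl); exact: hc. Qed.

Lemma eq_cell k x y : pi k x = pi k y -> cell k x = cell k y.
Proof. by rewrite /cell => ->. Qed.

Lemma lconst_measurable k d' (T' : measurableType d') (D : set T) (h : T -> T') :
  lconst k h -> measurable_fun D h.
Proof.
move=> hc; apply: (@measurable_funS _ _ _ _ setT) => // _ A mA; rewrite setTI.
have -> : h @^-1` A = \bigcup_(i in pi k @` (h @^-1` A)) [set x | pi k x = i].
  apply/seteqP; split=> [x Ax|x [_ [y Ay <-]] /= xy].
    by exists (pi k x) => //; exists x.
  by rewrite /preimage /= (hc _ _ xy).
by apply: bigcup_measurable => i _; exact: measurable_pi.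
Qed.

Local Open Scope ereal_scope.

Lemma le_integral_cellwise k (g h : T -> \bar R) :
  measurable_fun setT g -> measurable_fun setT h ->
  (forall x, 0 <= g x) -> (forall x, 0 <= h x) ->
  (forall x, \int[mu]_(y in cell k x) g y <= \int[mu]_(y in cell k x) h y) ->
  \int[mu]_y g y <= \int[mu]_y h y.
Proof.
move=> mg mh g0 h0 gh.
have TE : [set: T] = \bigcup_i [set x | pi k x = i].
  by apply/seteqP; split=> // x _; exists (pi k x).
have tF : trivIset setT (fun i => [set x | pi k x = i]).
  by apply/trivIsetP => i j _ _ ij; apply/seteqP; split=> // x [/= -> /eqP];
    rewrite (negbTE ij).
rewrite TE !ge0_integral_bigcup//; try by rewrite -TE.
apply: lee_nneseries => [i _ _|i _]; first exact: integral_ge0.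
have [->|/set0P[x <-]] := eqVneq [set x | pi k x = i] set0; last exact: gh.
by rewrite !integral_set0.
Qed.

Lemma eq_integral_cellwise k (g h : T -> \bar R) :
  measurable_fun setT g -> measurable_fun setT h ->
  (forall x, 0 <= g x) -> (forall x, 0 <= h x) ->
  (forall x, \int[mu]_(y in cell k x) g y = \int[mu]_(y in cell k x) h y) ->
  \int[mu]_y g y = \int[mu]_y h y.
Proof.
move=> mg mh g0 h0 gh; apply/eqP.
by rewrite eq_le !(@le_integral_cellwise k)// => x; rewrite gh.
Qed.

Definition cint (v : T -> R) k x : \bar R := \int[mu]_(y in cell k x) (v y)%:E.

Definition mass (v : T -> R) k x : R := fine (cint v k x).

(** The conditional expectation of [f] at level [k] for the measure v dmu. *)
Definition avg (v f : T -> R) k x : R := mass (fun y => f y * v y)%R k x / mass v k x.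

Lemma lconst_cint v k : lconst k (cint v k).
Proof. by move=> x y xy; rewrite /cint (eq_cell xy). Qed.

Lemma lconst_mass v k : lconst k (mass v k).
Proof. by move=> x y xy; rewrite /mass (lconst_cint _ xy). Qed.

Lemma lconst_avg v f k : lconst k (avg v f k).
Proof. by move=> x y xy; rewrite /avg !(lconst_mass _ xy). Qed.

Section density.
Variable v : T -> R.
Hypothesis mv : measurable_fun setT v.
Hypothesis v_gt0 : forall x, (0 < v x)%R.
Hypothesis cint_v : forall k x, cint v k x < +oo.
Hypothesis cell_gt0 : forall k x, 0 < mu (cell k x).

Let v_ge0 x : (0 <= v x)%R. Proof. exact: ltW. Qed.

Lemma mass_gt0 k x : (0 < mass v k x)%R.
Proof.
rewrite fine_gt0// cint_v andbT.
by apply: integral_gt0_of_pos => //; [exact: measurable_cell|exact: measurable_funS mv].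
Qed.

Lemma massE k x : (mass v k x)%:E = cint v k x.
Proof. by rewrite fineK// ge0_fin_numE// integral_EFin_ge0. Qed.

Variable f : T -> R.
Hypothesis mf : measurable_fun setT f.
Hypothesis f_ge0 : forall x, (0 <= f x)%R.

Let fv_ge0 x : (0 <= f x * v x)%R. Proof. exact: mulr_ge0. Qed.

Let mfv : measurable_fun setT (fun x => f x * v x)%R.
Proof. exact: measurable_funM. Qed.

Hypothesis cint_fv : forall k x, cint (fun y => f y * v y)%R k x < +oo.

Lemma avg_ge0 k x : (0 <= avg v f k x)%R.
Proof. by rewrite divr_ge0// fine_ge0// integral_EFin_ge0. Qed.

(** The tower property: on a cell both sides are the constant value of [h] times the integral of f
    v. *)
Lemma integral_avg k (h : T -> R) : (forall x, (0 <= h x)%R) -> lconst k h ->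
  \int[mu]_x (h x * avg v f k x * v x)%:E = \int[mu]_x (h x * f x * v x)%:E.
Proof.
move=> h0 hc.
have mh : measurable_fun setT h by exact: lconst_measurable hc.
have ma : measurable_fun setT (avg v f k) by exact: lconst_measurable (@lconst_avg _ _ k).
apply: (@eq_integral_cellwise k).
- by apply/measurable_EFinP; do 2?apply: measurable_funM.
- by apply/measurable_EFinP; do 2?apply: measurable_funM.
- by move=> x; rewrite lee_fin mulr_ge0// mulr_ge0// avg_ge0.
- by move=> x; rewrite lee_fin mulr_ge0// mulr_ge0.
move=> x.
rewrite [LHS](_ : _ = \int[mu]_(y in cell k x) (h x * avg v f k x * v y)%:E); last first.
  by apply: eq_integral => y /set_mem xy; rewrite (hc _ _ xy) (lconst_avg _ _ xy).
rewrite [RHS](_ : _ = \int[mu]_(y in cell k x) (h x * (f y * v y))%:E); last first.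
  by apply: eq_integral => y /set_mem xy; rewrite (hc _ _ xy) mulrA.
have mc := measurable_cell k x.
rewrite !integral_EFinZ//; last 3 first.
- exact: measurable_funS mfv.
- exact: measurable_funS mv.
- by rewrite mulr_ge0// avg_ge0.
rewrite -[X in _ * X]/(cint v k x) -massE -[RHS]/(_ * cint (fun y => f y * v y)%R k x).
rewrite -[in RHS](@fineK _ (cint _ k x)) ?ge0_fin_numE ?integral_EFin_ge0//.
rewrite -!EFinM -mulrA; congr (_ * _)%:E.
by rewrite divfK// gt_eqF// mass_gt0.
Qed.

Lemma measurable_avg k : measurable_fun setT (avg v f k).
Proof. exact: lconst_measurable (@lconst_avg _ _ k). Qed.

Lemma lconst_running_max N : lconst N (fun x => running_max (avg v f ^~ x) N).
Proof.
move=> x y xy; apply: eq_running_max => k kN.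
exact: (lconst_le kN (@lconst_avg v f k)).
Qed.

Lemma measurable_running_max N :
  measurable_fun setT (fun x => running_max (avg v f ^~ x) N).
Proof. exact: lconst_measurable (@lconst_running_max N). Qed.

Lemma lconst_max_incr p t k : lconst k (fun x => max_incr p t (avg v f ^~ x) k).
Proof.
case: k => [|k] x y xy /=; first by rewrite (lconst_avg _ _ xy).
have := @lconst_running_max k.+1 x y xy => /= ->.
by rewrite (@lconst_running_max k x y)//; exact: refine_pi.
Qed.

Lemma integral_EFin_fin (D : set T) (g : T -> R) (b : R) k x :
  D = cell k x -> (forall y, (0 <= g y <= b)%R) ->
  \int[mu]_(y in D) (g y * v y)%:E \is a fin_num.
Proof.
move=> -> gb; have b0 : (0 <= b)%R by have /andP[] := gb x; exact: le_trans.
rewrite ge0_fin_numE; last first.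
  by apply: integral_EFin_ge0 => y _; rewrite mulr_ge0//; case/andP: (gb y).
apply: (@le_lt_trans _ _ (\int[mu]_(y in cell k x) (b * v y)%:E)).
  apply: le_integral_EFin => y _; have /andP[? ?] := gb y.
    by rewrite mulr_ge0.
  by rewrite ler_wpM2r.
rewrite integral_EFinZ//; [|exact: measurable_cell|exact: measurable_funS mv].
by rewrite -[X in _ * X]/(cint v k x) -massE -EFinM ltry.
Qed.

(** Integrating [doob_trajectory] and replacing averages by [f] bounds (1 - 1/p) A by the integral
    of f b^(p-1), with [b] the truncated maximum and [A] the left side. Comparing [f] with [e * b]
    bounds this by e A + e^(1-p) B. For [e] half of 1 - 1/p the term e A is absorbed; the truncation
    and the restriction to one cell make [A] finite, so that it can be subtracted. *)
Lemma doob_truncated p t N x0 : (1 < p)%R -> (0 <= t)%R ->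
  \int[mu]_(x in cell 0 x0)
    (Num.min (running_max (avg v f ^~ x) N) t `^ p * v x)%:E <=
  (((1 - p^-1) / 2) `^ (- p))%:E *
    \int[mu]_(x in cell 0 x0) (f x `^ p * v x)%:E.
Proof.
move=> p1 t0; set D := cell 0 x0.
have mD : measurable D by exact: measurable_cell.
set c : R := (1 - p^-1)%R; set e := (c / 2)%R.
have c0 : (0 < c)%R by rewrite subr_gt0 invf_lt1//; lra.
have e0 : (0 < e)%R by rewrite divr_gt0.
pose b x := Num.min (running_max (avg v f ^~ x) N) t.
have b0 x : (0 <= b x)%R.
  by rewrite le_min t0 andbT; apply: running_max_ge0 => k; exact: avg_ge0.
have mb : measurable_fun setT b.
  by apply: measurable_minr => //; exact: measurable_running_max.
have mbp q : measurable_fun setT (fun x => b x `^ q)%R.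
  exact: measurableT_comp (measurable_powR _) mb.
have mfp q : measurable_fun setT (fun x => f x `^ q)%R.
  exact: measurableT_comp (measurable_powR _) mf.
have mbv : measurable_fun D (fun x => b x `^ p * v x)%R.
  by apply: measurable_funTS; apply: measurable_funM.
have mfvp : measurable_fun D (fun x => f x `^ p * v x)%R.
  by apply: measurable_funTS; apply: measurable_funM.
pose h k x : R := (\1_D x * max_incr p t (avg v f ^~ x) k)%R.
have X0 x k : (0 <= avg v f k x)%R by exact: avg_ge0.
have h0 k x : (0 <= h k x)%R by rewrite mulr_ge0// max_incr_ge0.
have hc k : lconst k (h k).
  move=> x y xy; rewrite /h (@lconst_max_incr p t k x y)//; congr (_ * _)%R.
  rewrite !indicE; congr ((nat_of_bool _)%:R); apply/idP/idP; rewrite !inE /D /cell /=;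
    by rewrite (pi_le (leq0n k) xy).
have mh k : measurable_fun setT (h k) by exact: lconst_measurable (hc k).
set A := \int[mu]_(x in D) _; set B := \int[mu]_(x in D) _.
have Afin : A \is a fin_num.
  apply: (@integral_EFin_fin _ _ (t `^ p) 0 x0) => // y.
  rewrite powR_ge0 /= -/(b y); apply: ge0_ler_powR; rewrite ?nnegrE ?b0//; first lra.
  by rewrite /b ge_min lexx orbT.
have key : c%:E * A <= e%:E * A + (e `^ (1 - p))%:E * B.
  have -> : c%:E * A = \int[mu]_x (\1_D x * (c * (b x `^ p * v x)))%:E.
    rewrite integral_EFin_indic integral_EFinZ//.
    - exact: ltW.
    - by move=> x; rewrite mulr_ge0 ?powR_ge0.
  apply: (@le_trans _ _
      (\int[mu]_x (\sum_(k < N.+1) (h k x * avg v f k x * v x))%:E)).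
    apply: le_integral_EFin => x _.
      by rewrite mulr_ge0// mulr_ge0 ?(ltW c0)// mulr_ge0 ?powR_ge0.
    rewrite -mulr_suml (_ : _ * (c * _) = \1_D x * (c * b x `^ p) * v x)%R; last first.
      by rewrite !mulrA.
    apply: ler_wpM2r => //.
    under eq_bigr do rewrite /h -mulrA [X in (_ * X)%R]mulrC.
    rewrite -mulr_sumr; apply: ler_wpM2l => //; exact: doob_trajectory.
  have mall k : measurable_fun setT (fun x => h k x * avg v f k x * v x)%R.
    by do 2?apply: measurable_funM => //; exact: measurable_avg.
  rewrite integral_EFin_sum//; last first.
    by move=> k x; rewrite mulr_ge0// mulr_ge0.
  under eq_bigr do rewrite integral_avg//.
  rewrite -integral_EFin_sum//; last 2 first.
  - by move=> k; do 2?apply: measurable_funM.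
  - by move=> k x; rewrite mulr_ge0// mulr_ge0.
  apply: (@le_trans _ _ (\int[mu]_(x in D)
      (e * (b x `^ p * v x) + e `^ (1 - p) * (f x `^ p * v x))%:E)).
    rewrite -[leRHS]integral_EFin_indic; apply: le_integral_EFin => x _.
      by apply: sumr_ge0 => k _; rewrite mulr_ge0// mulr_ge0.
    rewrite -2!mulr_suml /h -mulr_sumr sum_max_incr -/(b x) -!mulrA.
    apply: ler_wpM2l => //; rewrite !mulrA -mulrDl; apply: ler_wpM2r => //.
    have [fb|bf] := leP (f x) (e * b x)%R.
      apply: (@le_trans _ _ (e * b x `^ p)%R).
        rewrite mulrC -(@mulr_powRB1 _ (b x) p)// ?mulrA; [|lra].
        by rewrite ler_wpM2r ?powR_ge0.
      by rewrite lerDl mulr_ge0 ?powR_ge0.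
    apply: (@le_trans _ _ (e `^ (1 - p) * f x `^ p)%R); last first.
      by rewrite lerDr mulr_ge0 ?powR_ge0// ltW.
    rewrite -(@mulr_powRB1 _ (f x) p)//; last lra.
    rewrite mulrCA mulrC; apply: ler_wpM2l => //.
    rewrite -(opprB p 1%R) powRN ler_pdivlMl ?powR_gt0// -powRM// ?(ltW e0)//.
    by apply: ge0_ler_powR; rewrite ?nnegrE ?mulr_ge0 ?(ltW e0) ?(ltW bf)//; lra.
  rewrite integral_EFinD//; last 4 first.
  - exact: measurable_funM.
  - exact: measurable_funM.
  - by move=> x; rewrite mulr_ge0 ?(ltW e0)// mulr_ge0 ?powR_ge0.
  - by move=> x; rewrite mulr_ge0 ?powR_ge0// mulr_ge0 ?powR_ge0.
  rewrite !integral_EFinZ//.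
  - exact: powR_ge0.
  - by move=> x; rewrite mulr_ge0 ?powR_ge0.
  - exact: ltW.
  - by move=> x; rewrite mulr_ge0 ?powR_ge0.
have : e%:E * A <= (e `^ (1 - p))%:E * B.
  rewrite -(@leeD2lE _ (e%:E * A)) ?fin_numM//.
  apply: le_trans key; rewrite -muleDl//.
  by rewrite -EFinD /e (_ : c / 2 + c / 2 = c)%R//; lra.
move=> eA; rewrite -(@lee_pmul2l _ e%:E) ?lte_fin// muleA -EFinM.
rewrite -[X in (X * _)%R]powRr1 ?(ltW e0)// -powRD//.
by apply/implyP => _; rewrite gt_eqF.
Qed.

(** The constant of [doob_truncated] involves neither the height nor the cell, so the height tends
    to infinity and the cells of level 0 are added up. *)
Lemma doob p N : (1 < p)%R ->
  \int[mu]_x (running_max (avg v f ^~ x) N `^ p * v x)%:E <=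
  (((1 - p^-1) / 2) `^ (- p))%:E * \int[mu]_x (f x `^ p * v x)%:E.
Proof.
move=> p1.
have M0 x : (0 <= running_max (avg v f ^~ x) N)%R.
  by apply: running_max_ge0 => k; exact: avg_ge0.
have mfp : measurable_fun setT (fun x => f x `^ p * v x)%R.
  exact: measurable_funM (measurableT_comp (measurable_powR _) mf) mv.
rewrite -integral_EFinZ//; [|exact: powR_ge0|by move=> x; rewrite mulr_ge0 ?powR_ge0].
apply: (@le_integral_cellwise 0).
- apply/measurable_EFinP/measurable_funM => //.
  exact: measurableT_comp (measurable_powR _) (measurable_running_max N).
- by apply/measurable_EFinP; exact: measurable_funM.
- by move=> x; rewrite lee_fin mulr_ge0 ?powR_ge0.
- by move=> x; rewrite lee_fin !mulr_ge0 ?powR_ge0.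
move=> x0; have mD := measurable_cell 0 x0.
rewrite integral_EFinZ ?powR_ge0//; last 2 first.
- exact: measurable_funS mfp.
- by move=> x; rewrite mulr_ge0 ?powR_ge0.
rewrite -[leLHS]integral_EFin_indic//.
apply: (@integral_le_of_monotone_approx _ _ _ _ _ (fun j x =>
   (\1_(cell 0 x0) x * (Num.min (running_max (avg v f ^~ x) N) j%:R `^ p * v x))%:E)).
- by move=> x; rewrite lee_fin !mulr_ge0 ?powR_ge0.
- move=> j; apply/measurable_EFinP/measurable_funM => //.
  apply/measurable_funM => //; apply: measurableT_comp (measurable_powR _) _.
  by apply: measurable_minr => //; exact: measurable_running_max.
- by move=> j x; rewrite lee_fin !mulr_ge0 ?powR_ge0.
- move=> x i j ij; rewrite lee_fin; apply: ler_wpM2l => //.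
  apply: ler_wpM2r => //; apply: ge0_ler_powR; rewrite ?nnegrE ?le_min ?M0 ?ler0n//.
    lra.
  by rewrite !ge_min lexx /= ler_nat ij orbT.
- move=> x; set M := running_max _ _.
  apply: (@le_trans _ _ (\1_(cell 0 x0) x *
      (Num.min M (Num.truncn M).+1%:R `^ p * v x))%:E); last first.
    by apply: ereal_sup_ubound; exists (Num.truncn M).+1.
  by rewrite (min_idPl _)// ltW// truncnS_gt.
- by move=> j; rewrite integral_EFin_indic; exact: doob_truncated.
Qed.

End density.

End filtration.

(** * Stopping and sparse cells *)

Section stopping.
Context (R : realType).
Implicit Types (a : R) (c : nat -> R).

(** The Calderon-Zygmund choice of principal cells, read along one chain: [stop] remembers the value
    of [c] at the latest stopping time up to [k]. Time 0 always stops. *)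
Fixpoint stop a c (k : nat) : R :=
  if k is l.+1 then (if a * stop a c l < c k then c k else stop a c l) else c 0.

Definition stopping a c (k : nat) : bool :=
  if k is l.+1 then a * stop a c l < c k else true.

Definition last_stopping a c (k N : nat) : bool :=
  [forall j : 'I_N.+1, (k < j)%N ==> ~~ stopping a c j].

Definition next_stopping a c (k l : nat) : bool :=
  [&& (k < l)%N, stopping a c l & [forall j : 'I_l, (k < j)%N ==> ~~ stopping a c j]].

Lemma stop_stopping a c k : stopping a c k -> stop a c k = c k.
Proof. by case: k => //= k ->. Qed.

Lemma eq_stop a c c' k : (forall j, (j <= k)%N -> c j = c' j) ->
  stop a c k = stop a c' k.
Proof.
elim: k => [|k ih] cc /=; first exact: cc.
by rewrite cc// ih// => j jk; apply: cc; exact: leqW.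
Qed.

Lemma eq_stopping a c c' k : (forall j, (j <= k)%N -> c j = c' j) ->
  stopping a c k = stopping a c' k.
Proof.
case: k => //= k cc; rewrite cc// (@eq_stop _ _ c')// => j jk.
by apply: cc; exact: leqW.
Qed.

Lemma eq_last_stopping a c c' k N : (forall j, (j <= N)%N -> c j = c' j) ->
  last_stopping a c k N = last_stopping a c' k N.
Proof.
move=> cc; apply: eq_forallb => j; rewrite (@eq_stopping _ _ c')// => i ij.
by apply: cc; rewrite (leq_trans ij)// -ltnS.
Qed.

Lemma eq_next_stopping a c c' k l : (forall j, (j <= l)%N -> c j = c' j) ->
  next_stopping a c k l = next_stopping a c' k l.
Proof.
move=> cc; rewrite /next_stopping (@eq_stopping _ _ c')//; congr [&& _, _ & _].
apply: eq_forallb => j; rewrite (@eq_stopping _ _ c')// => i ij.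
by apply: cc; rewrite (leq_trans ij)// ltnW.
Qed.

Section nonneg.
Variables (a : R) (c : nat -> R).
Hypotheses (a_ge1 : 1 <= a) (c_ge0 : forall k, 0 <= c k).

Lemma le_stop k : c k <= a * stop a c k.
Proof.
case: k => [|k] /=; first by rewrite ler_peMl.
by case: ifPn; rewrite -?leNgt// => _; rewrite ler_peMl.
Qed.

Lemma stop_le_sum k : stop a c k <= \sum_(l < k.+1) (stopping a c l)%:R * c l.
Proof.
elim: k => [|k ih]; first by rewrite big_ord1 /= mul1r.
rewrite big_ord_recr /=; case: ifP => _; last by rewrite mul0r addr0.
by rewrite mul1r lerDr sumr_ge0// => i _; rewrite mulr_ge0.
Qed.

(** Each [c k] is at most [a] times the latest stopped value, hence [a] times the sum of all stopped
    [c l] with l <= k. After exchanging the sums, [c l] is multiplied by the tail of [g] from [l],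
    which is at most [G * g l]. *)
Lemma sum_le_stopping (g : nat -> R) (G : R) N :
  (forall k, 0 <= g k) ->
  (forall l, (l <= N)%N -> \sum_(l <= k < N.+1) g k <= G * g l) ->
  \sum_(k < N.+1) g k * c k <=
  a * G * \sum_(k < N.+1) (stopping a c k)%:R * (g k * c k).
Proof.
move=> g0 gG.
apply: (@le_trans _ _ (\sum_(k < N.+1) \sum_(l < N.+1 | (l <= k)%N)
    a * ((stopping a c l)%:R * (g k * c l)))).
  apply: ler_sum => k _.
  rewrite -mulr_sumr (le_trans (ler_wpM2l (g0 k) (le_stop k)))//.
  rewrite mulrCA ler_wpM2l//; first by rewrite (le_trans _ a_ge1).
  apply: (le_trans (ler_wpM2l (g0 k) (stop_le_sum k))); rewrite mulr_sumr.
  rewrite (@big_ord_widen _ _ _ _ N.+1 (fun l => g k * ((stopping a c l)%:R * c l)))//.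
  rewrite le_eqVlt; apply/orP; left; apply/eqP.
  by apply: eq_big => [l|l _]; rewrite ?ltnS// mulrCA.
rewrite (exchange_big_dep xpredT)//= -mulrA mulr_sumr mulr_sumr.
apply: ler_sum => l _; rewrite -mulr_sumr ler_wpM2l//.
  by rewrite (le_trans _ a_ge1).
rewrite mulrCA -mulr_sumr ler_wpM2l// mulrA -mulr_suml ler_wpM2r//.
apply: le_trans (gG l _); last by rewrite -ltnS.
rewrite le_eqVlt; apply/orP; left; apply/eqP.
by rewrite big_geq_mkord.
Qed.

(** Of two stopping times the earlier one is not the last, so at most one summand is nonzero. This
    is the disjointness of the remaining halves along a chain. *)
Lemma sum_last_stopping N (y : nat -> R) M : 0 <= M ->
  (forall k, (k <= N)%N -> y k <= M) ->
  \sum_(k < N.+1) (stopping a c k && last_stopping a c k N)%:R * y k <= M.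
Proof.
move=> M0 yM.
case: (pickP (fun k : 'I_N.+1 => stopping a c k && last_stopping a c k N)) => [k|no].
  move=> /[dup] kk /andP[sk /forallP lk]; rewrite (bigD1 k)//= kk mul1r big1 ?addr0.
    by apply: yM; rewrite -ltnS.
  move=> l lk'; apply/eqP; rewrite mulf_eq0; apply/orP; left; rewrite pnatr_eq0 eqb0.
  apply/negP => /andP[sl /forallP ll].
  have [lk0|kl|/val_inj lk0] := ltngtP l k; last by rewrite lk0 eqxx in lk'.
    by have /implyP/(_ lk0) := ll k; rewrite sk.
  by have /implyP/(_ kl) := lk l; rewrite sl.
by rewrite big1// => k _; rewrite no mul0r.
Qed.

Lemma sum_next_stopping k N (y : nat -> R) M : 0 <= M ->
  (forall l, (l <= N)%N -> y l <= M) ->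
  \sum_(l < N.+1) (next_stopping a c k l)%:R * y l <= M.
Proof.
move=> M0 yM.
case: (pickP (fun l : 'I_N.+1 => next_stopping a c k l)) => [l|no]; last first.
  by rewrite big1// => l _; rewrite no mul0r.
move=> /[dup] ll /and3P[kl sl /forallP lk]; rewrite (bigD1 l)//= ll mul1r big1 ?addr0.
  by apply: yM; rewrite -ltnS.
move=> j jl; apply/eqP; rewrite mulf_eq0; apply/orP; left; rewrite pnatr_eq0 eqb0.
apply/negP => /and3P[kj sj /forallP jk].
have [lj|lj|/val_inj lj] := ltngtP l j; last by rewrite lj eqxx in jl.
  by have /implyP/(_ kl) := jk (Ordinal lj); rewrite sl.
by have /implyP/(_ kj) := lk (Ordinal lj); rewrite sj.
Qed.

Lemma exists_next_stopping k N : ~~ last_stopping a c k N ->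
  exists2 l : 'I_N.+1, next_stopping a c k l & true.
Proof.
rewrite negb_forall => /existsP[j]; rewrite negb_imply negbK => /andP[kj sj].
pose P l := (k < l)%N && stopping a c l.
have exP : exists l, P l by exists (val j); rewrite /P kj.
have lj : (ex_minn exP < N.+1)%N.
  case: ex_minnP => l _ /(_ (val j)); rewrite /P kj sj => /(_ isT) lj.
  exact: leq_ltn_trans lj (ltn_ord j).
exists (Ordinal lj) => //; rewrite /next_stopping /=.
case: ex_minnP => l /andP[kl sl] lmin; rewrite kl sl /=.
apply/forallP => i; apply/implyP => ki; apply/negP => si.
by have := lmin i; rewrite /P ki si => /(_ isT); rewrite leqNgt ltn_ord.
Qed.

(** Nothing stops strictly between [k] and [l], so [stop] still has the value [c k] when [l] is
    tested. *)
Lemma next_stopping_gt k l : stopping a c k -> next_stopping a c k l ->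
  a * c k < c l.
Proof.
move=> sk /and3P[kl sl /forallP nl]; case: l kl sl nl => // l kl sl nl.
suff <- : stop a c l = c k by [].
rewrite -(stop_stopping sk); have {kl} := kl; rewrite ltnS.
have {}nl j : (k < j <= l)%N -> ~~ stopping a c j.
  by move=> /andP[kj jl]; have /implyP/(_ kj) := nl (Ordinal (jl : (j < l.+1)%N)).
elim: l {sl} nl => [|l ih] nl; first by rewrite leqn0 => /eqP ->.
rewrite leq_eqVlt => /predU1P[->//|kl]; rewrite -[RHS]ih//.
  by have := nl l.+1; rewrite kl leqnn => /(_ isT) /=; case: ifP.
by move=> j /andP[kj jl]; rewrite nl// kj leqW.
Qed.

End nonneg.
End stopping.

(** If the sum were below [B], so would be each of the nonnegative factors. *)
Lemma le_sum_of_le_prod (R : realType) (m : nat) (B : R) (z : 'I_m -> R) :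
  (0 < m)%N -> 0 <= B -> (forall i, 0 <= z i) ->
  B ^+ m <= \prod_i z i -> B <= \sum_i z i.
Proof.
move=> m0 B0 z0 Bz; rewrite leNgt; apply/negP => zB.
suff : \prod_i z i < B ^+ m by rewrite ltNge Bz.
apply: (@le_lt_trans _ _ ((\sum_i z i) ^+ m)).
  rewrite -[X in _ ^+ X]card_ord -prodr_const; apply: ler_prod => i _.
  by rewrite z0 (bigD1 i)//= lerDl sumr_ge0.
by rewrite ltrXn2r// ?sumr_ge0// -lt0n.
Qed.

Section sparse.
Context d (T : measurableType d) (R : realType).
Variables (mu : {measure set T -> \bar R}) (pi : nat -> T -> nat).
Hypothesis measurable_pi : forall k i, measurable [set x | pi k x = i].
Hypothesis refine_pi : forall k x y, pi k.+1 x = pi k.+1 y -> pi k x = pi k y.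
Hypothesis cell_gt0 : forall k x, (0 < mu (cell pi k x))%E.
Hypothesis cell_fin : forall k x, (mu (cell pi k x) < +oo)%E.

Local Notation cell := (cell pi).
Local Notation lconst := (lconst pi).
Let one : T -> R := fun=> 1.
Let mone : measurable_fun setT one. Proof. exact: measurable_cst. Qed.

Lemma cint_one k x : cint mu pi one k x = mu (cell k x).
Proof. by rewrite -[RHS]mul1e -integral_cst//; exact: measurable_cell. Qed.

Lemma mass_one k x : (mass mu pi one k x)%:E = mu (cell k x).
Proof. by rewrite massE ?cint_one// => l y; rewrite cint_one. Qed.

Lemma mass_one_gt0 k x : 0 < mass mu pi one k x.
Proof. by apply: mass_gt0 => // l y; rewrite cint_one. Qed.

Variables (m : nat) (F : 'I_m -> T -> R).
Hypothesis m_gt0 : (0 < m)%N.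
Hypothesis mF : forall i, measurable_fun setT (F i).
Hypothesis F_ge0 : forall i x, 0 <= F i x.
Hypothesis cint_F : forall i k x, (cint mu pi (F i) k x < +oo)%E.

Definition prod_avg x k : R := \prod_(i < m) avg mu pi one (F i) k x.
(** A factor 2m for each of the [m] averages: each then accounts for at most the fraction 1/(2m) of
    a stopped cell, which leaves one half. *)
Definition stop_ratio : R := (2 * m%:R) ^+ m.

Local Notation a := stop_ratio.
Local Notation c := prod_avg.

Let cint_F1 i k x : (cint mu pi (fun y => F i y * one y)%R k x < +oo)%E.
Proof.
by rewrite (_ : (fun y => _) = F i) ?cint_F//; apply/funext => y; rewrite mulr1.
Qed.

Let A_ge0 i k x : 0 <= avg mu pi one (F i) k x.
Proof. exact: avg_ge0. Qed.

Lemma prod_avg_ge0 x k : 0 <= c x k.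
Proof. exact: prodr_ge0. Qed.

Lemma stop_ratio_ge1 : 1 <= a.
Proof.
by apply: exprn_ege1; rewrite -natrM ler1n muln_gt0.
Qed.

Lemma lconst_prod_avg k : lconst k (c ^~ k).
Proof.
by move=> x y xy; apply: eq_bigr => i _; exact: lconst_avg xy.
Qed.

Lemma eq_prod_avg k l x y : pi l x = pi l y -> (k <= l)%N -> c x k = c y k.
Proof. by move=> xy kl; apply: lconst_prod_avg; exact: pi_le xy. Qed.

Lemma lconst_stopping k : lconst k (fun x => stopping a (c x) k).
Proof. by move=> x y xy; apply: eq_stopping => j jk; exact: eq_prod_avg xy _. Qed.

Lemma lconst_last k N : lconst N (fun x => last_stopping a (c x) k N).
Proof. by move=> x y xy; apply: eq_last_stopping => j; exact: eq_prod_avg. Qed.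

Lemma lconst_next k l : lconst l (fun x => next_stopping a (c x) k l).
Proof. by move=> x y xy; apply: eq_next_stopping => j; exact: eq_prod_avg. Qed.

Lemma measurable_last k N : measurable [set x | last_stopping a (c x) k N].
Proof.
have := @lconst_measurable _ _ _ measurable_pi N _ _ setT _ (@lconst_last k N).
move=> /(_ measurableT [set true] I); rewrite setTI; congr measurable.
Qed.

(** The product of the growth ratios of the averages exceeds (2m)^m, so these ratios divided by 2m
    add up to at least 1. Passing from the product to a sum makes the condition linear and ready for
    integration. *)
Lemma next_stopping_sum_avg k l x y : stopping a (c y) k -> 0 < c y k ->
  pi k x = pi k y -> next_stopping a (c x) k l ->
  1 <= \sum_i (2 * m%:R * avg mu pi one (F i) k y)^-1 * avg mu pi one (F i) l x.
Proof.
move=> sk ck xy nl.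
have Ak i : 0 < avg mu pi one (F i) k y.
  by rewrite lt_neqAle A_ge0 andbT eq_sym; move/lt0r_neq0/prodf_neq0 : ck; exact.
have m2 : 0 < 2 * m%:R :> R by rewrite mulr_gt0// ltr0n.
apply: le_sum_of_le_prod => //.
  by move=> i; rewrite mulr_ge0// invr_ge0 mulr_ge0// ltW.
have cE : c x k = c y k by exact: eq_prod_avg xy _.
have := next_stopping_gt (c := c x) (k := k) _ nl.
rewrite cE (lconst_stopping xy) => /(_ sk)/ltW lcl.
rewrite expr1n big_split/= prodfV big_split /= prodr_const card_ord -/(c x l).
by rewrite mulrC ler_pdivlMr ?mul1r// mulr_gt0// exprn_gt0.
Qed.

(** The inequality of [next_stopping_sum_avg] is integrated over the points of the cell that stop
    again. The tower property turns the averages at the next stopping time back into [F i], so slot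
    i contributes at most |Q| / (2m). *)
Lemma half_last_stopping k N y : (k <= N)%N -> stopping a (c y) k -> 0 < c y k ->
  (mu (cell k y) <=
   2%:E * mu (cell k y `&` [set x | last_stopping a (c x) k N]))%E.
Proof.
move=> kN sk ck; set D := cell k y; set E := [set x | _].
have mD : measurable D by exact: measurable_cell.
have mE : measurable E by exact: measurable_last.
have Ak i : 0 < avg mu pi one (F i) k y.
  by rewrite lt_neqAle A_ge0 andbT eq_sym; move/lt0r_neq0/prodf_neq0 : ck; exact.
have m2 : 0 < 2 * m%:R :> R by rewrite mulr_gt0// ltr0n.
pose w i := (2 * m%:R * avg mu pi one (F i) k y)^-1.
have w0 i : 0 <= w i by rewrite invr_ge0 mulr_ge0// ltW.
(* The part of the cell whose next stopping time is [l]; it is empty for l <= k and a union of cells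
   of level [l] otherwise. *)
pose h (l : nat) x : R := \1_D x * (next_stopping a (c x) k l)%:R.
have h0 l x : 0 <= h l x by rewrite mulr_ge0.
have hc l : (k <= l)%N -> lconst l (h l).
  move=> kl x z xz; rewrite /h (@lconst_next k l x z)//; congr (_ * _).
  by rewrite !indicE; congr ((nat_of_bool _)%:R); apply/idP/idP; rewrite !inE /D
    /cell /= (pi_le refine_pi kl xz).
have hlt l x : (l <= k)%N -> h l x = 0.
  by rewrite /h /next_stopping ltnNge => -> /=; rewrite mulr0.
have mh l : measurable_fun setT (h l).
  have [kl|/ltnW lk] := leqP k l; first exact: lconst_measurable (hc _ kl).
  by rewrite (_ : h l = cst 0)//; apply/funext => x; exact: hlt.
have mA i l : measurable_fun setT (avg mu pi one (F i) l) by exact: measurable_avg.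
have step i : (\int[mu]_x (\sum_(l < N.+1) h l x * avg mu pi one (F i) l x)%:E <=
               cint mu pi (F i) k y)%E.
  rewrite integral_EFin_sum//; last 2 first.
  - by move=> l; exact: measurable_funM.
  - by move=> l x; rewrite mulr_ge0.
  have tow (l : nat) : (\int[mu]_x (h l x * avg mu pi one (F i) l x)%:E =
      \int[mu]_x (h l x * F i x)%:E)%E.
    have [kl|/ltnW lk] := leqP k l; last first.
      by apply: eq_integral => x _; rewrite hlt// !mul0r.
    transitivity (\int[mu]_x (h l x * avg mu pi one (F i) l x * one x)%:E)%E.
      by apply: eq_integral => x _; rewrite mulr1.
    rewrite integral_avg//.
    - by apply: eq_integral => x _; rewrite mulr1.
    - by move=> j x; rewrite cint_one.
    - exact: hc.
  under eq_bigr do rewrite tow.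
  rewrite -integral_EFin_sum//; last 2 first.
  - by move=> l; exact: measurable_funM.
  - by move=> l x; rewrite mulr_ge0.
  rewrite /cint -[leRHS]integral_EFin_indic//; apply: le_integral_EFin => x _.
    by apply: sumr_ge0 => l _; rewrite mulr_ge0.
  rewrite /h; under eq_bigr do rewrite -mulrA.
  rewrite -mulr_sumr ler_wpM2l//.
  by apply: (@sum_next_stopping _ a (c x) k N (fun=> F i x)).
have DE : (mu (D `\` E) <= (2^-1)%:E * mu D)%E.
  have mDE : measurable (D `\` E) by exact: measurableD.
  rewrite -[leLHS]mul1e -(integral_cst mu mDE) -[leLHS]integral_EFin_indic//.
  apply: (@le_trans _ _ (\int[mu]_x (\sum_i w i *
      (\sum_(l < N.+1) h l x * avg mu pi one (F i) l x))%:E)%E).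
    apply: le_integral_EFin => x _; first by rewrite mulr_ge0.
    have S0 : 0 <= \sum_i w i * \sum_(l < N.+1) h l x * avg mu pi one (F i) l x.
      apply: sumr_ge0 => i _; rewrite mulr_ge0// sumr_ge0// => l _.
      by rewrite mulr_ge0.
    rewrite mulr1 indicE; case: (boolP (x \in D `\` E)) => // /set_mem[Dx nEx] /=.
    have [l nl _] : exists2 l : 'I_N.+1, next_stopping a (c x) k l & true.
      by apply: exists_next_stopping; apply/negP.
    have := next_stopping_sum_avg sk ck Dx nl => /le_trans; apply.
    apply: ler_sum => i _; apply: ler_wpM2l; first exact: w0.
    rewrite (bigD1 l)//= /h nl mulr1 indicE mem_set// mul1r lerDl.
    by apply: sumr_ge0 => j _; rewrite mulr_ge0// mulr_ge0.
  have mS i : measurable_fun setT (fun x => \sum_(l < N.+1) h l x * avg mu pi one (F i) l x).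
    by apply: measurable_sum => l; exact: measurable_funM.
  have S0 i x : 0 <= \sum_(l < N.+1) h l x * avg mu pi one (F i) l x.
    by rewrite sumr_ge0// => l _; rewrite mulr_ge0.
  rewrite integral_EFin_sum//; last 2 first.
  - by move=> i; exact: measurable_funM.
  - by move=> i x; rewrite mulr_ge0.
  rewrite -mass_one -EFinM.
  apply: (@le_trans _ _ (\sum_(i < m) (w i * (avg mu pi one (F i) k y * mass mu pi one k y))%:E)%E).
    apply: lee_sum => i _; rewrite integral_EFinZ// EFinM.
    apply: lee_wpmul2l; first by rewrite lee_fin.
    apply: le_trans (step i) _.
    rewrite /avg divfK ?gt_eqF ?mass_one_gt0//.
    rewrite (_ : (fun y0 => _) = F i); last by apply/funext => z; rewrite mulr1.
    by rewrite fineK// ge0_fin_numE// integral_EFin_ge0.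
  rewrite sumEFin lee_fin /w.
  rewrite (eq_bigr (fun=> (2 * m%:R)^-1 * mass mu pi one k y)); last first.
    move=> i _; have := Ak i; move: (avg _ _ _ _ _ _) (mass _ _ _ _ _) => u v u0.
    by field; rewrite (gt_eqF u0) pnatr_eq0 -lt0n m_gt0.
  rewrite sumr_const card_ord -mulr_natr.
  rewrite le_eqVlt; apply/orP; left; apply/eqP.
  by field;  rewrite pnatr_eq0 -lt0n m_gt0.
have DI : mu (D `&` E) \is a fin_num.
  rewrite ge0_fin_numE//; apply: le_lt_trans (cell_fin k y).
  by apply: le_measure; rewrite ?inE//; exact: measurableI.
have DD : mu (D `\` E) \is a fin_num.
  rewrite ge0_fin_numE//; apply: le_lt_trans (cell_fin k y).
  by apply: le_measure; rewrite ?inE//; exact: measurableD.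
have DS : mu D = (fine (mu (D `\` E)) + fine (mu (D `&` E)))%:E.
  by rewrite EFinD !fineK//; exact: measureDI.
move: DE; rewrite -[X in (X <= _)%E -> _](fineK DD) -[X in _ -> (_ <= _ * X)%E](fineK DI).
rewrite DS -!EFinM !lee_fin; lra.
Qed.

End sparse.

(** * Inequalities for the masses on a single cell *)

Section numeric.
Context (R : realType).

Lemma powR_expR (a t : R) : 0 < a -> a `^ t = expR (t * ln a).
Proof. by move=> a0; rewrite /powR gt_eqF. Qed.

Lemma prod_powR (M : nat) (a t : 'I_M -> R) : (forall i, 0 < a i) ->
  \prod_i a i `^ t i = expR (\sum_i t i * ln (a i)).
Proof.
by move=> a0; rewrite expR_sum; apply: eq_bigr => i _; rewrite powR_expR.
Qed.

Lemma powR_prod (I : Type) (r : seq I) (P : pred I) (x : I -> R) (t : R) :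
  (forall i, 0 <= x i) ->
  (\prod_(i <- r | P i) x i) `^ t = \prod_(i <- r | P i) x i `^ t.
Proof.
move=> x0; elim: r => [|i r ih]; first by rewrite !big_nil powR1.
by rewrite !big_cons; case: ifP => // _; rewrite powRM ?ih ?prodr_ge0.
Qed.

Lemma powR_sum (M : nat) (x : R) (e : 'I_M -> R) : 0 < x ->
  x `^ (\sum_i e i) = \prod_i x `^ e i.
Proof. by move=> x0; rewrite prod_powR// powR_expR// mulr_suml. Qed.

(** A crude weighted mean inequality, every factor being bounded by the sum; in place of Holder's
    inequality it costs only constants. *)
Lemma prod_powR_le (M : nat) (x e : 'I_M -> R) :
  (forall i, 0 <= x i) -> (forall i, 0 <= e i) ->
  \prod_i x i `^ e i <= (\sum_i x i) `^ (\sum_i e i).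
Proof.
move=> x0 e0; have X0 : 0 <= \sum_i x i by exact: sumr_ge0.
have xX i : x i <= \sum_i x i by rewrite (bigD1 i)//= lerDl sumr_ge0.
have [X1|X1] := ltP 0 (\sum_i x i).
  rewrite powR_sum//; apply: ler_prod => i _.
  by rewrite powR_ge0 ge0_ler_powR ?nnegrE.
(* All [x i] vanish here. Since 0 to the power 0 is 1, both sides are 1 if all exponents are 0;
   otherwise some factor on the left is 0. *)
have [E0|/eqP E0] := eqVneq (\sum_i e i) 0.
  rewrite E0 powRr0 big1// => i _.
  have -> : e i = 0.
    by apply/eqP; rewrite eq_le e0 -E0 (bigD1 i)//= lerDl sumr_ge0.
  by rewrite powRr0.
have [i ei] : exists i, e i != 0.
  apply/existsP; apply: contrapT => /negP; rewrite negb_exists => /forallP h.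
  by apply: E0; rewrite big1// => i _; apply/eqP; have := h i; rewrite negbK.
rewrite (bigD1 i)//= (_ : x i = 0) ?powR0// ?mul0r ?powR_ge0//.
by apply/eqP; rewrite eq_le x0 (le_trans (xX i)).
Qed.

(* For each slot [i], [a i] and [b i] are the masses of the [i]-th weight on a
   cell of volume [V] and on its portion of volume [VE]; the gain [K ^ rho]
   comes from the first product bound, and the exponents [d i] measure its
   surplus, which is absorbed by the second one. *)
Lemma cell_weight_bound (M : nat) (s e d a b : 'I_M -> R) (rho V VE K : R) :
  (0 < M)%N -> (forall i, 0 < s i) -> 1 <= rho ->
  (forall i, 0 <= e i) -> (forall i, 0 <= d i) ->
  (forall i, e i + d i = (rho - 1) * s i) ->
  0 < VE -> VE <= V -> V <= 2 * VE ->
  (forall i, 0 < b i) -> (forall i, b i <= a i) ->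
  \prod_i (a i / V) `^ s i <= K ->
  VE <= M%:R * \prod_i b i `^ (s i / \sum_j s j) ->
  V `^ (- \sum_i s i) * \prod_i a i `^ (e i + s i) <=
  (2 * M%:R) `^ ((rho - 1) * \sum_i s i) * K `^ rho * \prod_i b i `^ e i.
Proof.
move=> M0 s0 rho1 e0 d0 ed VE0 VEV V2 b0 ba HK HE.
have a0 i : 0 < a i by exact: lt_le_trans (ba i).
have V0 : 0 < V by exact: lt_le_trans VEV.
have MR0 : 0 < M%:R :> R by rewrite ltr0n.
have av0 i : 0 < a i / V by rewrite divr_gt0.
have K0 : 0 < K by apply: lt_le_trans HK; rewrite prodr_gt0// => i _; rewrite powR_gt0.
set S := \sum_i s i in HE *.
have S0 : 0 < S.
  by rewrite /S (bigD1 (Ordinal M0))//= ltr_wpDr// sumr_ge0// => i _; exact: ltW.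
rewrite !prod_powR// !powR_expR// ?mulr_gt0// -!expRD ler_expR.
move: HK HE; rewrite !prod_powR// => HK HE.
have {}HK : \sum_i s i * (ln (a i) - ln V) <= ln K.
  rewrite -ler_expR [leRHS]lnK//; apply: le_trans HK.
  by rewrite le_eqVlt; apply/orP; left; apply/eqP; congr expR; apply: eq_bigr => i _;
    rewrite ln_div// posrE.
have {}HE : ln VE <= ln M%:R + S^-1 * \sum_i s i * ln (b i).
  rewrite -ler_expR [X in X <= _]lnK// expRD lnK//.
  rewrite mulr_sumr; under [X in expR X]eq_bigr do rewrite mulrA (mulrC S^-1).
  exact: HE.
have {}VEV : ln VE <= ln V by rewrite ler_ln.
have {}V2 : ln V <= ln 2 + ln VE by rewrite -lnM ?posrE// ler_ln ?posrE ?mulr_gt0.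
have {}ba i : ln (b i) <= ln (a i) by rewrite ler_ln ?posrE.
rewrite [ln (2 * _)]lnM ?posrE//.
set l2 := ln 2 in V2 *; set lM := ln M%:R in HE *.
(* This exceeds the left side by the sum of d_i (ln a_i - ln b_i), which is nonnegative. It remains
   to use the first product bound [rho] times and the second one [rho - 1] times. *)
apply: (@le_trans _ _ (- S * ln V + (rho * \sum_i s i * (ln (a i) - ln V)
    + rho * (S * ln V) + \sum_i e i * ln (b i)
    - (rho - 1) * \sum_i s i * ln (b i)))).
  rewrite lerD2l /S mulr_suml !mulr_sumr -!big_split /= -sumrB.
  apply: ler_sum => i _; have -> : e i = (rho - 1) * s i - d i.
    by rewrite -ed addrK.
  rewrite -subr_ge0 (_ : _ - _ = d i * (ln (a i) - ln (b i))); last by ring.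
  by rewrite mulr_ge0// subr_ge0.
have h1 : rho * (\sum_i s i * (ln (a i) - ln V)) <= rho * ln K.
  by rewrite ler_wpM2l// (le_trans _ rho1).
have h2 : S * (ln V - l2 - lM) <= \sum_i s i * ln (b i).
  by rewrite -ler_pdivlMl//; lra.
have h3 : (rho - 1) * (S * (ln V - l2 - lM)) <= (rho - 1) * \sum_i s i * ln (b i).
  by rewrite ler_wpM2l// subr_ge0.
move: h1 h3; move: (\sum_i _) (\sum_i _) (\sum_i _) => x y z h1 h3.
lra.
Qed.

(* Holder-type summation of the cell bounds: a slot contributes
   [z i * b i] to the power [e i]. *)
Lemma cell_bound (M : nat) (s e d a b tau Y z D : 'I_M -> R) (rho V VE K : R) :
  (0 < M)%N -> (forall i, 0 < s i) -> 1 <= rho ->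
  (forall i, 0 <= e i) -> (forall i, 0 <= d i) ->
  (forall i, e i + d i = (rho - 1) * s i) ->
  0 < VE -> VE <= V -> V <= 2 * VE ->
  (forall i, 0 < b i) -> (forall i, b i <= a i) ->
  \prod_i (a i / V) `^ s i <= K ->
  VE <= M%:R * \prod_i b i `^ (s i / \sum_j s j) ->
  (forall i, 0 <= z i) -> (forall i, 0 <= Y i) -> (forall i, 0 <= D i) ->
  (forall i, a i `^ (tau i - (e i + s i)) * Y i <= D i * z i `^ e i) ->
  V `^ (- \sum_i s i) * \prod_i (a i `^ tau i * Y i) <=
  (2 * M%:R) `^ ((rho - 1) * \sum_i s i) * \prod_i D i * K `^ rho *
  (\sum_i z i * b i) `^ (\sum_i e i).
Proof.
move=> M0 s0 rho1 e0 d0 ed VE0 VEV V2 b0 ba HK HE z0 Y0 D0 HY.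
have a0 i : 0 < a i by exact: lt_le_trans (ba i).
have aY0 i : 0 <= a i `^ (tau i - (e i + s i)) * Y i by rewrite mulr_ge0 ?powR_ge0.
have := cell_weight_bound M0 s0 rho1 e0 d0 ed VE0 VEV V2 b0 ba HK HE.
set S := \sum_i s i; set C := (2 * M%:R) `^ _ => H.
(* The power [e i + s i] of the mass goes to [cell_weight_bound], and the rest is paid by [Y i]. *)
have -> : \prod_i (a i `^ tau i * Y i) =
    (\prod_i a i `^ (e i + s i)) * \prod_i (a i `^ (tau i - (e i + s i)) * Y i).
  rewrite -big_split /=; apply: eq_bigr => i _; rewrite mulrA -powRD.
    by rewrite addrC subrK.
  by apply/implyP => _; rewrite gt_eqF.
rewrite mulrA; apply: (@le_trans _ _ ((C * K `^ rho * \prod_i b i `^ e i) *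
    \prod_i (D i * z i `^ e i))).
  apply: ler_pM => //.
  - by rewrite mulr_ge0 ?powR_ge0// prodr_ge0// => i _; exact: powR_ge0.
  - by rewrite prodr_ge0.
  - by apply: ler_prod => i _; rewrite aY0 HY.
have zb : \prod_i (z i * b i) `^ e i = \prod_i z i `^ e i * \prod_i b i `^ e i.
  by rewrite -big_split /=; apply: eq_bigr => i _; rewrite powRM// ltW.
rewrite big_split /= (_ : _ * (_ * _) = C * \prod_i D i * K `^ rho *
    (\prod_i (z i * b i) `^ e i)); last by rewrite zb; ring.
apply: ler_wpM2l; first by rewrite !mulr_ge0 ?powR_ge0// prodr_ge0.
by apply: prod_powR_le => // i; rewrite mulr_ge0// ltW.
Qed.

End numeric.

Section measure_numeric.
Context d (T : measurableType d) (R : realType) (mu : {measure set T -> \bar R}).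

(** Holder's inequality for 1, written as the product of the v_i^(s_i/S): each v_i / b_i has
    integral 1 over [E], and a product of powers with exponents of sum 1 is at most the sum, whence
    the factor [M]. *)
Lemma measure_le_prod_mass (M : nat) (s : 'I_M -> R) (v : 'I_M -> T -> R)
    (E : set T) (b : 'I_M -> R) :
  (0 < M)%N -> (forall i, 0 < s i) ->
  (forall i, measurable_fun setT (v i)) -> (forall i x, 0 < v i x) ->
  (forall x, \prod_i v i x `^ s i = 1) -> measurable E ->
  (forall i, (\int[mu]_(x in E) (v i x)%:E)%E = (b i)%:E) -> (forall i, 0 < b i) ->
  (mu E <= (M%:R * \prod_i b i `^ (s i / \sum_j s j))%:E)%E.
Proof.
move=> M0 s0 mv v0 pv mE vb b0.
set S := \sum_i s i; set P := \prod_i _.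
have S0 : 0 < S.
  by rewrite /S (bigD1 (Ordinal M0))//= ltr_wpDr// sumr_ge0// => i _; exact: ltW.
have P0 : 0 <= P by apply: prodr_ge0 => i _; exact: powR_ge0.
have ptw x : 1 <= P * \sum_i (b i)^-1 * v i x.
  have x0 i : 0 <= (b i)^-1 * v i x by rewrite mulr_ge0 ?invr_ge0 ?ltW.
  have H : \prod_i ((b i)^-1 * v i x) `^ (s i / S) <= \sum_i (b i)^-1 * v i x.
    have e0 i : 0 <= s i / S by rewrite divr_ge0// ltW.
    have := prod_powR_le x0 e0; rewrite -mulr_suml divff ?gt_eqF// powRr1//.
    exact: sumr_ge0.
  apply: le_trans (ler_wpM2l P0 H).
  rewrite /P -big_split /= le_eqVlt; apply/orP; left; apply/eqP.
  transitivity ((\prod_i v i x `^ s i) `^ S^-1); first by rewrite pv powR1.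
  rewrite powR_prod; last by move=> i; exact: powR_ge0.
  apply: eq_bigr => i _; rewrite -powRrM -powRM ?mulr_ge0 ?invr_ge0 ?(ltW (b0 _)) ?(ltW (v0 _ _))//.
  by rewrite mulrA divff ?mul1r// gt_eqF.
rewrite -[leLHS]mul1e -(integral_cst mu mE).
apply: (@le_trans _ _ (\int[mu]_(x in E) (\sum_i P * ((b i)^-1 * v i x))%:E)%E).
  apply: le_integral_EFin => x _ //; apply: le_trans (ptw x) _.
  by rewrite mulr_sumr.
have mv1 i : measurable_fun E (v i) by exact: measurable_funTS.
have mbv i : measurable_fun E (fun x => (b i)^-1 * v i x) by exact: measurable_funM.
have v_ge0 i x : 0 <= v i x by exact: ltW.
have bV0 i : 0 <= (b i)^-1 by rewrite invr_ge0 ltW.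
have bv0 i x : 0 <= (b i)^-1 * v i x by exact: mulr_ge0.
rewrite integral_EFin_sum//; last 2 first.
- by move=> i; exact: measurable_funM.
- by move=> i x; exact: mulr_ge0.
rewrite (eq_bigr (fun=> P%:E)); last first.
  move=> i _; rewrite integral_EFinZ// integral_EFinZ// vb -!EFinM.
  by rewrite mulVf ?mulr1// gt_eqF.
by rewrite sumEFin sumr_const card_ord mulr_natl.
Qed.

End measure_numeric.

(** * The dyadic estimate *)

Section duality.
Context d (T : measurableType d) (R : realType) (mu : {measure set T -> \bar R}).

(** The converse of Holder's inequality. [H] is cut at height k and to the set [A k], so that its
    norm is finite before the bound is known; the test function is the power q - 1 of the cut
    function, normalised. *)
Lemma duality_bound (q B : R) (u H : T -> R) (A : nat -> set T) :
  1 < q -> 0 <= B ->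
  measurable_fun setT u -> (forall x, 0 <= u x) ->
  measurable_fun setT H -> (forall x, 0 <= H x) ->
  (forall k, measurable (A k)) -> nondecreasing_seq A -> \bigcup_k A k = setT ->
  (forall k, (\int[mu]_(x in A k) (u x)%:E < +oo)%E) ->
  (forall g : T -> R, measurable_fun setT g -> (forall x, 0 <= g x) ->
    (\int[mu]_x (g x `^ (q / (q - 1)) * u x)%:E <= 1)%E ->
    (\int[mu]_x (H x * g x * u x)%:E <= B%:E)%E) ->
  (\int[mu]_x (H x `^ q * u x)%:E <= (B `^ q)%:E)%E.
Proof.
move=> q1 B0 mu' u0 mH H0 mA ndA UA uA dual.
have q0 : 0 < q by lra.
have q10 : 0 < q - 1 by rewrite subr_gt0.
pose h k x := \1_(A k) x * Num.min (H x) k%:R.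
have h0 k x : 0 <= h k x by rewrite mulr_ge0// le_min H0 ler0n.
have mh k : measurable_fun setT (h k).
  by apply: measurable_funM => //; exact: measurable_minr.
have mhp k t : measurable_fun setT (fun x => h k x `^ t).
  exact: measurableT_comp (measurable_powR _) (mh k).
apply: (@integral_le_of_monotone_approx _ _ _ _ _ (fun k x => (h k x `^ q * u x)%:E)).
- by move=> x; rewrite lee_fin mulr_ge0 ?powR_ge0.
- by move=> k; apply/measurable_EFinP/measurable_funM.
- by move=> k x; rewrite lee_fin mulr_ge0 ?powR_ge0.
- move=> x i j ij; rewrite lee_fin ler_wpM2r// ge0_ler_powR ?nnegrE ?(ltW q0)//.
  rewrite ler_pM// ?le_min ?H0 ?ler0n//.
    rewrite !indicE ler_nat; case: (boolP (x \in A i)) => // /set_mem Aix.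
    by rewrite mem_set//; have /subsetPset := ndA _ _ ij; apply.
  by rewrite !ge_min lexx /= ler_nat ij orbT.
- move=> x; have [k _ Akx] : (\bigcup_k A k) x by rewrite UA.
  pose l := maxn k (Num.truncn (H x)).+1.
  apply: (@le_trans _ _ (h l x `^ q * u x)%:E); last first.
    by apply: ereal_sup_ubound; exists l.
  rewrite /h indicE mem_set ?mul1r; last first.
    have /subsetPset := ndA _ _ (leq_maxl k (Num.truncn (H x)).+1); exact.
  by rewrite (min_idPl _)// (le_trans (ltW (truncnS_gt _)))// ler_nat leq_maxr.
move=> k.
set X := (\int[mu]_x (h k x `^ q * u x)%:E)%E.
have X0 : (0 <= X)%E.
  by apply: integral_EFin_ge0 => x _; rewrite mulr_ge0 ?powR_ge0.
have Xfin : X \is a fin_num.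
  rewrite ge0_fin_numE//.
  apply: (@le_lt_trans _ _ (\int[mu]_x (\1_(A k) x * (k%:R `^ q * u x))%:E)%E).
    apply: le_integral_EFin => x _; first by rewrite mulr_ge0 ?powR_ge0.
    rewrite mulrA ler_wpM2r// /h indicE; case: (x \in A k); last first.
      by rewrite !mul0r powR0// gt_eqF.
    rewrite !mul1r ge0_ler_powR ?nnegrE ?(ltW q0) ?le_min ?H0 ?ler0n//.
    by rewrite ge_min lexx orbT.
  rewrite integral_EFin_indic// integral_EFinZ ?powR_ge0//; last first.
    exact: measurable_funTS.
  rewrite -(@fineK _ (\int[mu]_(x in A k) (u x)%:E)%E) -?EFinM ?ltry//.
  by rewrite ge0_fin_numE ?uA// integral_EFin_ge0.
rewrite -(fineK Xfin) lee_fin; set x0 := fine X.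
have x00 : 0 <= x0 by exact: fine_ge0.
have [->|xn0] := eqVneq x0 0; first exact: powR_ge0.
have xp : 0 < x0 by rewrite lt_neqAle eq_sym xn0.
(* The factor that gives the test function norm 1 in the dual space; [t * x0] is then the q-th root
   of [x0]. *)
pose t := x0 `^ (- (q - 1) / q).
have t0 : 0 <= t by exact: powR_ge0.
have int_h : (\int[mu]_x (h k x `^ q * u x)%:E = x0%:E)%E by rewrite fineK.
have := dual (fun x => t * h k x `^ (q - 1)) _ _ _.
have -> : (\int[mu]_x ((t * h k x `^ (q - 1)) `^ (q / (q - 1)) * u x)%:E = 1)%E.
  rewrite (eq_integral (fun x => (t `^ (q / (q - 1)) * (h k x `^ q * u x))%:E)).
    rewrite integral_EFinZ ?powR_ge0//; last 2 first.
    - exact: measurable_funM.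
    - by move=> x; rewrite mulr_ge0 ?powR_ge0.
    rewrite int_h -EFinM /t -powRrM -[X in _ * X]powRr1// -powRD; last first.
      by apply/implyP => _; rewrite gt_eqF.
    rewrite (_ : _ + _ = 0) ?powRr0//; field.
    by rewrite !gt_eqF.
  move=> x _ /=; have -> : h k x `^ q = (h k x `^ (q - 1)) `^ (q / (q - 1)).
    by rewrite -powRrM; congr (_ `^ _); field; rewrite gt_eqF.
  by rewrite powRM ?powR_ge0// mulrA.
move=> /(_ _ _ (lexx _)) /= D.
have {}D : ((t * x0)%:E <= B%:E)%E.
  apply: (@le_trans _ _ (\int[mu]_x (H x * (t * h k x `^ (q - 1)) * u x)%:E)%E); last first.
    apply: D; last by move=> x; rewrite mulr_ge0 ?powR_ge0.
    exact: measurable_funM.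
  rewrite EFinM -int_h -integral_EFinZ//; last 2 first.
  - exact: measurable_funM.
  - by move=> x; rewrite mulr_ge0 ?powR_ge0.
  apply: le_integral_EFin => x _; first by rewrite !mulr_ge0 ?powR_ge0.
  rewrite mulrA ler_wpM2r// mulrCA ler_wpM2l// -(mulr_powRB1 (h0 k x) q0).
  rewrite ler_wpM2r ?powR_ge0// /h indicE; case: (x \in A k).
    by rewrite mul1r ge_min lexx.
  by rewrite mul0r.
have tx : t * x0 = x0 `^ q^-1.
  rewrite /t -[X in _ * X]powRr1// -powRD; last first.
    by apply/implyP => _; rewrite gt_eqF.
  by congr (_ `^ _); field; rewrite gt_eqF.
move: D; rewrite lee_fin tx => D.
have -> : x0 = (x0 `^ q^-1) `^ q by rewrite -powRrM mulVf ?gt_eqF// powRr1.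
by rewrite ge0_ler_powR ?nnegrE ?powR_ge0// ltW.
Qed.

End duality.

(** * Norm bounds for the average on a cell *)

Section cell_norm.
Context d (T : measurableType d) (R : realType).
Variables (mu : {measure set T -> \bar R}) (pi : nat -> T -> nat).
Hypothesis measurable_pi : forall k i, measurable [set x | pi k x = i].
Hypothesis cell_gt0 : forall k x, (0 < mu (cell pi k x))%E.
Variables (v f : T -> R) (p : R).
Hypotheses (mv : measurable_fun setT v) (v_gt0 : forall x, 0 < v x).
Hypothesis cint_v : forall k x, (cint mu pi v k x < +oo)%E.
Hypotheses (mf : measurable_fun setT f) (f_ge0 : forall x, 0 <= f x).
Hypotheses (p_gt1 : 1 < p) (fp : (\int[mu]_x (f x `^ p * v x)%:E <= 1)%E).

(** Holder's inequality up to the constant 2, by comparing [f] with the height t = a^(-1/p) at which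
    the two contributions t a and t^(1-p) coincide. *)
Lemma cint_le_norm k x :
  (cint mu pi (fun y => f y * v y)%R k x <= (2 * mass mu pi v k x `^ (1 - p^-1))%:E)%E.
Proof.
have p0 : 0 < p by exact: lt_trans p_gt1.
have a0 := mass_gt0 measurable_pi mv v_gt0 cint_v cell_gt0 k x.
have aE := massE v_gt0 cint_v k x.
set a := mass mu pi v k x in a0 aE *.
have v0 y : 0 <= v y by exact: ltW.
have mD := measurable_cell measurable_pi k x.
set D := cell pi k x in mD *.
pose t := a `^ (- p^-1).
have t0 : 0 < t by exact: powR_gt0.
have mfp : measurable_fun setT (fun y => f y `^ p * v y).
  by apply: measurable_funM => //; exact: measurableT_comp (measurable_powR _) mf.
have mvD : measurable_fun D v by exact: measurable_funTS.
have mfD : measurable_fun D (fun y => f y `^ p * v y) by exact: measurable_funTS.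
apply: (@le_trans _ _ (\int[mu]_(y in D)
    (t * v y + t `^ (1 - p) * (f y `^ p * v y))%:E)%E).
  apply: le_integral_EFin => y _; first by rewrite mulr_ge0.
  rewrite mulrA -mulrDl ler_wpM2r//.
  have [ft|tf] := leP (f y) t.
    by rewrite (le_trans ft)// lerDl mulr_ge0 ?powR_ge0.
  apply: (@le_trans _ _ (t `^ (1 - p) * f y `^ p)); last by rewrite lerDr ltW.
  rewrite -(mulr_powRB1 (f_ge0 y) p0) mulrCA ler_peMr//.
  rewrite -(opprB p 1) powRN ler_pdivlMl ?powR_gt0// mulr1.
  by rewrite ge0_ler_powR ?nnegrE ?(ltW t0) ?(ltW tf) ?subr_ge0 ?(ltW p_gt1).
have tp0 : 0 <= t `^ (1 - p) by exact: powR_ge0.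
have fv0 y : 0 <= f y `^ p * v y by rewrite mulr_ge0 ?powR_ge0.
rewrite integral_EFinD//; last 4 first.
- by apply: measurable_funM.
- by apply: measurable_funM.
- by move=> y; rewrite mulr_ge0// ltW.
- by move=> y; rewrite mulr_ge0.
rewrite !integral_EFinZ ?(ltW t0)// -[X in (_ * X + _)%E]/(cint mu pi v k x) -aE.
apply: (@le_trans _ _ (t%:E * a%:E + (t `^ (1 - p))%:E * 1)%E).
  apply: leeD => //; apply: lee_wpmul2l; first by rewrite lee_fin.
  apply: le_trans fp; rewrite -integral_EFin_indic//.
  apply: le_integral_EFin => y _; first by rewrite mulr_ge0.
  by rewrite ler_piMl// indicE; case: (_ \in _).
rewrite mule1 -EFinM -EFinD lee_fin.
have -> : t * a = a `^ (1 - p^-1).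
  rewrite /t -[X in _ * X]powRr1 ?(ltW a0)// -powRD; last first.
    by apply/implyP => _; rewrite gt_eqF.
  by rewrite addrC.
have -> : t `^ (1 - p) = a `^ (1 - p^-1).
  by rewrite /t -powRrM; congr (_ `^ _); field; rewrite gt_eqF.
by rewrite mulr_natl.
Qed.

Lemma cint_lty_norm k x : (cint mu pi (fun y => f y * v y)%R k x < +oo)%E.
Proof. exact: le_lt_trans (cint_le_norm k x) (ltry _). Qed.

(** An average is at most 2 a^(-1/p), and the power p beta of this bound trades a^beta for a part of
    the average. The fractional gain is paid in this way, in the dominant slot only. *)
Lemma avg_norm_bound beta k x : 0 <= beta ->
  mass mu pi v k x `^ beta * avg mu pi v f k x <=
  2 `^ (p * beta) * (avg mu pi v f k x `^ p) `^ (p^-1 - beta).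
Proof.
move=> b0; have p0 : 0 < p by exact: lt_trans p_gt1.
have a0 := mass_gt0 measurable_pi mv v_gt0 cint_v cell_gt0 k x.
have y0 : 0 <= avg mu pi v f k x by exact: avg_ge0.
have : avg mu pi v f k x <= 2 * mass mu pi v k x `^ (- p^-1).
  rewrite /avg ler_pdivrMr// -mulrA -[X in _ <= _ * (_ * X)]powRr1 ?(ltW a0)//.
  rewrite -powRD; last by apply/implyP => _; rewrite gt_eqF.
  rewrite addrC -lee_fin fineK ?cint_le_norm//.
  by rewrite ge0_fin_numE ?cint_lty_norm// integral_EFin_ge0// => y _; rewrite mulr_ge0// ltW.
set a := mass mu pi v k x in a0 *; set y := avg _ _ _ _ _ _ in y0 * => ya.
move: y0; rewrite le_eqVlt => /predU1P[<-|yp].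
  by rewrite mulr0 mulr_ge0 ?powR_ge0.
rewrite -powRrM (_ : p * (p^-1 - beta) = 1 - p * beta); last first.
  by field; rewrite gt_eqF.
have yE : y = y `^ (p * beta) * y `^ (1 - p * beta).
  rewrite -powRD; last by apply/implyP => _; rewrite gt_eqF.
  by rewrite addrC subrK powRr1// ltW.
rewrite {1}yE mulrA ler_wpM2r ?powR_ge0//.
have : y `^ (p * beta) <= (2 * a `^ (- p^-1)) `^ (p * beta).
  by rewrite ge0_ler_powR ?nnegrE ?(ltW yp) ?mulr_ge0 ?powR_ge0 ?(ltW p0).
rewrite powRM ?powR_ge0// -powRrM (_ : - p^-1 * (p * beta) = - beta); last first.
  by field; rewrite gt_eqF.
by rewrite powRN ler_pdivlMr ?powR_gt0// mulrC.
Qed.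

End cell_norm.

Definition doob_const (R : realType) (p : R) : R := ((1 - p^-1) / 2) `^ (- p).

Lemma powR_sum_le (R : realType) (I : finType) (x : I -> R) (q : R) :
  0 < q <= 1 -> (forall i, 0 <= x i) -> (\sum_i x i) `^ q <= \sum_i x i `^ q.
Proof.
move=> /andP[q0 q1] x0; have X0 : 0 <= \sum_i x i by exact: sumr_ge0.
have S0 : 0 <= \sum_i x i `^ q by apply: sumr_ge0 => i _; exact: powR_ge0.
move: X0; rewrite le_eqVlt => /predU1P[<-|X0]; first by rewrite powR0// gt_eqF.
rewrite -[leLHS]mul1r -ler_pdivlMr ?powR_gt0// -(divff (lt0r_neq0 X0)).
rewrite !mulr_suml; apply: ler_sum => i _.
have xX : x i <= \sum_i x i by rewrite (bigD1 i)//= lerDl sumr_ge0.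
rewrite -powRN -(powR_inv1 (ltW X0)) (_ : _ `^ (- q) = ((\sum_i x i) `^ (-1)) `^ q).
  rewrite -powRM ?powR_ge0// powR_inv1 ?(ltW X0)//.
  have := x0 i; rewrite le_eqVlt => /predU1P[<-|xi0]; first by rewrite mul0r powR_ge0.
  by apply: ger1_powR => //; rewrite divr_gt0//= ler_pdivrMr// mul1r.
by rewrite -powRrM mulN1r.
Qed.

(** * The sum over stopped cells *)

Section dyadic_bound.
Context d (T : measurableType d) (R : realType).
Variables (mu : {measure set T -> \bar R}) (pi : nat -> T -> nat).
Hypothesis measurable_pi : forall k i, measurable [set x | pi k x = i].
Hypothesis refine_pi : forall k x y, pi k.+1 x = pi k.+1 y -> pi k x = pi k y.
Hypothesis cell_gt0 : forall k x, (0 < mu (cell pi k x))%E.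
Hypothesis cell_fin : forall k x, (mu (cell pi k x) < +oo)%E.

Let one : T -> R := fun=> 1.
Let mone : measurable_fun setT one. Proof. exact: measurable_cst. Qed.

Variables (m : nat) (v : 'I_m.+1 -> T -> R) (s : 'I_m.+1 -> R) (K : R).
Hypothesis m_gt0 : (0 < m)%N.
Hypothesis mv : forall i, measurable_fun setT (v i).
Hypothesis v_gt0 : forall i x, 0 < v i x.
Hypothesis cint_v : forall i k x, (cint mu pi (v i) k x < +oo)%E.
Hypothesis s_gt0 : forall i, 0 < s i.
Hypothesis prod_v : forall x, \prod_i v i x `^ s i = 1.
Hypothesis cell_K : forall k x,
  \prod_i (mass mu pi (v i) k x / mass mu pi one k x) `^ s i <= K.

Variables (f : 'I_m.+1 -> T -> R) (p : 'I_m.+1 -> R).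
Hypothesis mf : forall i, measurable_fun setT (f i).
Hypothesis f_ge0 : forall i x, 0 <= f i x.
Hypothesis p_gt1 : forall i, 1 < p i.
Hypothesis norm_f : forall i, (\int[mu]_x (f i x `^ p i * v i x)%:E <= 1)%E.

Let v_ge0 i x : 0 <= v i x. Proof. exact: ltW. Qed.

Let F (i : 'I_m) x : R := f (lift ord0 i) x * v (lift ord0 i) x.

Let mF i : measurable_fun setT (F i). Proof. exact: measurable_funM. Qed.
Let F_ge0 i x : 0 <= F i x. Proof. by rewrite mulr_ge0. Qed.

Let cint_fv i k x : (cint mu pi (fun y => f i y * v i y)%R k x < +oo)%E.
Proof. exact: cint_lty_norm (p_gt1 i) (norm_f i) _ _. Qed.

Let cint_F i k x : (cint mu pi (F i) k x < +oo)%E. Proof. exact: cint_fv. Qed.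

Local Notation c := (prod_avg mu pi F).
Local Notation a := (stop_ratio R m).
Local Notation V := (mass mu pi one).

Let V_gt0 k x : 0 < V k x. Proof. exact: mass_one_gt0. Qed.

Let stopE k x y : pi k x = pi k y ->
  stopping a (c x) k = stopping a (c y) k.
Proof. exact: lconst_stopping. Qed.

Let lastE k l x y : pi l x = pi l y ->
  last_stopping a (c x) k l = last_stopping a (c y) k l.
Proof. by move=> xy; apply: (lconst_last mu refine_pi F k xy). Qed.

Variables (N : nat) (beta : R).

(** The dyadic model of I_alpha along the chain of cells of [x], with |Q|^(alpha/n) written as
    V^beta. *)
Definition level_sum x : R := \sum_(k < N.+1) V k x `^ beta * c x k.
Definition stopped_level k x : R :=
  (stopping a (c x) k)%:R * (V k x `^ beta * c x k).

Let avg_pow (i : 'I_m.+1) k x : R := avg mu pi (v i) (f i) k x `^ p i.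
Let is_last k x : R := (stopping a (c x) k && last_stopping a (c x) k N)%:R.

Let avg_pow_ge0 i k x : 0 <= avg_pow i k x. Proof. exact: powR_ge0. Qed.
Let c_ge0 x k : 0 <= c x k. Proof. exact: prod_avg_ge0. Qed.

Let massZ i k x (h : R) : 0 <= h ->
  (\int[mu]_(y in cell pi k x) (h * v i y)%:E = (h * mass mu pi (v i) k x)%:E)%E.
Proof.
move=> h0; rewrite integral_EFinZ//.
- by rewrite [RHS]EFinM massE.
- exact: measurable_cell.
- exact: measurable_funTS.
Qed.

Let prod_avgE x k : c x k =
  \prod_(i < m) ((V k x)^-1 *
   (mass mu pi (v (lift ord0 i)) k x * avg mu pi (v (lift ord0 i)) (f (lift ord0 i)) k x)).
Proof.
apply: eq_bigr => i _; rewrite /avg mulrC; congr (_ * _).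
rewrite mulrCA divff ?mulr1; last by rewrite gt_eqF// mass_gt0.
by congr (mass mu pi _ k x); apply/funext => y; rewrite mulr1.
Qed.

Lemma stopped_level_ge0 k x : 0 <= stopped_level k x.
Proof. by rewrite mulr_ge0// mulr_ge0 ?powR_ge0. Qed.

Lemma lconst_V k : lconst pi k (V k). Proof. exact: lconst_mass. Qed.

Lemma lconst_stopped k : lconst pi k (stopped_level k).
Proof.
move=> x y xy; by rewrite /stopped_level (stopE xy) (lconst_V xy) (lconst_prod_avg mu F xy).
Qed.

Lemma measurable_stopped k : measurable_fun setT (stopped_level k).
Proof. exact: lconst_measurable (@lconst_stopped k). Qed.

Let measurable_is_last k : (k <= N)%N -> measurable_fun setT (is_last k).
Proof.
move=> kN; apply: (@lconst_measurable _ _ _ measurable_pi N) => x y xy.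
by rewrite /is_last (lastE k xy) (stopE (pi_le refine_pi kN xy)).
Qed.

Let measurable_avg_pow i k : measurable_fun setT (avg_pow i k).
Proof.
apply: measurableT_comp (measurable_powR _) _.
exact: lconst_measurable (@lconst_avg _ _ _ _ _ (v i) (f i) k).
Qed.

Variables (tau e dd D : 'I_m.+1 -> R) (rho : R).
Hypothesis tau_lift : forall i, tau (lift ord0 i) = 1.
Hypothesis rho_ge1 : 1 <= rho.
Hypothesis e_ge0 : forall i, 0 <= e i.
Hypothesis dd_ge0 : forall i, 0 <= dd i.
Hypothesis e_dd : forall i, e i + dd i = (rho - 1) * s i.
Hypothesis D_ge0 : forall i, 0 <= D i.
Hypothesis sum_s : \sum_i s i = m%:R - beta.

Let S := \sum_i s i.

Definition cell_const : R :=
  (2 * m.+1%:R) `^ ((rho - 1) * S) * \prod_i D i * K `^ rho.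

Lemma K_ge0 (x : T) : 0 <= K.
Proof.
by apply: le_trans (cell_K 0 x); rewrite prodr_ge0// => i _; exact: powR_ge0.
Qed.

(** On a stopped cell the integrand on the right lives on the portion that does not stop again,
    where the powers of averages are constants; its integral is the sum in [cell_bound]. [Y ord0]
    stands for the average of the dual function, or for 1 when there is none. *)
Lemma stopped_cell_bound (Y : 'I_m.+1 -> R) k x : (k <= N)%N ->
  (forall i, 0 <= Y i) ->
  (forall i, Y (lift ord0 i) = avg mu pi (v (lift ord0 i)) (f (lift ord0 i)) k x) ->
  (forall i, mass mu pi (v i) k x `^ (tau i - (e i + s i)) * Y i <=
             D i * avg_pow i k x `^ e i) ->
  ((stopped_level k x * mass mu pi (v ord0) k x `^ tau ord0 * Y ord0)%:E <=
   cell_const%:E * (\int[mu]_(y in cell pi k x)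
     (\sum_i is_last k y * avg_pow i k y * v i y)%:E) `^ (\sum_i e i))%E.
Proof.
move=> kN Y0 YE HY.
have RHS0 : (0 <= cell_const%:E * (\int[mu]_(y in cell pi k x)
     (\sum_i is_last k y * avg_pow i k y * v i y)%:E) `^ (\sum_i e i))%E.
  rewrite mule_ge0 ?poweR_ge0// lee_fin /cell_const.
  by rewrite !mulr_ge0 ?powR_ge0// prodr_ge0.
have [sk|nsk] := boolP (stopping a (c x) k); last first.
  by rewrite /stopped_level (negbTE nsk) !mul0r.
have := c_ge0 x k; rewrite le_eqVlt => /predU1P[c0|c0].
  by rewrite /stopped_level -c0 !mulr0 !mul0r.
set Q := cell pi k x; set E := [set y | last_stopping a (c y) k N].
have mQ : measurable Q by exact: measurable_cell.
have mE : measurable E by exact: measurable_last.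
have mQE : measurable (Q `&` E) by exact: measurableI.
have half := half_last_stopping measurable_pi refine_pi cell_gt0 cell_fin m_gt0
  mF F_ge0 cint_F kN sk c0.
have QEQ : (mu (Q `&` E) <= mu Q)%E by apply: le_measure; rewrite ?inE.
have QEfin : mu (Q `&` E) \is a fin_num.
  by rewrite ge0_fin_numE//; exact: le_lt_trans QEQ (cell_fin k x).
set VE := fine (mu (Q `&` E)).
have VEE : (mu (Q `&` E) = VE%:E)%E by rewrite fineK.
have VQ : (mu Q = (V k x)%:E)%E by rewrite mass_one.
have V2 : V k x <= 2 * VE by rewrite -lee_fin EFinM -VEE -VQ.
have VEV : VE <= V k x by rewrite -lee_fin -VEE -VQ.
have VE0 : 0 < VE by have := V_gt0 k x; lra.
pose b i := fine (\int[mu]_(y in Q `&` E) (v i y)%:E)%E.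
have bfin i : (\int[mu]_(y in Q `&` E) (v i y)%:E = (b i)%:E)%E.
  rewrite fineK// ge0_fin_numE ?integral_EFin_ge0//.
  apply: le_lt_trans (cint_v i k x); apply: ge0_subset_integral => //.
    exact/measurable_EFinP/measurable_funTS.
  by move=> y _; rewrite lee_fin.
have b0 i : 0 < b i.
  rewrite -lte_fin -bfin; apply: integral_gt0_of_pos => //.
    exact: measurable_funTS.
  by rewrite VEE lte_fin.
have ba i : b i <= mass mu pi (v i) k x.
  rewrite -lee_fin -bfin massE//; apply: ge0_subset_integral => //.
    exact/measurable_EFinP/measurable_funTS.
  by move=> y _; rewrite lee_fin.
have HVE : VE <= m.+1%:R * \prod_i b i `^ (s i / \sum_j s j).
  by rewrite -lee_fin -VEE; apply: measure_le_prod_mass.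
have := cell_bound (ltn0Sn m) s_gt0 rho_ge1 e_ge0 dd_ge0 e_dd VE0 VEV V2 b0 ba
  (cell_K k x) HVE (fun i => avg_pow_ge0 i k x) Y0 D_ge0 HY.
rewrite -lee_fin => H.
have -> : (\int[mu]_(y in Q) (\sum_i is_last k y * avg_pow i k y * v i y)%:E =
    (\sum_i avg_pow i k x * b i)%:E)%E.
  rewrite integral_EFin_sum//; last 2 first.
  - move=> i; apply: measurable_funTS; apply: measurable_funM => //.
    by apply: measurable_funM => //; exact: measurable_is_last.
  - by move=> i y; rewrite !mulr_ge0.
  rewrite -sumEFin; apply: eq_bigr => i _; rewrite EFinM -bfin -integral_EFinZ//.
    rewrite -[RHS]integral_EFin_indic// -[LHS]integral_EFin_indic//.
    apply: eq_integral => y _; rewrite !indicE.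
    have [yQ|nyQ] := boolP (y \in Q); last first.
      rewrite mul0r (_ : (y \in Q `&` E) = false) ?mul0r//.
      by apply/negbTE; apply: contra nyQ; rewrite !inE => -[].
    have xy : pi k y = pi k x by move/set_mem : yQ.
    rewrite /is_last (stopE xy) sk /= mul1r.
    have -> : avg_pow i k y = avg_pow i k x by rewrite /avg_pow (lconst_avg mu (v i) (f i) xy).
    have -> : (y \in Q `&` E) = last_stopping a (c y) k N.
      by apply/idP/idP => [/set_mem[]//|ly]; apply/mem_set; split=> //; exact: set_mem.
    by rewrite mulrA.
  exact: measurable_funTS.
rewrite poweR_EFin -EFinM; apply: le_trans H; rewrite lee_fin /cell_const.
rewrite le_eqVlt; apply/orP; left; apply/eqP.
rewrite /stopped_level sk mul1r prod_avgE [X in _ = _ * X]big_ord_recl /=.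
have -> : \prod_(i < m) (mass mu pi (v (lift ord0 i)) k x `^ tau (lift ord0 i) * Y (lift ord0 i))
  = \prod_(i < m) (mass mu pi (v (lift ord0 i)) k x *
       avg mu pi (v (lift ord0 i)) (f (lift ord0 i)) k x).
  apply: eq_bigr => i _; rewrite tau_lift YE powRr1//.
  by apply/ltW/mass_gt0.
rewrite [X in _ * X * _ * _]big_split /= prodr_const card_ord.
(* The sum of the [s i] is m - beta: this is the kernel factor times one volume for each of the [m]
   averages. *)
rewrite (_ : V k x `^ (- \sum_i s i) = V k x `^ beta * (V k x)^-1 ^+ m).
  move: (_^-1 ^+ m) (V k x `^ beta) (_ `^ tau ord0) (Y ord0) (\prod_(i < m) _).
  by move=> t1 t2 t3 t4 t5; ring.
rewrite sum_s exprVn -powR_mulrn ?(ltW (V_gt0 _ _))// -powRN -powRD.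
  by congr (_ `^ _); ring.
by apply/implyP => _; rewrite gt_eqF.
Qed.

(** At each point at most one level counts as last, so the sum over levels is bounded by the p-th
    power of the maximal function, and Doob's inequality applies in every slot. *)
Lemma sum_last_avg_bound :
  (\sum_(k < N.+1) \int[mu]_x (\sum_i is_last k x * avg_pow i k x * v i x)%:E <=
   (\sum_i doob_const (p i))%:E)%E.
Proof.
have mI (k : 'I_N.+1) i : measurable_fun setT (fun x => is_last k x * avg_pow i k x * v i x).
  apply: measurable_funM => //; apply: measurable_funM => //.
  by apply: measurable_is_last; rewrite -ltnS.
have I0 (k : 'I_N.+1) i x : 0 <= is_last k x * avg_pow i k x * v i x.
  by rewrite !mulr_ge0.
under eq_bigr => k _ do rewrite integral_EFin_sum//.
rewrite exchange_big /= -sumEFin; apply: lee_sum => i _.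
rewrite -integral_EFin_sum//.
apply: (@le_trans _ _ (\int[mu]_x
   (running_max (avg mu pi (v i) (f i) ^~ x) N `^ p i * v i x)%:E)%E).
  apply: le_integral_EFin => x _; first by apply: sumr_ge0.
  rewrite -mulr_suml ler_wpM2r// /is_last.
  apply: (@sum_last_stopping _ a (c x) N (fun k => avg_pow i k x)); first exact: powR_ge0.
  move=> k kN; rewrite ge0_ler_powR ?nnegrE//.
  - by apply: (le_trans ler01); exact: ltW.
  - exact: avg_ge0.
  - by apply: running_max_ge0 => l; exact: avg_ge0.
  - exact: running_max_ge.
apply: le_trans (doob _ _ _ _ _ _ _ _ _ _ _) _ => //.
rewrite -[leRHS]mule1; apply: lee_wpmul2l; first by rewrite lee_fin powR_ge0.
exact: norm_f.
Qed.

Let last_sum k x : R := \sum_i is_last k x * avg_pow i k x * v i x.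

Let last_sum_ge0 k x : 0 <= last_sum k x.
Proof. by apply: sumr_ge0 => i _; rewrite !mulr_ge0. Qed.

Let measurable_last_sum k : (k <= N)%N -> measurable_fun setT (last_sum k).
Proof.
move=> kN; apply: measurable_sum => i; apply: measurable_funM => //.
by apply: measurable_funM => //; exact: measurable_is_last.
Qed.

Lemma sum_levels_bound (W : nat -> T -> R) (B : R) : 0 <= B ->
  (forall k, measurable_fun setT (W k)) -> (forall k x, 0 <= W k x) ->
  (forall k x, (k <= N)%N -> (\int[mu]_(y in cell pi k x) (W k y)%:E <=
     B%:E * \int[mu]_(y in cell pi k x) (last_sum k y)%:E)%E) ->
  (\int[mu]_x (\sum_(k < N.+1) W k x)%:E <= (B * \sum_i doob_const (p i))%:E)%E.
Proof.
move=> B0 mW W0 HW; rewrite integral_EFin_sum// EFinM.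
apply: le_trans (lee_wpmul2l _ sum_last_avg_bound); last by rewrite lee_fin.
rewrite ge0_sume_distrr; last first.
  by move=> k _; apply: integral_EFin_ge0 => x _; exact: last_sum_ge0.
apply: lee_sum => k _; have kN : (k <= N)%N by rewrite -ltnS.
have mL := measurable_last_sum kN.
rewrite -integral_EFinZ//; last by move=> x; exact: last_sum_ge0.
apply: (le_integral_cellwise measurable_pi (k := k)).
- exact/measurable_EFinP.
- by apply/measurable_EFinP; exact: measurable_funM.
- by move=> x; rewrite lee_fin.
- by move=> x; rewrite lee_fin mulr_ge0// last_sum_ge0.
move=> x; rewrite integral_EFinZ//.
- exact: HW.
- exact: measurable_cell.
- exact: measurable_funTS.
- by move=> y; exact: last_sum_ge0.
Qed.

Lemma cell_const_ge0 : 0 <= cell_const.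
Proof. by rewrite /cell_const !mulr_ge0 ?powR_ge0// prodr_ge0. Qed.

(** The case q > 1, with the dual function in slot 0. It may be replaced by its averages because the
    stopped levels are constant on cells; with exponents of sum 1 the cell bounds simply add up. *)
Lemma stopped_linear_bound : tau ord0 = 1 -> \sum_i e i = 1 ->
  (forall i k x, mass mu pi (v i) k x `^ (tau i - (e i + s i)) *
      avg mu pi (v i) (f i) k x <= D i * avg_pow i k x `^ e i) ->
  (\int[mu]_x ((\sum_(k < N.+1) stopped_level k x) * f ord0 x * v ord0 x)%:E <=
   (cell_const * \sum_i doob_const (p i))%:E)%E.
Proof.
move=> tau0 e1 HY.
pose W k x := stopped_level k x * avg mu pi (v ord0) (f ord0) k x * v ord0 x.
have A0 k x : 0 <= avg mu pi (v ord0) (f ord0) k x by exact: avg_ge0.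
have SL := stopped_level_ge0.
have W0 k x : 0 <= W k x by apply: mulr_ge0 => //; apply: mulr_ge0.
have mA k : measurable_fun setT (avg mu pi (v ord0) (f ord0) k).
  exact: lconst_measurable (@lconst_avg _ _ _ _ _ _ _ k).
have mW k : measurable_fun setT (W k).
  by apply: measurable_funM => //; apply: measurable_funM => //; exact: measurable_stopped.
have -> : (\int[mu]_x ((\sum_(k < N.+1) stopped_level k x) * f ord0 x * v ord0 x)%:E =
    \int[mu]_x (\sum_(k < N.+1) W k x)%:E)%E.
  rewrite integral_EFin_sum//.
  under eq_integral do rewrite -mulrA mulr_suml.
  rewrite integral_EFin_sum//; last 2 first.
  - move=> k; apply: measurable_funM; first exact: measurable_stopped.
    exact: measurable_funM.
  - by move=> k x; apply: mulr_ge0 => //; apply: mulr_ge0.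
  apply: eq_bigr => k _; rewrite /W integral_avg//.
  - by apply: eq_integral => x _; rewrite mulrA.
  - exact: lconst_stopped.
apply: sum_levels_bound => //; first exact: cell_const_ge0.
move=> k x kN.
have := stopped_cell_bound (Y := fun i => avg mu pi (v i) (f i) k x) kN
  (fun i => avg_ge0 mu pi (v_gt0 i) (f_ge0 i) k x) (fun i => erefl) (fun i => HY i k x).
rewrite e1 poweRe1 ?tau0; last first.
  by apply: integral_EFin_ge0 => y _; exact: last_sum_ge0.
apply: le_trans.
rewrite powRr1; last by apply/ltW/mass_gt0.
have -> : (stopped_level k x * mass mu pi (v ord0) k x * avg mu pi (v ord0) (f ord0) k x
   = stopped_level k x * avg mu pi (v ord0) (f ord0) k x * mass mu pi (v ord0) k x).
  by ring.
rewrite -(massZ ord0 k x (mulr_ge0 (SL k x) (A0 k x))).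
rewrite le_eqVlt; apply/orP; left; apply/eqP; apply: eq_integral => y /set_mem xy.
by rewrite /W (lconst_stopped xy) (lconst_avg mu _ _ xy).
Qed.

(** For q <= 1 the power q is subadditive and no dual function is needed. The exponents now add up
    to 1/q, and the power q makes the cell bounds linear again. *)
Lemma stopped_power_bound (q : R) : 0 < q <= 1 -> tau ord0 = q^-1 ->
  \sum_i e i = q^-1 ->
  (forall k x, mass mu pi (v ord0) k x `^ (tau ord0 - (e ord0 + s ord0)) <=
      D ord0 * avg_pow ord0 k x `^ e ord0) ->
  (forall i k x, mass mu pi (v (lift ord0 i)) k x `^
      (tau (lift ord0 i) - (e (lift ord0 i) + s (lift ord0 i))) *
      avg mu pi (v (lift ord0 i)) (f (lift ord0 i)) k x <=
      D (lift ord0 i) * avg_pow (lift ord0 i) k x `^ e (lift ord0 i)) ->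
  (\int[mu]_x ((\sum_(k < N.+1) stopped_level k x) `^ q * v ord0 x)%:E <=
   (cell_const `^ q * \sum_i doob_const (p i))%:E)%E.
Proof.
move=> /[dup] q01 /andP[q0 q1] tau0 e1 HY0 HY.
pose W k x := stopped_level k x `^ q * v ord0 x.
have W0 k x : 0 <= W k x by rewrite mulr_ge0 ?powR_ge0.
have mW k : measurable_fun setT (W k).
  apply: measurable_funM => //.
  exact: measurableT_comp (measurable_powR _) (measurable_stopped k).
apply: (@le_trans _ _ (\int[mu]_x (\sum_(k < N.+1) W k x)%:E)%E).
  apply: le_integral_EFin => x _; first by rewrite mulr_ge0 ?powR_ge0.
  rewrite /W -mulr_suml ler_wpM2r//.
  apply: (powR_sum_le (x := fun k : 'I_N.+1 => stopped_level k x)) => // k.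
  exact: stopped_level_ge0.
apply: sum_levels_bound => //; first exact: powR_ge0.
move=> k x kN.
pose Y i := if i == ord0 then 1 else avg mu pi (v i) (f i) k x.
have Y0 i : 0 <= Y i by rewrite /Y; case: ifP => // _; exact: avg_ge0.
have HYY i : mass mu pi (v i) k x `^ (tau i - (e i + s i)) * Y i <=
    D i * avg_pow i k x `^ e i.
  rewrite /Y; case: (unliftP ord0 i) => [j ->|->]; last by rewrite eqxx mulr1 HY0.
  by rewrite eq_sym (negbTE (neq_lift _ _)) HY.
have SL := stopped_level_ge0 k x.
have I0 : (0 <= \int[mu]_(y in cell pi k x) (last_sum k y)%:E)%E.
  by apply: integral_EFin_ge0 => y _; exact: last_sum_ge0.
have a0 : 0 < mass mu pi (v ord0) k x by exact: mass_gt0.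
have := stopped_cell_bound (Y := Y) kN Y0 (fun i => erefl) HYY.
rewrite /Y eqxx mulr1 tau0 e1 => H.
rewrite (_ : (_ * _)%E = (cell_const%:E * (\int[mu]_(y in cell pi k x)
     (\sum_i is_last k y * avg_pow i k y * v i y)%:E) `^ q^-1) `^ q)%E; last first.
  rewrite poweRM ?poweR_ge0 ?lee_fin ?cell_const_ge0// poweR_EFin -poweRrM.
  by rewrite mulVf ?gt_eqF// poweRe1.
apply: le_trans (gt0_ler_poweR (ltW q0) _ _ H); last 2 first.
- rewrite in_itv /= leey andbT lee_fin; apply: mulr_ge0 => //; exact: powR_ge0.
- by rewrite in_itv /= leey andbT mule_ge0 ?poweR_ge0// lee_fin cell_const_ge0.
rewrite poweR_EFin (powRM q SL (powR_ge0 _ _)) -powRrM mulVf ?gt_eqF//.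
rewrite (powRr1 (ltW a0)) -(massZ ord0 k x (powR_ge0 (stopped_level k x) q)).
rewrite le_eqVlt; apply/orP; left; apply/eqP; apply: eq_integral => y /set_mem xy.
by rewrite /W (lconst_stopped xy).
Qed.

Lemma level_sum_le_stopped (G : R) x :
  (forall l, (l <= N)%N ->
    \sum_(l <= k < N.+1) V k x `^ beta <= G * V l x `^ beta) ->
  level_sum x <= a * G * \sum_(k < N.+1) stopped_level k x.
Proof.
move=> geo; rewrite /level_sum /stopped_level.
have g0 k : 0 <= V k x `^ beta by exact: powR_ge0.
exact: (sum_le_stopping (stop_ratio_ge1 R m_gt0) (c_ge0 x) g0 geo).
Qed.

End dyadic_bound.

Definition slot (A : Type) (m : nat) (x : A) (y : 'I_m -> A) (i : 'I_m.+1) : A :=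
  if unlift ord0 i is Some k then y k else x.

Lemma slot0 (A : Type) (m : nat) (x : A) (y : 'I_m -> A) : slot x y ord0 = x.
Proof. by rewrite /slot unlift_none. Qed.

Lemma slot_lift (A : Type) (m : nat) (x : A) (y : 'I_m -> A) k :
  slot x y (lift ord0 k) = y k.
Proof. by rewrite /slot liftK. Qed.

(** * Choice of the exponents and the dyadic theorem *)

Section dyadic_main.
Context (R : realType) (m : nat) (q beta G : R) (p : 'I_m -> R) (j : 'I_m.+1).
Hypotheses (m_gt0 : (0 < m)%N) (q_gt0 : 0 < q) (p_gt1 : forall i, 1 < p i).
Hypotheses (beta01 : 0 < beta < 1) (G_ge0 : 0 <= G).

(** The reciprocals 1 / r_i: 1/q in slot 0 and 1 - 1/p_k = 1/p_k' in the others. *)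
Definition slot_inv (i : 'I_m.+1) : R := slot q^-1 (fun k => 1 - (p k)^-1) i.

Local Notation s := slot_inv.
Hypothesis sum_s : \sum_i s i = m%:R - beta.
Hypothesis dominant : forall i, i != j -> s j <= (1 - beta) * s i.

Let beta0 : 0 < beta. Proof. by case/andP: beta01. Qed.
Let beta1 : beta < 1. Proof. by case/andP: beta01. Qed.

Lemma slot_inv_lift k : 0 < s (lift ord0 k) < 1.
Proof.
have pk := p_gt1 k; have p0 : 0 < p k by lra.
by rewrite /s slot_lift subr_gt0 invf_lt1// pk /= gtrBl invr_gt0.
Qed.

Lemma slot_inv_gt0 i : 0 < s i.
Proof.
case: (unliftP ord0 i) => [k ->|->]; first by case/andP: (slot_inv_lift k).
by rewrite /s slot0 invr_gt0.
Qed.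

(** Otherwise every slot but j would have s_i > 1, while the slots of the functions have s_i < 1. So
    m = 1 and j is the only such slot; but then s_0 + s_j = 1 - beta with s_0 > 0. *)
Lemma dominant_le : s j <= 1 - beta.
Proof.
rewrite leNgt; apply/negP => lj.
have big i : i != j -> 1 < s i.
  move=> /dominant h; have : (1 - beta) * 1 < (1 - beta) * s i by rewrite mulr1; lra.
  by rewrite ltr_pM2l// subr_gt0.
have only k : lift ord0 k = j.
  apply/eqP; apply: contrapT => /negP/big; have /andP[_ h] := slot_inv_lift k; lra.
pose k0 := Ordinal m_gt0.
have m1 : m = 1%N.
  apply/eqP; rewrite eqn_leq m_gt0 andbT leqNgt; apply/negP => m2.
  by have := only (Ordinal m2); rewrite -(only k0) => /lift_inj/(congr1 val).
move: (sum_s); rewrite big_ord_recl /=.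
have -> : \sum_(i < m) s (lift ord0 i) = s j.
  rewrite (bigD1 k0)//= big1 ?addr0 ?only// => i ik; exfalso; move/eqP: ik; apply.
  apply/val_inj => /=; have : (i < 1)%N by rewrite -m1 ltn_ord.
  by case: (nat_of_ord i).
have m1R : m%:R = 1 :> R by rewrite m1.
rewrite m1R; have := slot_inv_gt0 ord0; lra.
Qed.

(** Dominance gives 1/q <= (1 - beta) / p_k' < 1. Hence slot 0 is never dominant when q <= 1, and
    [tau j] is always 1. *)
Lemma dominant_ord0 : j = ord0 -> 1 < q.
Proof.
move=> j0; pose k0 := Ordinal m_gt0.
have : s j <= (1 - beta) * s (lift ord0 k0) by apply: dominant; rewrite j0.
have /andP[s0 s1] := slot_inv_lift k0; rewrite j0 {1}/s slot0 => h.
have : q^-1 < 1.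
  apply: le_lt_trans h _; apply: mulr_ilt1 => //; rewrite ?subr_ge0 ?(ltW beta1) ?(ltW s0)//.
  by rewrite gtrBl.
by rewrite invf_lt1.
Qed.

(** [tau i] is the power of the mass of slot i on a stopped cell: 1, except 1/q in slot 0 when there
    is no duality. Outside slot j, [e i + s i] is all of [tau i]; slot j keeps back beta, so that
    the [e i] add up to [tau0], the exponent for which summation over cells is linear. [rho] is the
    value for which [dd j] is 0. *)
Let rho := (1 - beta) / s j.
Let tau0 : R := if 1 < q then 1 else q^-1.
Let tau : 'I_m.+1 -> R := slot tau0 (fun=> 1).
Let e i : R := if i == j then 1 - beta - s j else tau i - s i.
Let dd i : R := (rho - 1) * s i - e i.
(** For q <= 1 slot 0 will carry the zero function, and 2 is just some exponent above 1. *)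
Let P : 'I_m.+1 -> R := slot (if 1 < q then q / (q - 1) else 2) p.
Let D i : R := if i == j then 2 `^ (P j * beta) else 1.

Let P_gt1 i : 1 < P i.
Proof.
case: (unliftP ord0 i) => [k ->|->]; rewrite /P ?slot_lift ?slot0//.
case: ifP => q1; last lra.
by rewrite ltr_pdivlMr ?subr_gt0// mul1r gtrBl.
Qed.

Let tauj : tau j = 1.
Proof.
case: (unliftP ord0 j) => [k ->|/[dup] /dominant_ord0 q1 ->]; rewrite /tau ?slot_lift//.
by rewrite slot0 /tau0 q1.
Qed.

Let rho_ge1 : 1 <= rho.
Proof. by rewrite /rho ler_pdivlMr ?slot_inv_gt0// mul1r dominant_le. Qed.

Let s_le_tau i : s i <= tau i.
Proof.
case: (unliftP ord0 i) => [k ->|->]; rewrite /tau ?slot_lift.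
  by case/andP: (slot_inv_lift k) => _ /ltW.
by rewrite slot0 /s slot0 /tau0; case: ifP => // q1; rewrite invf_le1// ltW.
Qed.

Let e_ge0 i : 0 <= e i.
Proof. by rewrite /e; case: ifP => _; rewrite subr_ge0 ?dominant_le. Qed.

Let dd_ge0 i : 0 <= dd i.
Proof.
have sj0 := slot_inv_gt0 j.
rewrite /dd /e; case: eqVneq => [->|ij].
  by rewrite mulrBl /rho divfK ?gt_eqF// mul1r subrr.
suff : tau i <= rho * s i by lra.
have h1 : 1 <= rho * s i by rewrite /rho mulrAC ler_pdivlMr// mul1r dominant.
case: (unliftP ord0 i) => [k ik|i0]; first by rewrite {1}ik /tau slot_lift.
rewrite {1}i0 /tau slot0 /tau0; case: ifP => // _.
by rewrite (_ : q^-1 = s i) ?i0 ?ler_peMl ?(ltW (slot_inv_gt0 _))// /s slot0.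
Qed.

Let sum_e : \sum_i e i = tau0.
Proof.
have -> : \sum_i e i = \sum_i (tau i - s i) - beta.
  rewrite (bigD1 j)//= [in RHS](bigD1 j)//= /e eqxx tauj.
  rewrite (eq_bigr (fun i => tau i - s i)); last by move=> i /negbTE ->.
  by ring.
rewrite sumrB sum_s big_ord_recl /tau slot0.
under eq_bigr do rewrite slot_lift.
by rewrite sumr_const card_ord; ring.
Qed.

Let DC := \sum_i doob_const (P i).

Definition dyadic_const : R :=
  stop_ratio R m * G * ((2 * m.+1%:R) `^ ((rho - 1) * \sum_i s i) * \prod_i D i) *
  (if 1 < q then DC else DC `^ q^-1).

Lemma dyadic_const_ge0 : 0 <= dyadic_const.
Proof.
have DC0 : 0 <= DC by apply: sumr_ge0 => i _; exact: powR_ge0.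
rewrite /dyadic_const !mulr_ge0 ?powR_ge0//.
- by rewrite (le_trans _ (stop_ratio_ge1 R m_gt0)).
- by apply: prodr_ge0 => i _; rewrite /D; case: ifP => // _; exact: powR_ge0.
- by case: ifP => // _; exact: powR_ge0.
Qed.

Theorem dyadic_main d (T : measurableType d) (mu : {measure set T -> \bar R})
    (pi : nat -> T -> nat) (v : 'I_m.+1 -> T -> R) (K : R)
    (f : 'I_m -> T -> R) (N : nat) :
  (forall k i, measurable [set x | pi k x = i]) ->
  (forall k x y, pi k.+1 x = pi k.+1 y -> pi k x = pi k y) ->
  (forall k x, (0 < mu (cell pi k x))%E) ->
  (forall k x, (mu (cell pi k x) < +oo)%E) ->
  (forall i, measurable_fun setT (v i)) -> (forall i x, 0 < v i x) ->
  (forall i k x, (cint mu pi (v i) k x < +oo)%E) ->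
  (forall x, \prod_i v i x `^ s i = 1) ->
  (forall k x, \prod_i (mass mu pi (v i) k x / mass mu pi (fun=> 1) k x) `^ s i <= K) ->
  (forall i, measurable_fun setT (f i)) -> (forall i x, 0 <= f i x) ->
  (forall i, (\int[mu]_x (f i x `^ p i * v (lift ord0 i) x)%:E <= 1)%E) ->
  (forall x l, (l <= N)%N ->
    \sum_(l <= k < N.+1) mass mu pi (fun=> 1) k x `^ beta <=
    G * mass mu pi (fun=> 1) l x `^ beta) ->
  (\int[mu]_x ((\sum_(k < N.+1) mass mu pi (fun=> 1) k x `^ beta *
      \prod_(i < m) avg mu pi (fun=> 1)
         (fun y => f i y * v (lift ord0 i) y)%R k x) `^ q * v ord0 x)%:E
    <= ((dyadic_const * K `^ rho) `^ q)%:E)%E.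
Proof.
move=> mpi rpi c0 cfin mv v0 cv pv HK mf f0 nf geo.
have tau_lift k : tau (lift ord0 k) = 1 by rewrite /tau slot_lift.
have e_dd i : e i + dd i = (rho - 1) * s i by rewrite /dd addrC subrK.
have D_ge0 i : 0 <= D i by rewrite /D; case: ifP => // _; exact: powR_ge0.
have [x0|Tempty] := pselect (exists x : T, True); last first.
  rewrite (_ : \int[mu]_x _ = 0)%E ?lee_fin ?powR_ge0//.
  by rewrite integral0_eq// => x; exfalso; apply: Tempty; exists x.
have K0 : 0 <= K by case: x0 => x _; exact: K_ge0 HK x.
have DC0 : 0 <= DC by apply: sumr_ge0 => i _; exact: powR_ge0.
have a_ge1 := stop_ratio_ge1 R m_gt0.
have aG0 : 0 <= stop_ratio R m * G by rewrite mulr_ge0// (le_trans _ a_ge1).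
set cc := cell_const s K D rho.
have cc0 : 0 <= cc by rewrite /cc /cell_const !mulr_ge0 ?powR_ge0// prodr_ge0.
set H := fun x => \sum_(k < N.+1) mass mu pi (fun=> 1) k x `^ beta *
  \prod_(i < m) avg mu pi (fun=> 1) (fun y => f i y * v (lift ord0 i) y)%R k x.
have H0 x : 0 <= H x.
  apply: sumr_ge0 => k _; rewrite mulr_ge0 ?powR_ge0// prodr_ge0// => i _.
  by apply: avg_ge0 => y //; rewrite mulr_ge0// ltW.
have mH : measurable_fun setT H.
  apply: (@lconst_measurable _ _ _ mpi N) => x y xy; apply: eq_bigr => k _.
  have xyk : pi k x = pi k y by apply: (pi_le rpi _ xy); rewrite -ltnS.
  rewrite (lconst_mass mu _ xyk); congr (_ * _); apply: eq_bigr => i _.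
  exact: lconst_avg.
have levelE (g : T -> R) x : level_sum mu pi v (slot g f) N beta x = H x.
  apply: eq_bigr => k _; congr (_ * _); apply: eq_bigr => i _.
  by congr (avg mu pi _ _ k x); apply/funext => y; rewrite slot_lift.
have Hstop (g : T -> R) x : (forall x, 0 <= g x) ->
    H x <= stop_ratio R m * G * \sum_(k < N.+1) stopped_level mu pi v (slot g f) beta k x.
  move=> g0; rewrite -(levelE g); apply: level_sum_le_stopped => //.
    move=> i y; case: (unliftP ord0 i) => [k ->|->]; rewrite ?slot_lift ?slot0//.
  by move=> l; exact: geo.
have mslot (g : T -> R) : measurable_fun setT g -> forall i, measurable_fun setT (slot g f i).
  by move=> mg i; case: (unliftP ord0 i) => [k ->|->]; rewrite ?slot_lift ?slot0.
have slot_ge0 (g : T -> R) : (forall x, 0 <= g x) -> forall i x, 0 <= slot g f i x.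
  by move=> g0 i x; case: (unliftP ord0 i) => [k ->|->]; rewrite ?slot_lift ?slot0.
have nslot (g : T -> R) : (\int[mu]_x (g x `^ P ord0 * v ord0 x)%:E <= 1)%E ->
    forall i, (\int[mu]_x (slot g f i x `^ P i * v i x)%:E <= 1)%E.
  move=> ng i; case: (unliftP ord0 i) => [k ->|->]; last by rewrite slot0.
  by rewrite slot_lift /P slot_lift.
have HY (g : T -> R) : measurable_fun setT g -> (forall x, 0 <= g x) ->
    (\int[mu]_x (g x `^ P ord0 * v ord0 x)%:E <= 1)%E ->
    forall i k x, tau i = 1 -> (P i)^-1 = 1 - s i ->
    mass mu pi (v i) k x `^ (tau i - (e i + s i)) * avg mu pi (v i) (slot g f i) k x
    <= D i * (avg mu pi (v i) (slot g f i) k x `^ P i) `^ e i.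
  move=> mg g0 ng i k x taui Pi.
  have A0 : 0 <= avg mu pi (v i) (slot g f i) k x.
    by apply: avg_ge0 => y //; exact: slot_ge0.
  rewrite /e /D; case: eqVneq => [ij|ij].
    rewrite (_ : tau i - _ = beta); last by rewrite taui -ij; ring.
    rewrite -ij (_ : 1 - beta - s i = (P i)^-1 - beta); last by rewrite Pi; ring.
    apply: avg_norm_bound => //; [exact: mslot|exact: slot_ge0|exact: nslot|exact: ltW].
  rewrite subrK subrr powRr0 !mul1r taui -Pi -powRrM divff ?powRr1//.
  by rewrite gt_eqF// (lt_trans _ (P_gt1 i)).
have P_lift k : (P (lift ord0 k))^-1 = 1 - s (lift ord0 k).
  by rewrite /P /s !slot_lift opprB addrC subrK.
have [q1|q1] := ltP 1 q; last first.
  have tau0E : tau ord0 = q^-1 by rewrite /tau slot0 /tau0 ltNge q1.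
  have sume : \sum_i e i = q^-1 by rewrite sum_e /tau0 ltNge q1.
  pose z : T -> R := fun=> 0.
  have g0 x : 0 <= z x by [].
  have mg : measurable_fun setT z by exact: measurable_cst.
  have ng : (\int[mu]_x (z x `^ P ord0 * v ord0 x)%:E <= 1)%E.
    rewrite integral0_eq// => x _; rewrite powR0 ?mul0r//.
    by rewrite gt_eqF// (lt_trans _ (P_gt1 _)).
  have j0 : ord0 != j by apply/eqP => /esym/dominant_ord0; rewrite ltNge q1.
  have e0 : e ord0 = 0 by rewrite /e (negbTE j0) tau0E /s slot0 subrr.
  have HY0 k x : mass mu pi (v ord0) k x `^ (tau ord0 - (e ord0 + s ord0)) <=
      D ord0 * (avg mu pi (v ord0) (slot z f ord0) k x `^ P ord0) `^ e ord0.
    by rewrite e0 powRr0 tau0E {1}/s slot0 add0r subrr powRr0 /D (negbTE j0) mulr1.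
  have q01 : 0 < q <= 1 by rewrite q_gt0.
  have B := stopped_power_bound mpi rpi c0 cfin m_gt0 mv v0 cv slot_inv_gt0 pv HK
    (mslot _ mg) (slot_ge0 _ g0) P_gt1 (nslot _ ng) N tau_lift rho_ge1 e_ge0 dd_ge0
    e_dd D_ge0 sum_s q01 tau0E sume HY0
    (fun i k x => HY _ mg g0 ng (lift ord0 i) k x (tau_lift i) (P_lift i)).
  rewrite -/cc -/DC in B.
  have -> : dyadic_const * K `^ rho = stop_ratio R m * G * (cc * DC `^ q^-1).
    rewrite /dyadic_const ltNge q1 /= /cc /cell_const.
    move: (stop_ratio R m) (DC `^ q^-1) (K `^ rho) (\prod_i D i) (_ `^ _) => t1 t2 t3 t4 t5.
    by ring.
  rewrite (powRM q aG0 (mulr_ge0 cc0 (powR_ge0 _ _))) (powRM q cc0 (powR_ge0 _ _)).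
  rewrite -powRrM mulVf ?gt_eqF// (powRr1 DC0) EFinM.
  apply: le_trans (lee_wpmul2l _ B); last by rewrite lee_fin powR_ge0.
  have S0 x : 0 <= \sum_(k < N.+1) stopped_level mu pi v (slot z f) beta k x.
    apply: sumr_ge0 => k _; apply: stopped_level_ge0 => //; exact: slot_ge0.
  have mS : measurable_fun setT
      (fun x => \sum_(k < N.+1) stopped_level mu pi v (slot z f) beta k x).
    by apply: measurable_sum => k; exact: measurable_stopped.
  rewrite -integral_EFinZ ?powR_ge0//; last 2 first.
  - by apply: measurable_funM => //; exact: measurableT_comp (measurable_powR _) mS.
  - by move=> x; rewrite mulr_ge0 ?powR_ge0// ltW.
  apply: le_integral_EFin => x _; first by rewrite mulr_ge0 ?powR_ge0// ltW.
  rewrite mulrA -(powRM q aG0 (S0 x)); apply: ler_wpM2r; first exact: ltW.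
  apply: ge0_ler_powR; rewrite ?nnegrE;
    [exact: ltW|exact: H0|exact: mulr_ge0|exact: Hstop].
have tau0E : tau ord0 = 1 by rewrite /tau slot0 /tau0 q1.
have sume : \sum_i e i = 1 by rewrite sum_e /tau0 q1.
have P0E : P ord0 = q / (q - 1) by rewrite /P slot0 q1.
have taui i : tau i = 1.
  by case: (unliftP ord0 i) => [k ->|->].
have PE i : (P i)^-1 = 1 - s i.
  case: (unliftP ord0 i) => [k ->|->] //; rewrite P0E /s slot0 invf_div.
  by rewrite mulrBl mul1r divff// gt_eqF.
have -> : dyadic_const * K `^ rho = stop_ratio R m * G * (cc * DC).
  rewrite /dyadic_const q1 /cc /cell_const.
  move: (stop_ratio R m) DC (K `^ rho) (\prod_i D i) (_ `^ _) => t1 t2 t3 t4 t5.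
  by ring.
(* The exhaustion required by duality: finitely many cells of level 0, each of finite mass for
   [v ord0]. *)
have UA (B : set T) n : B = [set x | (pi 0%N x <= n)%N] -> measurable B /\
    (\int[mu]_(x in B) (v ord0 x)%:E < +oo)%E.
  have int_cell k : (\int[mu]_(x in [set x | pi 0%N x = k]) (v ord0 x)%:E < +oo)%E.
    have [->|/set0P[x <-]] := eqVneq [set x | pi 0%N x = k] set0.
      by rewrite integral_set0.
    exact: cv.
  elim: n B => [|n ih] B ->.
    rewrite (_ : [set x | _] = [set x | pi 0%N x = 0%N]).
      by split; [exact: mpi|exact: int_cell].
    by apply/seteqP; split => x /=; rewrite leqn0 => /eqP.
  have -> : [set x | (pi 0%N x <= n.+1)%N] =
      [set x | (pi 0%N x <= n)%N] `|` [set x | pi 0%N x = n.+1].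
    apply/seteqP; split => x /=.
      by rewrite leq_eqVlt => /predU1P[->|]; [right|left].
    by case => [/leqW//|->].
  have [m1 i1] := ih _ erefl.
  split; first by apply: measurableU => //; exact: mpi.
  have mpn := mpi 0%N n.+1.
  rewrite ge0_integral_setU//; first by rewrite lte_add_pinfty.
  - by apply/measurable_EFinP; exact: measurable_funTS.
  - by move=> x _; rewrite lee_fin ltW.
  - by apply/disj_setPS => x /= [+ xn]; rewrite xn ltnn.
apply: (@duality_bound _ _ _ mu q _ _ H (fun n => [set x | (pi 0%N x <= n)%N])) => //.
- exact: mulr_ge0 aG0 (mulr_ge0 cc0 DC0).
- by move=> x; exact: ltW.
- by move=> n; have [] := UA _ n erefl.
- by move=> n1 n2 n12; apply/subsetPset => x /= /leq_trans; exact.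
- by apply/seteqP; split => // x _; exists (pi 0%N x) => //=; rewrite leqnn.
- by move=> n; have [] := UA _ n erefl.
move=> g mg g0 ng; rewrite -P0E in ng.
have B := stopped_linear_bound mpi rpi c0 cfin m_gt0 mv v0 cv slot_inv_gt0 pv HK
  (mslot _ mg) (slot_ge0 _ g0) P_gt1 (nslot _ ng) N tau_lift rho_ge1 e_ge0 dd_ge0
  e_dd D_ge0 sum_s tau0E sume
  (fun i k x => HY _ mg g0 ng i k x (taui i) (PE i)).
rewrite -/cc -/DC slot0 in B.
rewrite EFinM; apply: le_trans (lee_wpmul2l _ B); last by rewrite lee_fin.
have S0 x : 0 <= \sum_(k < N.+1) stopped_level mu pi v (slot g f) beta k x.
  by apply: sumr_ge0 => k _; apply: stopped_level_ge0 => //; exact: slot_ge0.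
have mS : measurable_fun setT
    (fun x => \sum_(k < N.+1) stopped_level mu pi v (slot g f) beta k x).
  by apply: measurable_sum => k; exact: measurable_stopped.
rewrite -integral_EFinZ//; last 2 first.
- by do 2?apply: measurable_funM.
- by move=> x; rewrite mulr_ge0 ?(ltW (v0 _ _))// mulr_ge0.
apply: le_integral_EFin => x _; first by rewrite mulr_ge0 ?(ltW (v0 _ _))// mulr_ge0.
rewrite !mulrA; apply: ler_wpM2r; first exact: ltW.
by apply: ler_wpM2r => //; exact: Hstop.
Qed.

End dyadic_main.

(** * Product measures and grids *)

Section tuple_integral.
Context d (T : measurableType d) (R : realType).
Variable mu : {sigma_finite_measure set T -> \bar R}.
Local Open Scope ereal_scope.

Lemma measurable_tuple_prod n (h : 'I_n -> T -> R) :
  (forall i, measurable_fun setT (h i)) ->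
  measurable_fun setT (fun y : n.-tuple T => \prod_(i < n) h i (tnth y i))%R.
Proof.
move=> mh; apply: measurable_prod => i _.
by apply: measurableT_comp => //; exact: measurable_tnth.
Qed.

Lemma integral_tuple_prod n (h : 'I_n -> T -> R) :
  (forall i, measurable_fun setT (h i)) -> (forall i x, (0 <= h i x)%R) ->
  \int[tuple_measure mu n]_y (\prod_(i < n) h i (tnth y i))%:E =
  \prod_(i < n) \int[mu]_x (h i x)%:E.
Proof.
elim: n h => [|n ih] h mh h0.
  rewrite big_ord0 /=.
  have m1 : measurable_fun setT (fun y : 0.-tuple T => (\prod_(i < 0) h i (tnth y i))%:E).
    by apply/measurable_EFinP; exact: measurable_tuple_prod.
  by rewrite integral_dirac// diracT mul1e big_ord0.
pose F (y : n.+1.-tuple T) := (\prod_(i < n.+1) h i (tnth y i))%:E.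
have mF : measurable_fun setT F by apply/measurable_EFinP; exact: measurable_tuple_prod.
have F0 y : 0 <= F y by rewrite lee_fin prodr_ge0.
transitivity (\int[mu \x tuple_measure mu n]_z (F \o @cons_pair _ T n) z).
  exact: (ge0_integral_pushforward (@measurable_cons_pair _ T n)
    (mu \x tuple_measure mu n) measurableT mF (fun y _ => F0 y)).
rewrite fubini_tonelli1//.
- rewrite big_ord_recl /fubini_F.
  rewrite -ih//.
  set I := \int[tuple_measure mu n]_y _.
  have I0 : 0 <= I by apply: integral_ge0 => y _; rewrite lee_fin prodr_ge0.
  rewrite -ge0_integralZr//.
  + apply: eq_integral => x _.
    under eq_integral => y _.
      rewrite /F /cons_pair /= big_ord_recl tnth0 EFinM.
      under eq_bigr do rewrite tnthS.
      over.
    rewrite ge0_integralZl//.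
    * apply/measurable_EFinP.
      by apply: (@measurable_tuple_prod n (fun i => h (lift ord0 i))).
    * by move=> y _; rewrite lee_fin prodr_ge0.
    * by rewrite lee_fin.
  + exact/measurable_EFinP.
  + by move=> x _; rewrite lee_fin.
- exact: (measurableT_comp mF (@measurable_cons_pair _ T n)).
- by move=> z; exact: F0.
Qed.

Lemma measurable_box n (A : 'I_n -> set T) : (forall i, measurable (A i)) ->
  measurable [set y : n.-tuple T | forall i, A i (tnth y i)].
Proof.
move=> mA.
rewrite (_ : [set y | _] = \bigcap_(i in [set: 'I_n]) ((tnth (T:=T))^~ i @^-1` A i)).
  apply: fin_bigcap_measurable => // i _.
  by rewrite -[X in measurable X]setTI; apply: measurable_tnth.
by apply/seteqP; split => y /= Ay i => [_|]; exact: Ay.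
Qed.

Lemma indic_box n (A : 'I_n -> set T) (y : n.-tuple T) :
  \1_[set y : n.-tuple T | forall i, A i (tnth y i)] y =
  (\prod_(i < n) \1_(A i) (tnth y i))%R :> R.
Proof.
have [Ay|nAy] := pselect (forall i, A i (tnth y i)).
  rewrite indicE mem_set// big1// => i _.
  by rewrite indicE mem_set.
rewrite indicE memNset//; move/existsNP : nAy => [i nAi].
by rewrite (bigD1 i)//= indicE memNset// mul0r.
Qed.

Lemma tuple_measure_box n (A : 'I_n -> set T) : (forall i, measurable (A i)) ->
  tuple_measure mu n [set y | forall i, A i (tnth y i)] = \prod_(i < n) mu (A i).
Proof.
move=> mA; have mB := measurable_box mA.
rewrite -[X in tuple_measure mu n X]setIT -integral_indic//.
under eq_integral do rewrite indic_box.
rewrite (integral_tuple_prod (h := fun i => \1_(A i)))//; apply: eq_bigr => i _.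
by rewrite integral_indic// setIT.
Qed.

Lemma ae_tuple n (P : 'I_n -> T -> Prop) :
  (forall i, {ae mu, forall x, P i x}) ->
  {ae tuple_measure mu n, forall y, forall i, P i (tnth y i)}.
Proof.
move=> aeP; apply: filter_forall => i; have [N [mN N0 PN]] := aeP i.
exists [set y : n.-tuple T | N (tnth y i)]; split.
- by rewrite -[X in measurable X]setTI; apply: measurable_tnth.
(* The cylinder over [N] is a box; its zero factor annihilates the other factors, even infinite
   ones. *)
- pose A k := if k == i then N else setT.
  have -> : [set y : n.-tuple T | N (tnth y i)] = [set y | forall k, A k (tnth y k)].
    apply/seteqP; split=> [y By k|y /(_ i)]; rewrite /A ?eqxx//.
    by case: eqP => // ->.
  rewrite tuple_measure_box; last by move=> k; rewrite /A; case: ifP.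
  by rewrite (bigD1 i)//= /A eqxx N0 mul0e.
- by move=> y /= nP; apply: PN.
Qed.

End tuple_integral.

(** * Translated dyadic grids: the one-third trick *)

Section grid1.
Context (R : realType).
Implicit Types (N k : nat) (t : bool) (x y : R).

Definition side N k : R := 2 ^+ N / 2 ^+ k.

Lemma side_gt0 N k : 0 < side N k.
Proof. by rewrite divr_gt0// exprn_gt0. Qed.

Lemma sideS N k : side N k = 2 * side N k.+1.
Proof. by rewrite /side exprS; field; rewrite expf_neq0. Qed.

(* The translation by a third of the top side shifts each finer level by
   [2 ^ k / 3] of its own side, hence always by one third or two thirds of it
   modulo the grid. *)
Definition grid_shift N t : R := t%:R * (2 ^+ N / 3).

Definition grid_index t N k x : int := Num.floor ((x - grid_shift N t) / side N k).

Lemma floor_double (a b : R) :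
  Num.floor (2 * a) = Num.floor (2 * b) -> Num.floor a = Num.floor b.
Proof.
have H (c : R) : 2 * Num.floor c <= Num.floor (2 * c) <= 2 * Num.floor c + 1.
  have /andP[c1 c2] := floor_itv c.
  have d1 : (2 * Num.floor c)%:~R <= 2 * c by rewrite intrM ler_wpM2l.
  have d2 : 2 * c < (2 * Num.floor c + 2)%:~R.
    have -> : 2 * Num.floor c + 2 = 2 * (Num.floor c + 1) by lia.
    by rewrite intrM ltr_pM2l.
  move: d1 d2; rewrite -floor_ge_int -floor_lt_int.
  move: (Num.floor (2 * c)) (Num.floor c) => u w uw1 uw2. lia.
have := H a; have := H b; lia.
Qed.

Lemma grid_index_refine t N k x y :
  grid_index t N k.+1 x = grid_index t N k.+1 y ->
  grid_index t N k x = grid_index t N k y.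
Proof.
have E z : z / side N k.+1 = 2 * (z / side N k).
  by rewrite (sideS N k); field; rewrite gt_eqF// side_gt0.
by rewrite /grid_index !E; exact: floor_double.
Qed.

Lemma grid_indexE t N k x (z : int) :
  (grid_index t N k x == z) =
  (x \in `[z%:~R * side N k + grid_shift N t,
           z%:~R * side N k + grid_shift N t + side N k[).
Proof.
rewrite /grid_index floor_eq in_itv /= ler_pdivlMr ?side_gt0// ltr_pdivrMr ?side_gt0//.
by rewrite intrD mulrDl mul1r lerBrDr ltrBlDr addrAC.
Qed.

Lemma floor_neq_near (a b : R) : `|a - b| < 6^-1 -> Num.floor a != Num.floor b ->
  exists z : int, `|a - z%:~R| < 6^-1.
Proof.
move=> ab fab; have /andP[a1 a2] := floor_itv a; have /andP[b1 b2] := floor_itv b.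
have [lt|gt|eq] := ltgtP (Num.floor a) (Num.floor b); last by rewrite eq eqxx in fab.
- exists (Num.floor b).
  have : (Num.floor a + 1)%:~R <= (Num.floor b)%:~R :> R by rewrite ler_int; lia.
  by move: ab; rewrite !ltr_norml; lra.
- exists (Num.floor a).
  have : (Num.floor b + 1)%:~R <= (Num.floor a)%:~R :> R by rewrite ler_int; lia.
  by move: ab; rewrite !ltr_norml; lra.
Qed.

Lemma pow2_neq_mul3 k (z : int) : (2 ^+ k : int) <> 3 * z.
Proof.
elim: k z => [|k ih] z; first by rewrite expr0; lia.
rewrite exprS => h; have [y zy] : exists y : int, z = 2 * y by exists (2 ^+ k - z); lia.
by apply: (ih y); lia.
Qed.

(** If both grids failed, [x] would lie within a sixth of a side of an endpoint of each. The grids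
    differ by 2^k / 3 sides, so 2^k and 3 (z1 - z2) would differ by less than 3 (1/6 + 1/6) = 1 and
    be equal, but 3 does not divide 2^k. *)
Lemma exists_good_grid N k x : exists t, forall y, `|x - y| < side N k / 6 ->
  grid_index t N k y = grid_index t N k x.
Proof.
apply: contrapT => /forallNP bad.
have near t : exists z : int, `|(x - grid_shift N t) / side N k - z%:~R| < 6^-1.
  have /existsNP[y /not_implyP[xy /eqP neq]] := bad t.
  apply: (@floor_neq_near _ ((y - grid_shift N t) / side N k)); last by rewrite eq_sym.
  rewrite -mulrBl normrM [X in _ * X]gtr0_norm ?invr_gt0 ?side_gt0//.
  rewrite ltr_pdivrMr ?side_gt0// mulrC.
  by rewrite (_ : _ - _ = x - y)//; ring.
have [z1 hz1] := near false; have [z2 hz2] := near true.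
apply: (@pow2_neq_mul3 k (z1 - z2)).
have E : (x - grid_shift N true) / side N k =
   (x - grid_shift N false) / side N k - 2 ^+ k / 3.
  rewrite /grid_shift /side /=; field.
  by rewrite !expf_neq0.
move: hz1 hz2; rewrite E; set w := _ / side N k => hz1 hz2.
have : `|2 ^+ k - 3 * (z1 - z2)%:~R : R| < 1.
  by move: hz1 hz2; rewrite intrB !ltr_norml; lra.
rewrite (_ : _ - _ = ((2 ^+ k : int) - 3 * (z1 - z2))%:~R); last first.
  by rewrite !intrB intrM rmorphXn intrB.
rewrite -intr_norm ltrz1 => h; lia.
Qed.

End grid1.

Section grid.
Variable R : realType.
Local Notation euclid n := (n.-tuple (measurableTypeR R)).
Variable n : nat.
Implicit Types (N k : nat) (t : {ffun 'I_n -> bool}).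

Definition grid_vec t N k (x : euclid n) : {ffun 'I_n -> int} :=
  [ffun l => grid_index (t l) N k (tnth x l)].

(** The translation is chosen separately in each coordinate, which gives 2^n grids; [pickle] encodes
    the integer position of a cell as the natural number by which filtrations index it. *)
Definition grid t N k (x : euclid n) : nat := pickle (grid_vec t N k x).

Lemma gridP t N k x y : grid t N k x = grid t N k y <->
  forall l, grid_index (t l) N k (tnth x l) = grid_index (t l) N k (tnth y l).
Proof.
split=> [/(pcan_inj pickleK) /ffunP xy l|xy]; first by have := xy l; rewrite !ffunE.
by congr pickle; apply/ffunP => l; rewrite !ffunE.
Qed.

Lemma grid_refine t N k x y : grid t N k.+1 x = grid t N k.+1 y ->
  grid t N k x = grid t N k y.
Proof. by move=> /gridP xy; apply/gridP => l; exact: grid_index_refine. Qed.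

Definition grid_corner t N k (x : euclid n) (l : 'I_n) : R :=
  (grid_index (t l) N k (tnth x l))%:~R * side R N k + grid_shift R N (t l).

Lemma grid_cellE t N k x : cell (grid t N) k x =
  [set y | forall l, `[grid_corner t N k x l, grid_corner t N k x l + side R N k[%classic
           (tnth y l)].
Proof.
apply/seteqP; split=> y.
  by move=> /gridP xy l /=; rewrite -grid_indexE xy.
by move=> xy; apply/gridP => l; apply/eqP; rewrite grid_indexE; exact: xy.
Qed.

Lemma measurable_grid_cell t N k x : measurable (cell (grid t N) k x).
Proof.
rewrite grid_cellE.
by apply: (measurable_box (A := (fun l => `[grid_corner t N k x l, grid_corner t N k x l + side R N k[%classic : set (measurableTypeR R)))) => l; exact: measurable_itv.
Qed.

Lemma measurable_grid t N k i : measurable [set x | grid t N k x = i].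
Proof.
have [->//|/set0P[x <-]] := eqVneq [set x | grid t N k x = i] set0.
exact: measurable_grid_cell.
Qed.

Lemma leb_grid_cell t N k x : leb R n (cell (grid t N) k x) = (side R N k ^+ n)%:E.
Proof.
rewrite grid_cellE [leb R n]/leb.
rewrite (tuple_measure_box _ (A := (fun l => `[grid_corner t N k x l, grid_corner t N k x l + side R N k[%classic : set (measurableTypeR R))))//.
rewrite (eq_bigr (fun=> (side R N k)%:E)).
  by rewrite prodEFin prodr_const card_ord.
move=> l _; rewrite [LHS]lebesgue_measure_itv /= lte_fin ltrDl side_gt0.
by rewrite -EFinB addrAC subrr add0r.
Qed.

Lemma grid_cell_subset t N k x :
  cell (grid t N) k x `<=` cube [tuple grid_corner t N k x l | l < n] (side R N k).
Proof.
rewrite grid_cellE => y xy l; rewrite tnth_mktuple.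
by have := xy l; rewrite /= in_itv /= => /andP[-> /ltW].
Qed.

Lemma leb_cube (a : euclid n) (l : R) : 0 < l -> leb R n (cube a l) = (l ^+ n)%:E.
Proof.
move=> l0.
have -> : cube a l = [set y | forall i, `[tnth a i, tnth a i + l]%classic (tnth y i)].
  by apply/seteqP; split => y ay i; have := ay i; rewrite /= in_itv.
rewrite [leb R n]/leb.
rewrite (tuple_measure_box _ (A := (fun i => `[tnth a i, tnth a i + l]%classic : set (measurableTypeR R))))//.
rewrite (eq_bigr (fun=> l%:E)); first by rewrite prodEFin prodr_const card_ord.
move=> i _; rewrite [LHS]lebesgue_measure_itv /= lte_fin ltrDl l0.
by rewrite -EFinB addrAC subrr add0r.
Qed.

Lemma measurable_cube (a : euclid n) (l : R) : measurable (cube a l).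
Proof.
have -> : cube a l = [set y | forall i, `[tnth a i, tnth a i + l]%classic (tnth y i)].
  by apply/seteqP; split => y ay i; have := ay i; rewrite /= in_itv.
by apply: (measurable_box (A := (fun i => `[tnth a i, tnth a i + l]%classic : set (measurableTypeR R)))) => i; exact: measurable_itv.
Qed.

Lemma coord_le_eucl_dist (x y : euclid n) l : `|tnth x l - tnth y l| <= eucl_dist x y.
Proof.
rewrite -sqrtr_sqr ler_wsqrtr// (bigD1 l)//= lerDl sumr_ge0// => i _.
exact: sqr_ge0.
Qed.

Lemma exists_grid_cell m N (x : euclid n) (y : 'I_m -> euclid n) (r : R) :
  (forall i, eucl_dist x (y i) <= r) -> (2 ^+ N)^-1 <= 6 * r -> 6 * r < 2 ^+ N ->
  exists t (k : 'I_(N + N).+1),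
    (forall i, grid t N k (y i) = grid t N k x) /\ side R N k <= 12 * r.
Proof.
move=> yr r1 r2.
(* The finest level of side above 6 r is taken, so its side is at most 12 r. Sides run from 2^N at
   level 0 to 2^(-N) at level 2N; by the bounds on [r] level 0 qualifies and level 2N does not. *)
pose P k := (k <= N + N)%N && (6 * r < side R N k).
have exP : exists k, P k by exists 0%N; rewrite /P /side expr0 divr1 r2.
have ubP k : P k -> (k <= N + N)%N by case/andP.
have [k /andP[kN rk] kmax] := ex_maxnP exP ubP.
have k1 : (k < N + N)%N.
  rewrite ltn_neqAle kN andbT; apply/eqP => kNN.
  move: rk; rewrite kNN /side exprD invfM mulrA divff ?mul1r; last by rewrite expf_neq0.
  by rewrite ltNge r1.
have rk1 : side R N k.+1 <= 6 * r.
  rewrite leNgt; apply/negP => rk1.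
  by have := kmax k.+1; rewrite /P k1 rk1 ltnn => /(_ isT).
pose t := [ffun l : 'I_n => sval (cid (exists_good_grid N k (tnth x l)))].
exists t, (Ordinal (kN : (k < (N + N).+1)%N)); split => [i|] /=; last first.
  by rewrite sideS; lra.
apply/gridP => l; rewrite ffunE; apply: (svalP (cid (exists_good_grid N k (tnth x l)))).
apply: le_lt_trans (coord_le_eucl_dist _ _ _) _; apply: le_lt_trans (yr i) _.
by rewrite ltr_pdivlMr//; lra.
Qed.

End grid.

(** * The upper bound *)

Lemma prode_gt0 (R : realType) (I : Type) (r : seq I) (P : pred I) (x : I -> \bar R) :
  (forall i, (0 < x i)%E) -> (0 < \prod_(i <- r | P i) x i)%E.
Proof. by move=> x0; elim/big_ind: _ => // a b; exact: mule_gt0. Qed.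

Lemma lty_prode (R : realType) (I : finType) (x : I -> \bar R) i :
  (forall i, (0 < x i)%E) -> (\prod_i x i < +oo)%E -> (x i < +oo)%E.
Proof.
move=> x0; rewrite (bigD1 i)//=; set Y := (\prod_(j | _) _)%E.
have Y0 : (0 < Y)%E by exact: prode_gt0.
by rewrite ltey => /eqP xY; rewrite ltey; apply/eqP => xi; apply: xY; rewrite xi gt0_mulye.
Qed.

Lemma le_prode (R : realType) (I : Type) (r : seq I) (P : pred I) (x y : I -> \bar R) :
  (forall i, (0 <= x i <= y i)%E) ->
  (\prod_(i <- r | P i) x i <= \prod_(i <- r | P i) y i)%E.
Proof.
move=> xy; suff /andP[] : (0 <= \prod_(i <- r | P i) x i <= \prod_(i <- r | P i) y i)%E by [].
elim/big_ind2: _ => [|a b c d /andP[a0 ab] /andP[c0 cd]|i _]; rewrite ?lee01 ?lexx//.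
by rewrite mule_ge0//= lee_pmul.
Qed.

Section weights.
Context (R : realType) (m n : nat) (q : R) (p : 'I_m -> R).
Local Notation euclid n := (n.-tuple (measurableTypeR R)).
Variable w : 'I_m -> euclid n -> R.
Hypotheses (q_gt0 : 0 < q) (p_gt1 : forall i, 1 < p i).
Hypotheses (mw : forall i, measurable_fun setT (w i)) (w_gt0 : forall i x, 0 < w i x).

Definition all_weights : 'I_m.+1 -> euclid n -> R :=
  slot (u_weight q w) (sigma_weight p w).

Local Notation v := all_weights.

Lemma conj_exp_gt1 i : 1 < conj_exp (p i).
Proof.
have := p_gt1 i => pi1; rewrite /conj_exp ltr_pdivlMr ?subr_gt0// mul1r.
by rewrite gtrBl.
Qed.

Lemma inv_conj_exp i : (conj_exp (p i))^-1 = 1 - (p i)^-1.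
Proof.
have pi1 := p_gt1 i; rewrite /conj_exp invf_div mulrBl mul1r divff//.
by rewrite gt_eqF// (lt_trans _ pi1).
Qed.

Lemma all_weights_gt0 i x : 0 < v i x.
Proof.
case: (unliftP ord0 i) => [k ->|->]; rewrite /v ?slot_lift ?slot0 powR_gt0//.
exact: prodr_gt0.
Qed.

Lemma measurable_all_weights i : measurable_fun setT (v i).
Proof.
case: (unliftP ord0 i) => [k ->|->]; rewrite /v ?slot_lift ?slot0.
  exact: measurableT_comp (measurable_powR _) (mw k).
apply: measurableT_comp (measurable_powR _) _.
by apply: measurable_prod => i' _.
Qed.

Lemma prod_all_weights x : \prod_i v i x `^ slot_inv q p i = 1.
Proof.
rewrite big_ord_recl /v /slot_inv !slot0 /u_weight -powRrM divff ?gt_eqF//.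
rewrite powRr1; last by apply: prodr_ge0 => i _; exact: ltW.
rewrite -big_split /= big1// => i _; rewrite !slot_lift -inv_conj_exp.
rewrite /sigma_weight -powRrM mulNr divff ?powR_inv1 ?(ltW (w_gt0 _ _))//.
  by rewrite divff// gt_eqF.
by rewrite gt_eqF// (lt_trans _ (conj_exp_gt1 i)).
Qed.

Variable A : R.
Hypothesis cubeA : forall Q, @is_cube R n Q ->
  (average Q (u_weight q w) *
   \prod_(i < m) (average Q (sigma_weight p w i) `^ (q / conj_exp (p i))) <= A%:E)%E.

Let mcube (a : euclid n) (l : R) : measurable (cube a l).
Proof. exact: measurable_cube. Qed.

Lemma average_gt0 (a : euclid n) (l : R) i : 0 < l -> (0 < average (cube a l) (v i))%E.
Proof.
move=> l0; rewrite /average leb_cube//=; apply: mule_gt0.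
  by rewrite lte_fin invr_gt0 exprn_gt0.
apply: integral_gt0_of_pos => //.
- exact: measurable_funTS (measurable_all_weights i).
- by move=> x _; exact: all_weights_gt0.
- suff : (0 < leb R n (cube a l))%E by [].
  by rewrite leb_cube// lte_fin exprn_gt0.
Qed.

(** Local integrability of u_w and of the sigma_i comes from the A_{P,q} condition: all factors of a
    finite product of positive factors are finite. *)
Lemma average_lty (a : euclid n) (l : R) i : 0 < l -> (average (cube a l) (v i) < +oo)%E.
Proof.
move=> l0; have := cubeA (ex_intro _ a (ex_intro2 _ _ l l0 erefl)).
move=> /le_lt_trans/(_ (ltry A)).
rewrite -[X in (X * _)%E]poweRe1; last first.
  by have := average_gt0 a ord0 l0; rewrite /v slot0 => /ltW.
pose ex : 'I_m.+1 -> R := slot 1 (fun i => q / conj_exp (p i)).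
pose x i := (average (cube a l) (v i) `^ ex i)%E.
rewrite (_ : (_ * _)%E = (\prod_i x i)%E); last first.
  rewrite big_ord_recl /x /ex /v !slot0; congr (_ * _)%E.
  by apply: eq_bigr => k _; rewrite !slot_lift.
move=> /(lty_prode i)/=; rewrite /x => /(_ _) h.
apply: lty_poweRy (h _) => [|k]; last exact/poweR_gt0/average_gt0.
case: (unliftP ord0 i) => [k ->|->]; rewrite /ex ?slot_lift ?slot0 ?oner_neq0//.
by rewrite gt_eqF// divr_gt0// (lt_trans _ (conj_exp_gt1 k)).
Qed.

Lemma integral_cube_lty (a : euclid n) (l : R) i : 0 < l ->
  (\int[leb R n]_(x in cube a l) (v i x)%:E < +oo)%E.
Proof.
move=> l0; have := average_lty a i l0; rewrite /average leb_cube//=.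
rewrite !ltey; apply: contra => /eqP ->; rewrite gt0_muley//.
by rewrite lte_fin invr_gt0 exprn_gt0.
Qed.

(** The q-th root makes the condition symmetric in the slots. The [b i] allow for half-open grid
    cells, whose averages are at most those over the closed cube. *)
Lemma cube_product_bound (a : euclid n) (l : R) (b : 'I_m.+1 -> R) : 0 < l ->
  (forall i, 0 <= b i) ->
  (forall i, ((b i)%:E <= average (cube a l) (v i))%E) ->
  \prod_i b i `^ slot_inv q p i <= A `^ q^-1.
Proof.
move=> l0 b0 ba.
have H : b ord0 * \prod_(i < m) b (lift ord0 i) `^ (q / conj_exp (p i)) <= A.
  rewrite -lee_fin EFinM; apply: le_trans (cubeA (ex_intro _ a (ex_intro2 _ _ l l0 erefl))).
  apply: lee_pmul => //.
  - by rewrite lee_fin.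
  - by rewrite lee_fin prodr_ge0// => i _; exact: powR_ge0.
  - by have := ba ord0; rewrite /v slot0.
  rewrite -prodEFin; apply: le_prode => i /=.
  rewrite lee_fin powR_ge0 /= -poweR_EFin; apply: gt0_ler_poweR.
  - by rewrite divr_ge0 ?(ltW q_gt0)// ltW// (lt_trans _ (conj_exp_gt1 i)).
  - by rewrite in_itv /= leey lee_fin b0.
  - have := average_gt0 a (lift ord0 i) l0; rewrite /v slot_lift => h.
    by rewrite in_itv /= leey ltW.
  - by have := ba (lift ord0 i); rewrite /v slot_lift.
have -> : \prod_i b i `^ slot_inv q p i =
   (b ord0 * \prod_(i < m) b (lift ord0 i) `^ (q / conj_exp (p i))) `^ q^-1.
  rewrite powRM//; last by apply: prodr_ge0 => i _; exact: powR_ge0.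
  rewrite big_ord_recl /slot_inv slot0; congr (_ * _).
  rewrite powR_prod; last by move=> i; exact: powR_ge0.
  apply: eq_bigr => i _; rewrite slot_lift -powRrM mulrAC divff ?gt_eqF// mul1r.
  by rewrite inv_conj_exp.
have X0 : 0 <= b ord0 * \prod_(i < m) b (lift ord0 i) `^ (q / conj_exp (p i)).
  by rewrite mulr_ge0// prodr_ge0// => i _; exact: powR_ge0.
apply: ge0_ler_powR; rewrite ?nnegrE ?invr_ge0 ?(ltW q_gt0)//.
exact: le_trans H.
Qed.

End weights.

Section upper_bound.
Context (R : realType) (m n : nat) (alpha q : R) (p : 'I_m -> R) (j : 'I_m.+1).
Local Notation euclid n := (n.-tuple (measurableTypeR R)).
Hypotheses (m_gt0 : (0 < m)%N) (n_gt0 : (0 < n)%N).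
Hypotheses (alpha_gt0 : 0 < alpha) (alpha_ltn : alpha < n%:R).
Hypotheses (q_gt0 : 0 < q) (p_gt1 : forall i, 1 < p i).

Let beta : R := alpha / n%:R.

Hypothesis sum_s : \sum_i slot_inv q p i = m%:R - beta.
Hypothesis dominant : forall i, i != j ->
  slot_inv q p j <= (1 - beta) * slot_inv q p i.

Let n0 : 0 < n%:R :> R. Proof. by rewrite ltr0n. Qed.
Let beta01 : 0 < beta < 1.
Proof. by rewrite /beta divr_gt0//= ltr_pdivrMr// mul1r. Qed.

Let ratio : R := 2 `^ (- alpha).

Let ratio_gt0 : 0 < ratio. Proof. exact: powR_gt0. Qed.

Let ratio_lt1 : ratio < 1.
Proof.
have ln2 : 0 < ln 2 :> R by apply: ln_gt0; lra.
by rewrite /ratio powR_expR// -[ltRHS]expR0 ltr_expR mulNr oppr_lt0 mulr_gt0.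
Qed.

Let G : R := (1 - ratio)^-1.
Let G_ge0 : 0 <= G. Proof. by rewrite invr_ge0 subr_ge0 ltW. Qed.

(** With G = 1 / (1 - 2^(-alpha)) each term is the difference of two consecutive values of G
    side^alpha, and the sum telescopes. *)
Lemma side_geometric N l L :
  \sum_(l <= k < L) side R N k `^ alpha <= G * side R N l `^ alpha.
Proof.
have [lL|Ll] := leqP l L; last first.
  by rewrite big_geq ?(ltnW Ll)// mulr_ge0 ?powR_ge0.
have stepE k : side R N k `^ alpha =
    G * side R N k `^ alpha - G * side R N k.+1 `^ alpha.
  rewrite (sideS R N k) powRM ?(ltW (side_gt0 _ _ _))//.
  have -> : 2 `^ alpha = ratio^-1 by rewrite /ratio powRN invrK.
  rewrite /G; field.
  by apply/andP; split; apply/eqP => h; move: ratio_gt0 ratio_lt1; rewrite -/ratio; lra.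
rewrite (eq_bigr (fun k => - (G * side R N k.+1 `^ alpha - G * side R N k `^ alpha))).
  rewrite sumrN telescope_sumr// opprB gerBl mulr_ge0 ?powR_ge0//.
by move=> k _; rewrite opprB -stepE.
Qed.

Variable w : 'I_m -> euclid n -> R.
Hypotheses (mw : forall i, measurable_fun setT (w i)) (w_gt0 : forall i x, 0 < w i x).
Variable A : R.
Hypothesis cubeA : forall Q, @is_cube R n Q ->
  (average Q (u_weight q w) *
   \prod_(i < m) (average Q (sigma_weight p w i) `^ (q / conj_exp (p i))) <= A%:E)%E.
Variable f : 'I_m -> euclid n -> R.
Hypotheses (mf : forall i, measurable_fun setT (f i)) (f_ge0 : forall i x, 0 <= f i x).
Hypothesis norm_f : forall i,
  (\int[leb R n]_x (f i x `^ p i * w i x `^ p i)%:E <= 1)%E.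

Local Notation v := (all_weights q p w).

Definition grid_sum (N : nat) (t : {ffun 'I_n -> bool}) (x : euclid n) : R :=
  \sum_(k < (N + N).+1) side R N k `^ (alpha - (m * n)%:R) *
     \prod_(i < m) mass (leb R n) (grid t N) (f i) k x.

Definition upper_const : R := dyadic_const q beta G p j.

Let v0 := all_weights_gt0 q p w_gt0.
Let mv := measurable_all_weights q p mw.

Lemma grid_cell_gt0 t N k x : (0 < leb R n (cell (grid t N) k x))%E.
Proof. by rewrite leb_grid_cell lte_fin exprn_gt0// side_gt0. Qed.

Lemma grid_cell_lty t N k x : (leb R n (cell (grid t N) k x) < +oo)%E.
Proof. by rewrite leb_grid_cell ltry. Qed.

Let vint t N i k x : (cint (leb R n) (grid t N) (v i) k x <=
    \int[leb R n]_(y in cube [tuple grid_corner t N k x l | l < n] (side R N k)) (v i y)%:E)%E.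
Proof.
apply: ge0_subset_integral (@grid_cell_subset R n t N k x).
- exact: measurable_grid_cell.
- exact: measurable_cube.
- by apply/measurable_EFinP; exact: measurable_funTS.
- by move=> y _; rewrite lee_fin ltW.
Qed.

Lemma cint_weights_lty t N i k x : (cint (leb R n) (grid t N) (v i) k x < +oo)%E.
Proof.
apply: le_lt_trans (vint t N i k x) _.
by apply: (integral_cube_lty q_gt0 p_gt1 mw w_gt0 cubeA); exact: side_gt0.
Qed.

(** [f i] as a density with respect to sigma_i; the norms agree because p p' - p' = p. *)
Let g i x := f i x * w i x `^ conj_exp (p i).

Let gv i x : g i x * v (lift ord0 i) x = f i x.
Proof.
rewrite /g /all_weights slot_lift /sigma_weight powRN -mulrA divff ?mulr1//.
by rewrite gt_eqF// powR_gt0.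
Qed.

Let mg i : measurable_fun setT (g i).
Proof.
apply: measurable_funM => //.
exact: measurableT_comp (measurable_powR _) (mw i).
Qed.

Let g_ge0 i x : 0 <= g i x. Proof. by rewrite mulr_ge0// powR_ge0. Qed.

Let norm_g i : (\int[leb R n]_x (g i x `^ p i * v (lift ord0 i) x)%:E <= 1)%E.
Proof.
apply: le_trans (norm_f i).
rewrite le_eqVlt; apply/orP; left; apply/eqP; apply: eq_integral => x _.
rewrite /g /all_weights slot_lift /sigma_weight.
have p1 := p_gt1 i; have p0 : 0 < p i by exact: lt_trans p1.
rewrite powRM ?powR_ge0// -mulrA -powRrM -powRD; last first.
  by apply/implyP => _; rewrite gt_eqF.
congr (_ * _ `^ _)%:E; rewrite /conj_exp; field.
by rewrite subr_eq0 gt_eqF.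
Qed.

Lemma cint_f_lty t N i k x : (cint (leb R n) (grid t N) (f i) k x < +oo)%E.
Proof.
have -> : f i = (fun y => g i y * v (lift ord0 i) y) by apply/funext => y; rewrite gv.
exact: (cint_lty_norm (measurable_grid t N) (@grid_cell_gt0 t N) (mv _) (v0 _)
  (cint_weights_lty t N _) (mg i) (g_ge0 i) (p_gt1 i) (norm_g i)).
Qed.

Lemma grid_sum_bound N t :
  (\int[leb R n]_x (grid_sum N t x `^ q * u_weight q w x)%:E <=
   ((upper_const * (A `^ q^-1) `^ ((1 - beta) / slot_inv q p j)) `^ q)%:E)%E.
Proof.
have V k x : mass (leb R n) (grid t N) (fun=> 1) k x = side R N k ^+ n.
  apply: EFin_inj; rewrite (mass_one (measurable_grid t N) (@grid_cell_lty t N)).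
  exact: leb_grid_cell.
have HK k x : \prod_i (mass (leb R n) (grid t N) (v i) k x /
    mass (leb R n) (grid t N) (fun=> 1) k x) `^ slot_inv q p i <= A `^ q^-1.
  have sk := side_gt0 R N k.
  apply: (cube_product_bound q_gt0 p_gt1 mw w_gt0 cubeA
    (a := [tuple grid_corner t N k x l | l < n]) sk) => i.
    by rewrite divr_ge0// ?fine_ge0 ?integral_EFin_ge0// => y _; exact: ltW.
  rewrite /average leb_cube//= V mulrC EFinM.
  apply: lee_wpmul2l; first by rewrite lee_fin invr_ge0 exprn_ge0// ltW.
  by rewrite massE//; exact: cint_weights_lty.
have := @dyadic_main R m q beta G p j m_gt0 q_gt0 p_gt1 beta01 G_ge0 sum_s dominant
  _ _ (leb R n) (grid t N) v (A `^ q^-1) g (N + N)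
  (measurable_grid t N) (@grid_refine R n t N) (@grid_cell_gt0 t N) (@grid_cell_lty t N)
  mv v0 (cint_weights_lty t N)
  (prod_all_weights q_gt0 p_gt1 w_gt0) HK.
rewrite [v ord0]/all_weights slot0 -/upper_const.
move=> /(_ mg g_ge0 norm_g _) H; apply: le_trans (H _); last first.
- move=> x l _; under eq_bigr do rewrite V.
  rewrite V; have E k : (side R N k ^+ n) `^ beta = side R N k `^ alpha.
    rewrite -powR_mulrn ?(ltW (side_gt0 _ _ _))// -powRrM /beta mulrC divfK//.
    by rewrite gt_eqF.
  under eq_bigr do rewrite E.
  by rewrite E; exact: side_geometric.
rewrite le_eqVlt; apply/orP; left; apply/eqP; apply: eq_integral => x _.
congr (_ `^ _ * _)%:E; apply: eq_bigr => k _; rewrite V.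
have sk := side_gt0 R N k.
rewrite -powR_mulrn ?(ltW sk)// -powRrM {1}/beta (mulrC n%:R) divfK ?gt_eqF//.
rewrite powRB; last by apply/implyP => _; rewrite gt_eqF.
rewrite -mulrA; congr (_ * _).
transitivity (\prod_(i < m) ((side R N k ^+ n)^-1 * mass (leb R n) (grid t N) (f i) k x)).
  rewrite big_split /= prodr_const card_ord -exprVn -exprM; congr (_ * _).
  by rewrite powR_mulrn ?(ltW sk)// mulnC exprVn.
apply: eq_bigr => i _; rewrite /avg V mulrC; congr (mass _ _ _ _ _ / _).
by apply/funext => y; rewrite mulr1 gv.
Qed.

Let gam : R := (m * n)%:R - alpha.

Let gam_gt0 : 0 < gam.
Proof.
rewrite subr_gt0; apply: lt_le_trans alpha_ltn _.
by rewrite ler_nat leq_pmull.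
Qed.

Definition spread (x : euclid n) (y : m.-tuple (euclid n)) : R :=
  \sum_(i < m) eucl_dist x (tnth y i).

Lemma eucl_dist_ge0 (x y : euclid n) : 0 <= eucl_dist x y.
Proof. exact: sqrtr_ge0. Qed.

Lemma spread_ge0 x y : 0 <= spread x y.
Proof. by apply: sumr_ge0 => i _; exact: eucl_dist_ge0. Qed.

Lemma measurable_eucl_dist (x : euclid n) : measurable_fun setT (eucl_dist x).
Proof.
have -> : eucl_dist x = (fun y : euclid n =>
    (\sum_(k < n) (tnth x k - tnth y k) ^+ 2) `^ 2^-1).
  apply/funext => y; rewrite /eucl_dist powR12_sqrt// sumr_ge0// => i _.
  exact: sqr_ge0.
apply: measurableT_comp (measurable_powR _) _.
apply: measurable_sum => k; apply: measurable_funX.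
apply: measurable_funB; first exact: measurable_cst.
exact: (@measurable_tnth _ (measurableTypeR R)).
Qed.

Lemma measurable_spread x : measurable_fun setT (spread x).
Proof.
apply: measurable_sum => i.
apply: measurableT_comp (measurable_eucl_dist x) _.
exact: measurable_tnth.
Qed.

(** The kernel on the range of distances where [exists_grid_cell] applies for all N >= M. *)
Definition truncated_kernel (M : nat) x y : R :=
  (((2 ^+ M)^-1 <= 6 * spread x y) && (6 * spread x y < 2 ^+ M))%:R *
  spread x y `^ (- gam).

Let Fprod (y : m.-tuple (euclid n)) : R := \prod_(i < m) f i (tnth y i).

Let Fprod_ge0 y : 0 <= Fprod y. Proof. exact: prodr_ge0. Qed.

Let trunc M x : \bar R := (\int[lebm R m n]_y (Fprod y * truncated_kernel M x y)%:E)%E.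

Definition grid_total N x : R := 12 `^ gam * \sum_t grid_sum N t x.

Let cell_fun t N k x i (z : euclid n) : R := \1_(cell (grid t N) k x) z * f i z.

Let cell_fun_ge0 t N k x i z : 0 <= cell_fun t N k x i z.
Proof. exact: mulr_ge0. Qed.

Let measurable_cell_fun t N k x i : measurable_fun setT (cell_fun t N k x i).
Proof.
apply: measurable_funM => //; apply: measurable_indic.
exact: measurable_grid_cell.
Qed.

(** Some cell contains [x] and all the y_i and has side at most 12 times the spread. Its term alone
    bounds the left side, with the constant 12^gam. *)
Lemma truncated_kernel_le M N x y : (M <= N)%N ->
  Fprod y * truncated_kernel M x y <=
  \sum_t \sum_(k < (N + N).+1) (12 `^ gam * side R N k `^ (alpha - (m * n)%:R)) *
     \prod_(i < m) cell_fun t N k x i (tnth y i).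
Proof.
move=> MN; rewrite /truncated_kernel.
have c0 t (k : 'I_(N + N).+1) : 0 <= (12 `^ gam * side R N k `^ (alpha - (m * n)%:R)) *
     \prod_(i < m) cell_fun t N k x i (tnth y i).
  by rewrite !mulr_ge0 ?powR_ge0// prodr_ge0.
case: (boolP (_ && _)) => [/andP[r1 r2]|_]; last first.
  by rewrite mul0r mulr0 sumr_ge0// => t _; exact: sumr_ge0.
have e2 : 2 ^+ M <= 2 ^+ N :> R by rewrite ler_weXn2l// ler1n.
have s1 : (2 ^+ N)^-1 <= 6 * spread x y.
  by apply: le_trans r1; rewrite lef_pV2 ?posrE ?exprn_gt0.
have s2 : 6 * spread x y < 2 ^+ N by exact: lt_le_trans e2.
have dle i : eucl_dist x (tnth y i) <= spread x y.
  rewrite /spread (bigD1 i)//= lerDl sumr_ge0// => k _; exact: eucl_dist_ge0.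
have [t [k [yx sk]]] := exists_grid_cell dle s1 s2.
have sp : 0 < spread x y.
  have : 0 < (2 ^+ N)^-1 :> R by rewrite invr_gt0 exprn_gt0.
  lra.
apply: (@le_trans _ _ ((12 `^ gam * side R N k `^ (alpha - (m * n)%:R)) *
     \prod_(i < m) cell_fun t N k x i (tnth y i))); last first.
  rewrite (bigD1 t)//= (bigD1 k)//= -addrA lerDl addr_ge0//; last first.
    by apply: sumr_ge0 => t' _; exact: sumr_ge0.
  by apply: sumr_ge0 => k' _; exact: c0.
rewrite mul1r mulrC.
have -> : \prod_(i < m) cell_fun t N k x i (tnth y i) = Fprod y.
  by apply: eq_bigr => i _; rewrite /cell_fun indicE mem_set ?mul1r//; exact: yx.
apply: ler_wpM2r => //.
rewrite (_ : alpha - (m * n)%:R = - gam); last by rewrite /gam; ring.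
rewrite !powRN ler_pdivlMr ?powR_gt0 ?side_gt0// mulrC ler_pdivrMr ?powR_gt0//.
rewrite -powRM ?(ltW sp)//; apply: ge0_ler_powR; rewrite ?nnegrE ?(ltW gam_gt0)//.
- exact/ltW/side_gt0.
- by rewrite mulr_ge0// ltW.
Qed.

Lemma trunc_le M N x : (M <= N)%N -> (trunc M x <= (grid_total N x)%:E)%E.
Proof.
move=> MN.
apply: (@le_trans _ _ (\int[lebm R m n]_y (\sum_t \sum_(k < (N + N).+1)
    (12 `^ gam * side R N k `^ (alpha - (m * n)%:R)) *
     \prod_(i < m) cell_fun t N k x i (tnth y i))%:E)%E).
  apply: le_integral_EFin => y _; last exact: truncated_kernel_le.
  by rewrite mulr_ge0// mulr_ge0 ?powR_ge0.
have mP t k : measurable_fun setT (fun y : m.-tuple (euclid n) =>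
    \prod_(i < m) cell_fun t N k x i (tnth y i)).
  by apply: (measurable_tuple_prod (h := fun i => cell_fun t N k x i)).
have P0 t k (y : m.-tuple (euclid n)) : 0 <= \prod_(i < m) cell_fun t N k x i (tnth y i).
  by apply: prodr_ge0.
rewrite integral_EFin_sum//; last 2 first.
- move=> t; apply: measurable_sum => k.
  by apply: measurable_funM; [exact: measurable_cst|exact: mP].
- by move=> t y; apply: sumr_ge0 => k _; rewrite !mulr_ge0 ?powR_ge0.
rewrite /grid_total mulr_sumr -sumEFin; apply: lee_sum => t _.
rewrite integral_EFin_sum//; last 2 first.
- by move=> k; apply: measurable_funM; [exact: measurable_cst|exact: mP].
- by move=> k y; rewrite !mulr_ge0 ?powR_ge0.
rewrite /grid_sum mulr_sumr -sumEFin; apply: lee_sum => k _.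
rewrite integral_EFinZ ?mulr_ge0 ?powR_ge0//.
rewrite [in leRHS]mulrA [leRHS]EFinM; apply: lee_wpmul2l; first by rewrite lee_fin mulr_ge0 ?powR_ge0.
rewrite [lebm R m n]/lebm (integral_tuple_prod _ (h := fun i => cell_fun t N k x i))//.
rewrite -prodEFin le_eqVlt; apply/orP; left; apply/eqP; apply: eq_bigr => i _.
rewrite integral_EFin_indic.
rewrite fineK ?ge0_fin_numE ?integral_EFin_ge0//; exact: cint_f_lty.
Qed.

Lemma grid_total_ge0 N x : 0 <= grid_total N x.
Proof.
rewrite mulr_ge0 ?powR_ge0// sumr_ge0// => t _; apply: sumr_ge0 => k _.
rewrite mulr_ge0 ?powR_ge0// prodr_ge0// => i _.
by rewrite fine_ge0// integral_EFin_ge0.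
Qed.

Lemma grid_sum_ge0 N t x : 0 <= grid_sum N t x.
Proof.
apply: sumr_ge0 => k _.
rewrite mulr_ge0 ?powR_ge0// prodr_ge0// => i _.
by rewrite fine_ge0// integral_EFin_ge0.
Qed.

Lemma measurable_grid_sum N t : measurable_fun setT (grid_sum N t).
Proof.
apply: (@lconst_measurable _ _ _ (measurable_grid t N) (N + N)) => x y xy.
apply: eq_bigr => k _; congr (_ * _); apply: eq_bigr => i _.
apply: lconst_mass; apply: (pi_le (@grid_refine R n t N) _ xy).
by rewrite -ltnS.
Qed.

Let card_grid : R := #|{ffun 'I_n -> bool}|%:R.
Let Kpow : R := (A `^ q^-1) `^ ((1 - beta) / slot_inv q p j).

(** One factor [card_grid] comes from the q-th power of a sum over grids, and its q-th root from
    adding the integrals of the separate grids; this works for every q > 0. *)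
Definition borel_const : R := 12 `^ gam * card_grid * card_grid `^ q^-1 * upper_const.

Lemma borel_const_ge0 : 0 <= borel_const.
Proof.
have c0 : 0 <= upper_const by exact: dyadic_const_ge0.
apply: mulr_ge0 c0; apply: mulr_ge0 (powR_ge0 _ _).
by apply: mulr_ge0; [exact: powR_ge0|exact: ler0n].
Qed.

Let mu_w : measurable_fun setT (u_weight q w).
Proof. by have := mv ord0; rewrite /all_weights slot0. Qed.

Let u_w0 x : 0 < u_weight q w x.
Proof. by have := v0 ord0 x; rewrite /all_weights slot0. Qed.

Lemma sum_le_card_max (I : finType) (x : I -> R) : (forall i, 0 <= x i) ->
  (\sum_i x i) `^ q <= #|I|%:R `^ q * \sum_i x i `^ q.
Proof.
move=> x0.
case: (pickP (mem I)) => [i0 _|I0]; last first.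
  have -> : \sum_i x i = 0 by apply: big_pred0 => i; exact: I0.
  rewrite powR0 ?gt_eqF//.
  by rewrite mulr_ge0 ?powR_ge0// sumr_ge0// => i _; exact: powR_ge0.
case: (@arg_maxP _ _ _ i0 xpredT x) => // k _ kmax.
apply: (@le_trans _ _ ((#|I|%:R * x k) `^ q)).
  apply: ge0_ler_powR; rewrite ?nnegrE ?(ltW q_gt0)//.
  - exact: sumr_ge0.
  - by rewrite mulr_ge0.
  - rewrite mulr_natl -sumr_const; apply: ler_sum => i _; exact: kmax.
rewrite powRM// ler_wpM2l ?powR_ge0// (bigD1 k)//= lerDl sumr_ge0// => i _.
exact: powR_ge0.
Qed.

Lemma grid_total_bound N :
  (\int[leb R n]_x (grid_total N x `^ q * u_weight q w x)%:E <=
   ((borel_const * Kpow) `^ q)%:E)%E.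
Proof.
have K0 : 0 <= Kpow by exact: powR_ge0.
have c0 : 0 <= upper_const by exact: dyadic_const_ge0.
have T0 : 0 <= card_grid by exact: ler0n.
have gs t x : 0 <= grid_sum N t x `^ q * u_weight q w x.
  by rewrite mulr_ge0 ?powR_ge0// ltW.
have mgs t : measurable_fun setT (fun x => grid_sum N t x `^ q * u_weight q w x).
  apply: measurable_funM => //.
  exact: measurableT_comp (measurable_powR _) (measurable_grid_sum N t).
apply: (@le_trans _ _ (\int[leb R n]_x ((12 `^ gam) `^ q * card_grid `^ q *
    \sum_t grid_sum N t x `^ q * u_weight q w x)%:E)%E).
  apply: le_integral_EFin => x _; first by rewrite mulr_ge0 ?powR_ge0// ltW.
  rewrite -mulr_suml mulrA; apply: ler_wpM2r; first exact: ltW.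
  rewrite /grid_total powRM ?powR_ge0//; last by apply: sumr_ge0 => t _; exact: grid_sum_ge0.
  rewrite -mulrA; apply: ler_wpM2l; first exact: powR_ge0.
  by apply: sum_le_card_max => t; exact: grid_sum_ge0.
rewrite integral_EFinZ ?mulr_ge0 ?powR_ge0//; last 2 first.
- by apply: measurable_sum.
- by move=> x; apply: sumr_ge0 => t _; exact: gs.
rewrite integral_EFin_sum//.
apply: (@le_trans _ _ (((12 `^ gam) `^ q * card_grid `^ q)%:E *
   \sum_(t : {ffun 'I_n -> bool}) ((upper_const * Kpow) `^ q)%:E)%E).
  apply: lee_wpmul2l; first by rewrite lee_fin mulr_ge0 ?powR_ge0.
  by apply: lee_sum => t _; exact: grid_sum_bound.
rewrite sumEFin sumr_const -EFinM lee_fin -[_ *+ #|_|]mulr_natl.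
rewrite [X in _ * (X * _) <= _](_ : _ = card_grid); last first.
  by congr (_%:R); exact: eq_card.
rewrite le_eqVlt; apply/orP; left; apply/eqP.
have p1 : 0 <= 12 `^ gam by exact: powR_ge0.
have p2 := mulr_ge0 p1 T0.
have p3 : 0 <= card_grid `^ q^-1 by exact: powR_ge0.
have p4 := mulr_ge0 p2 p3.
rewrite /borel_const (powRM q (mulr_ge0 p4 c0) K0) (powRM q p4 c0) (powRM q p2 p3).
rewrite (powRM q p1 T0) (powRM q c0 K0).
rewrite -[(card_grid `^ q^-1) `^ q]powRrM mulVf ?gt_eqF// powRr1//.
move: ((12 `^ gam) `^ q) (card_grid `^ q) (upper_const `^ q) (Kpow `^ q) card_grid.
by move=> a b c d e; ring.
Qed.

(** Grids for different [N] are not nested, so no monotonicity of [grid_total] in N is at hand. Its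
    tail infima are measurable and increasing; the M-th one dominates the M-th truncation and is at
    most the M-th term. *)
Lemma upper_bound_borel :
  (\int[leb R n]_x ((\int[lebm R m n]_y (Fprod y / spread x y `^ gam)%:E) `^ q *
     (u_weight q w x)%:E) <= ((borel_const * Kpow) `^ q)%:E)%E.
Proof.
have uE x : (0 <= (u_weight q w x)%:E)%E by rewrite lee_fin ltW.
pose D N x := ((grid_total N x `^ q * u_weight q w x)%:E)%E.
have D0 N x : (0 <= D N x)%E by rewrite lee_fin mulr_ge0 ?powR_ge0// ltW.
have mD N : measurable_fun setT (D N).
  apply/measurable_EFinP/measurable_funM => //.
  apply: measurableT_comp (measurable_powR _) _.
  apply: measurable_funM; first exact: measurable_cst.
  by apply: measurable_sum => t; exact: measurable_grid_sum.
have int0 x : (0 <= \int[lebm R m n]_y (Fprod y / spread x y `^ gam)%:E)%E.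
  by apply: integral_EFin_ge0 => y _; rewrite divr_ge0 ?powR_ge0.
apply: (@integral_le_of_monotone_approx _ _ _ _ _ (fun M x => einfs (D ^~ x) M)).
- by move=> x; rewrite mule_ge0 ?poweR_ge0// lee_fin ltW.
- by move=> M; exact: measurable_fun_einfs.
- by move=> M x; apply: le_ereal_inf_tmp => _ [N _ <-].
- by move=> x; exact: nondecreasing_einfs.
- move=> x; set S := ereal_sup _.
  have trS M : (trunc M x `^ q * (u_weight q w x)%:E <= S)%E.
    apply: (@le_trans _ _ (einfs (D ^~ x) M)); last by apply: ereal_sup_ubound; exists M.
    apply: le_ereal_inf_tmp => _ [N /= MN <-]; rewrite /D EFinM -[(grid_total N x `^ q)%:E]poweR_EFin.
    apply: (lee_wpmul2r (uE x)).
    have t0 : (0 <= trunc M x)%E.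
      by apply: integral_EFin_ge0 => y _; rewrite mulr_ge0// mulr_ge0 ?powR_ge0.
    apply: gt0_ler_poweR; rewrite ?in_itv /= ?leey ?andbT ?(ltW q_gt0)//.
      by rewrite lee_fin grid_total_ge0.
    exact: trunc_le.
  have S0 : (0 <= S)%E.
    by apply: le_trans (trS 0%N); rewrite mule_ge0 ?poweR_ge0// lee_fin ltW.
  have uV : (0 <= (u_weight q w x)^-1%:E)%E by rewrite lee_fin invr_ge0 ltW.
  (* The bound is solved for the truncation, dividing by u_w(x) > 0 and taking the q-th root, so
     that the limit in M can be taken inside the integral over y. *)
  have trS' M : (trunc M x <= (S * (u_weight q w x)^-1%:E) `^ q^-1)%E.
    have t0 : (0 <= trunc M x)%E.
      by apply: integral_EFin_ge0 => y _; rewrite mulr_ge0// mulr_ge0 ?powR_ge0.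
    rewrite -[leLHS](poweRe1 t0) -(divff (lt0r_neq0 q_gt0)) poweRrM.
    apply: gt0_ler_poweR; rewrite ?in_itv /= ?leey ?andbT ?invr_ge0 ?(ltW q_gt0)//.
    - exact: poweR_ge0.
    - by rewrite mule_ge0.
    - have := lee_wpmul2r uV (trS M); rewrite -muleA -EFinM divff ?mule1//.
      by rewrite gt_eqF.
  rewrite -[leRHS]mule1 -(divff (lt0r_neq0 (u_w0 x))) mulrC EFinM muleA.
  apply: (lee_wpmul2r (uE x)).
  rewrite -[leRHS]poweRe1 ?mule_ge0// -(mulVf (lt0r_neq0 q_gt0)) poweRrM.
  apply: gt0_ler_poweR; rewrite ?in_itv /= ?leey ?andbT ?(ltW q_gt0)//.
    exact: poweR_ge0.
  apply: (@integral_le_of_monotone_approx _ _ _ _ _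
    (fun M y => (Fprod y * truncated_kernel M x y)%:E)) => //.
  + by move=> y; rewrite lee_fin divr_ge0 ?powR_ge0.
  + move=> M; apply/measurable_EFinP; apply: measurable_funM.
      exact: measurable_tuple_prod.
    have ms := measurable_spread x.
    have m6 : measurable_fun setT (fun y => 6 * spread x y) by exact: measurable_funM.
    apply: measurable_funM; last exact: measurableT_comp (measurable_powR _) ms.
    have mb : measurable_fun setT (fun y => ((2 ^+ M)^-1 <= 6 * spread x y) &&
        (6 * spread x y < 2 ^+ M)).
      by apply: measurable_and; [exact: measurable_fun_ler|exact: measurable_fun_ltr].
    have -> : (fun y => (((2 ^+ M)^-1 <= 6 * spread x y) && (6 * spread x y < 2 ^+ M))%:R : R)
      = \1_((fun y => ((2 ^+ M)^-1 <= 6 * spread x y) &&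
        (6 * spread x y < 2 ^+ M)) @^-1` [set true]).
      by apply/funext => y; rewrite indicE; congr ((nat_of_bool _)%:R);
        apply/idP/idP => [h|/set_mem//]; exact/mem_set.
    by apply: measurable_indic; rewrite -[X in measurable X]setTI; exact: mb.
  + by move=> M y; rewrite lee_fin mulr_ge0// mulr_ge0 ?powR_ge0.
  + move=> y M1 M2 M12; rewrite lee_fin ler_wpM2l// ler_wpM2r ?powR_ge0// ler_nat.
    have e2 : 2 ^+ M1 <= 2 ^+ M2 :> R by rewrite ler_weXn2l// ler1n.
    case: (boolP (_ && _)) => // /andP[r1 r2]; rewrite (lt_le_trans r2 e2) andbT.
    rewrite (le_trans _ r1)// lef_pV2 ?posrE ?exprn_gt0//.
  + move=> y; have := spread_ge0 x y; rewrite le_eqVlt => /predU1P[s0|s0].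
      (* At spread 0 the kernel is the inverse of 0, which is 0 by convention. *)
      rewrite -s0 powR0 ?gt_eqF// invr0 mulr0; apply: ereal_sup_ge.
      exists (Fprod y * truncated_kernel 0 x y)%:E; first by exists 0%N.
      by rewrite lee_fin mulr_ge0// mulr_ge0 ?powR_ge0.
    have [M1 hM1] : exists M, 6 * spread x y < 2 ^+ M.
      exists (Num.truncn (6 * spread x y)).+1; apply: lt_trans (truncnS_gt _) _.
      by rewrite -natrX ltr_nat ltn_expl.
    have [M2 hM2] : exists M, (6 * spread x y)^-1 < 2 ^+ M.
      exists (Num.truncn (6 * spread x y)^-1).+1; apply: lt_trans (truncnS_gt _) _.
      by rewrite -natrX ltr_nat ltn_expl.
    have s6 : 0 < 6 * spread x y by rewrite mulr_gt0.
    apply: ereal_sup_ge; exists (Fprod y * truncated_kernel (maxn M1 M2) x y)%:E.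
      by exists (maxn M1 M2).
    rewrite lee_fin -powRN /truncated_kernel.
    rewrite (lt_le_trans hM1) ?ler_weXn2l ?ler1n ?leq_maxl// andbT.
    rewrite (_ : _ <= 6 * spread x y) ?mul1r//.
    rewrite -[leRHS]invrK lef_pV2 ?posrE ?exprn_gt0 ?invr_gt0//.
    by apply: (le_trans (ltW hM2)); rewrite ler_weXn2l ?ler1n ?leq_maxr.
- move=> M; apply: le_trans (grid_total_bound M).
  apply: le_integral_nonmeas => x _; first by apply: le_ereal_inf_tmp => _ [N _ <-].
  by apply: ereal_inf_lbound; exists M => //=.
Qed.

End upper_bound.

Section dominance.
Context (R : realType) (m : nat) (q beta : R) (p : 'I_m -> R).
Hypotheses (q_gt0 : 0 < q) (p_gt1 : forall i, 1 < p i) (beta_lt1 : beta < 1).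
Hypothesis beta_gt0 : 0 < beta.

Let cp0 i : 0 < conj_exp (p i).
Proof. exact: lt_trans (conj_exp_gt1 p_gt1 i). Qed.

Lemma min_ratio_cases (c : R) : min_ratio p q <= c ->
  max_conj p / q <= c \/ exists j, max_conj_but p q j / conj_exp (p j) <= c.
Proof.
rewrite /min_ratio; elim/big_ind: _ => [|x y hx hy|j _ h]; first by left.
  by rewrite ge_min => /orP[/hx|/hy].
by right; exists j.
Qed.

(** If the first entry of the minimum is small, r_0 = q dominates and gamma = 1; if entry j is, p_j'
    dominates and gamma = p_j'/q. The second conclusion identifies the exponent produced by the
    dyadic theorem with (1 - beta) gamma. *)
Lemma slot_inv_dominant : min_ratio p q <= 1 - beta ->
  exists j, (forall i, i != j -> slot_inv q p j <= (1 - beta) * slot_inv q p i) /\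
    q^-1 * ((1 - beta) / slot_inv q p j) = (1 - beta) * gammaPq p q.
Proof.
have b0 : 0 < 1 - beta by rewrite subr_gt0.
have sl k : slot_inv q p (lift ord0 k) = (conj_exp (p k))^-1.
  by rewrite /slot_inv slot_lift inv_conj_exp.
have s0 : slot_inv q p ord0 = q^-1 by rewrite /slot_inv slot0.
have inv_le (a b : R) : 0 < a -> 0 < b -> a <= (1 - beta) * b -> b^-1 <= (1 - beta) * a^-1.
  move=> a0 b0' ab; rewrite -ler_pdivrMr ?invr_gt0// invrK mulrC ler_pdivrMr//.
case/min_ratio_cases => [h|[j h]].
- have cq i : conj_exp (p i) <= (1 - beta) * q.
    rewrite -ler_pdivrMr//; apply: le_trans h; apply: ler_wpM2r.
      by rewrite invr_ge0 ltW.
    exact: (le_bigmax _ (fun i => conj_exp (p i))).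
  exists ord0; split.
    move=> i; case: (unliftP ord0 i) => [k -> _|-> /eqP//].
    by rewrite s0 sl; apply: inv_le.
  rewrite s0 invrK mulrC mulfK ?gt_eqF// /gammaPq.
  suff -> : \big[Num.max/1]_(i < m) (conj_exp (p i) / q) = 1 by rewrite mulr1.
  apply/eqP; rewrite eq_le; apply/andP; split; last exact: bigmax_ge_id.
  apply/bigmax_leP; split=> // i _; rewrite ler_pdivrMr// mul1r.
  by apply: le_trans (cq i) _; rewrite ler_piMl ?(ltW q_gt0)// gerBl ltW.
- have qc : q <= (1 - beta) * conj_exp (p j).
    rewrite -ler_pdivrMr//; apply: le_trans h; apply: ler_wpM2r.
      by rewrite invr_ge0 ltW.
    exact: bigmax_ge_id.
  have cc i : i != j -> conj_exp (p i) <= (1 - beta) * conj_exp (p j).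
    move=> ij; rewrite -ler_pdivrMr//; apply: le_trans h; apply: ler_wpM2r.
      by rewrite invr_ge0 ltW.
    exact: (le_bigmax_cond _ (fun i => conj_exp (p i)) ij).
  have le1 x : x <= (1 - beta) * conj_exp (p j) -> x <= conj_exp (p j).
    by move=> /le_trans; apply; rewrite ler_piMl ?(ltW (cp0 _))// gerBl ltW.
  exists (lift ord0 j); split.
    move=> i; case: (unliftP ord0 i) => [k ->|-> _]; last first.
      by rewrite s0 sl; apply: inv_le.
    by rewrite (inj_eq lift_inj) !sl => /cc; apply: inv_le.
  rewrite sl invrK mulrCA; congr (_ * _); rewrite mulrC /gammaPq.
  apply/eqP; rewrite eq_le; apply/andP; split.
    exact: (le_bigmax _ (fun i => conj_exp (p i) / q)).
  apply/bigmax_leP; split=> [|i _].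
    by rewrite ler_pdivlMr// mul1r le1.
  rewrite ler_wpM2r ?invr_ge0 ?(ltW q_gt0)//.
  by case: (eqVneq i j) => [->//|/cc/le1].
Qed.

End dominance.

Lemma prod_add_le (R : realType) (I : Type) (s : seq I) (N : I -> R) :
  (forall i, 0 <= N i) ->
  exists2 C, 0 <= C & forall e, 0 <= e <= 1 ->
    \prod_(i <- s) (N i + e) <= \prod_(i <- s) N i + e * C.
Proof.
move=> N0; elim: s => [|i s [C C0 ih]].
  by exists 0 => // e _; rewrite !big_nil mulr0 addr0.
exists (N i * C + (\prod_(i <- s) N i + C)).
  by rewrite addr_ge0 ?mulr_ge0// addr_ge0// prodr_ge0.
move=> e /[dup] e01 /andP[e0 e1]; rewrite !big_cons.
apply: le_trans (ler_wpM2l (addr_ge0 (N0 i) e0) (ih e e01)) _.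
set P := \prod_(j <- s) N j.
have : e * (e * C) <= e * C by rewrite ler_wpM2l// ler_piMl.
lra.
Qed.

(** Functions are normalised by their norm plus e, which also covers norm 0; a finite product
    changes only by a multiple of e. *)
Lemma le_prod_of_add (R : realType) (m : nat) (N : 'I_m -> R) (x B : R) :
  (forall i, 0 <= N i) -> 0 <= B ->
  (forall e, 0 < e <= 1 -> x <= B * \prod_i (N i + e)) -> x <= B * \prod_i N i.
Proof.
move=> N0 B0 H; have [C C0 HC] := prod_add_le (index_enum 'I_m) N0.
apply/ler_addgt0Pr => e e0.
pose t := Num.min 1 (e / (B * C + 1)).
have D0 : 0 < B * C + 1 by rewrite ltr_wpDl// mulr_ge0.
have t0 : 0 < t by rewrite lt_min ltr01 divr_gt0.
have t1 : t <= 1 by rewrite ge_min lexx.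
apply: le_trans (H t _) _; first by rewrite t0.
apply: le_trans (ler_wpM2l B0 (HC t _)) _; first by rewrite (ltW t0).
rewrite mulrDr lerD2l mulrCA.
have te : t <= e / (B * C + 1) by rewrite ge_min lexx orbT.
apply: le_trans (ler_wpM2r (mulr_ge0 B0 C0) te) _.
rewrite mulrAC ler_pdivrMr// ler_pM2l//; lra.
Qed.

(** * Reduction of the upper bound to Borel data of norm at most one *)

Section upper_half.
Context (R : realType) (m n : nat) (alpha q : R) (p : 'I_m -> R).
Local Notation euclid n := (n.-tuple (measurableTypeR R)).

Lemma weight_borel (w : euclid n -> R) : weight w ->
  exists g : euclid n -> R, [/\ measurable_fun setT g, forall x, 0 < g x &
    {ae leb R n, forall x, w x = g x}].
Proof.
case=> -[g mg wg] _ wpos _.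
(* The exceptional set is null; the value 1 there makes the representative positive everywhere, as
   the pointwise identity between u_w and the sigma_i requires. *)
exists (fun x => if 0 < g x then g x else 1); split.
- apply: measurable_fun_ifT => //.
  exact: (measurable_fun_ltr (measurable_cst (0 : R)) mg).
- by move=> x; case: ifP.
- by apply: filterS2 wg wpos => x wgx; rewrite -wgx => ->.
Qed.

Lemma lebesgue_measurable_abs_borel (f : euclid n -> R) : lebesgue_measurable f ->
  exists g : euclid n -> R, [/\ measurable_fun setT g, forall x, 0 <= g x &
    {ae leb R n, forall x, `|f x| = g x}].
Proof.
case=> g mg fg; exists (fun x => `|g x|); split; [|by []|].
  apply: (measurableT_comp (f := fun r : R => `|r|) _ mg).
  exact: normr_measurable.
by apply: filterS fg => x ->.
Qed.

Lemma average_ae (Q : set (euclid n)) (f g : euclid n -> R) :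
  (forall x, 0 <= f x) -> (forall x, 0 <= g x) ->
  {ae leb R n, forall x, f x = g x} -> average Q f = average Q g.
Proof.
move=> f0 g0 fg; rewrite /average; congr (_ * _)%E.
apply: ae_eq_integral_nonmeas => [x|x|]; rewrite ?lee_fin//.
by apply: filterS fg => x ->.
Qed.

Lemma u_weight_ge0 (w : 'I_m -> euclid n -> R) x : 0 <= u_weight q w x.
Proof. exact: powR_ge0. Qed.

Lemma sigma_weight_ge0 (w : 'I_m -> euclid n -> R) i x : 0 <= sigma_weight p w i x.
Proof. exact: powR_ge0. Qed.

Lemma wnorm_EFin (s : R) (v f : euclid n -> R) :
  wnorm s v (EFin \o f) =
  ((\int[leb R n]_x (`|f x| `^ s * v x)%:E) `^ s^-1)%E.
Proof.
by rewrite /wnorm; congr (_ `^ _)%E.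
Qed.

Hypotheses (m_gt0 : (0 < m)%N) (n_gt0 : (0 < n)%N).
Hypotheses (alpha_gt0 : 0 < alpha) (alpha_ltn : alpha < n%:R).
Hypotheses (q_gt0 : 0 < q) (p_gt1 : forall i, 1 < p i).
Hypothesis scaling : \sum_(i < m) (p i)^-1 = q^-1 + alpha / n%:R.
Hypothesis ratio_le : min_ratio p q <= 1 - alpha / n%:R.

Lemma ApqC_ge0 (w : 'I_m -> euclid n -> R) : (0 <= ApqC p q w)%E.
Proof.
pose a : euclid n := [tuple 0 | _ < n].
apply: le_trans (ereal_sup_ubound _); last first.
  by exists (cube a 1) => //; exists a, 1.
rewrite mule_ge0//.
  by rewrite mule_ge0 ?lee_fin ?invr_ge0 ?fine_ge0// integral_EFin_ge0// => x _;
    exact: powR_ge0.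
by apply: prode_ge0 => i _; exact: poweR_ge0.
Qed.

Lemma upper_half : exists C : R,
  Ialpha_bound n alpha p q ((1 - alpha / n%:R) * gammaPq p q) C.
Proof.
have n0 : 0 < n%:R :> R by rewrite ltr0n.
have b0 : 0 < alpha / n%:R by rewrite divr_gt0.
have b1 : alpha / n%:R < 1 by rewrite ltr_pdivrMr// mul1r.
have [j [dom expE]] := slot_inv_dominant q_gt0 p_gt1 b1 b0 ratio_le.
have sum_s : \sum_i slot_inv q p i = m%:R - alpha / n%:R.
  rewrite big_ord_recl /slot_inv slot0.
  under eq_bigr do rewrite slot_lift.
  by rewrite sumrB scaling sumr_const card_ord; ring.
exists (borel_const n alpha q p j) => w f [ww wA] fL.
set Bc := borel_const n alpha q p j.
have [w' Hw'] := choice (fun i => weight_borel (ww i)).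
have [f' Hf'] := choice (fun i => lebesgue_measurable_abs_borel (proj1 (fL i))).
have mw' i : measurable_fun setT (w' i) by case: (Hw' i).
have w'0 i x : 0 < w' i x by case: (Hw' i).
have aew : {ae leb R n, forall x, forall i, w i x = w' i x}.
  by apply: filter_forall => i; case: (Hw' i).
have mf' i : measurable_fun setT (f' i) by case: (Hf' i).
have f'0 i x : 0 <= f' i x by case: (Hf' i).
have aef i : {ae leb R n, forall x, `|f i x| = f' i x} by case: (Hf' i).
have aeu : {ae leb R n, forall x, u_weight q w x = u_weight q w' x}.
  apply: filterS aew => x wx; rewrite /u_weight; congr (_ `^ _).
  by apply: eq_bigr => i _.
pose A := fine (ApqC p q w).
have AE : ApqC p q w = A%:E by rewrite fineK// ge0_fin_numE// ApqC_ge0.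
have A0 : 0 <= A by rewrite -lee_fin -AE ApqC_ge0.
have cubeA Q : @is_cube R n Q -> (average Q (u_weight q w') *
    \prod_(i < m) (average Q (sigma_weight p w' i) `^ (q / conj_exp (p i))) <= A%:E)%E.
  move=> cQ.
  have avE : average Q (u_weight q w') = average Q (u_weight q w).
    apply: average_ae; [exact: u_weight_ge0|exact: u_weight_ge0|].
    by apply: filterS aeu => x ->.
  have sgE i : average Q (sigma_weight p w' i) = average Q (sigma_weight p w i).
    apply: average_ae; [exact: sigma_weight_ge0|exact: sigma_weight_ge0|].
    by apply: filterS aew => x wx; rewrite /sigma_weight wx.
  rewrite -AE avE; under eq_bigr do rewrite sgE.
  by apply: ereal_sup_ubound; exists Q.
have normI i : (\int[leb R n]_x (`|f i x| `^ p i * w i x `^ p i)%:E =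
    \int[leb R n]_x (f' i x `^ p i * w' i x `^ p i)%:E)%E.
  apply: ae_eq_integral_nonmeas.
  - by move=> x; rewrite lee_fin mulr_ge0 ?powR_ge0.
  - by move=> x; rewrite lee_fin mulr_ge0 ?powR_ge0.
  - by apply: filterS2 aew (aef i) => x wx ->; rewrite wx.
pose W i := wnorm (p i) (fun x => w i x `^ p i) (EFin \o f i).
have normE i : W i =
    ((\int[leb R n]_x (f' i x `^ p i * w' i x `^ p i)%:E) `^ (p i)^-1)%E.
  by rewrite /W wnorm_EFin normI.
have W0 i : (0 <= W i)%E by rewrite normE poweR_ge0.
have Wfin i : W i \is a fin_num by rewrite (ge0_fin_numE (W0 i)); exact: (proj2 (fL i)).
pose Nf i := fine (W i).
have NfE i : W i = (Nf i)%:E by exact: esym (fineK (Wfin i)).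
have Nf0 i : 0 <= Nf i by rewrite -lee_fin -NfE.
have p0 i : 0 < p i by exact: lt_trans (p_gt1 i).
have int_f i : (\int[leb R n]_x (f' i x `^ p i * w' i x `^ p i)%:E = (Nf i `^ p i)%:E)%E.
  rewrite -poweR_EFin -NfE normE -poweRrM mulVf ?gt_eqF// poweRe1//.
  by apply: integral_EFin_ge0 => x _; rewrite mulr_ge0 ?powR_ge0.
have mfw i : measurable_fun setT (fun x => f' i x `^ p i * w' i x `^ p i).
  apply: measurable_funM.
    exact: measurableT_comp (measurable_powR _) (mf' i).
  exact: measurableT_comp (measurable_powR _) (mw' i).
pose gam : R := (m * n)%:R - alpha.
pose J x : \bar R := (\int[lebm R m n]_y
  ((\prod_(i < m) f' i (tnth y i)) / spread x y `^ gam)%:E)%E.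
have J0 x : (0 <= J x)%E.
  by apply: integral_EFin_ge0 => y _; rewrite divr_ge0 ?powR_ge0 ?prodr_ge0.
have Bc0 : 0 <= Bc by exact: borel_const_ge0.
set Kp := A `^ ((1 - alpha / n%:R) * gammaPq p q).
have K0 : 0 <= Kp by exact: powR_ge0.
have IJ x : (`|Ialpha alpha f x| <= J x)%E.
  apply: le_trans (abse_integral_le _ _) _; rewrite /J.
  rewrite le_eqVlt; apply/orP; left; apply/eqP; apply: ae_eq_integral_nonmeas.
  - by move=> y; exact: abse_ge0.
  - by move=> y; rewrite lee_fin divr_ge0 ?powR_ge0 ?prodr_ge0.
  have := @ae_tuple _ _ R (leb R n) m (fun i x => `|f i x| = f' i x) aef.
  apply: filterS => y fy; rewrite abse_EFin normrM normr_prod.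
  rewrite (eq_bigr (fun i => f' i (tnth y i))); last by move=> i _; exact: fy.
  by rewrite [X in _ * X]ger0_norm// invr_ge0 powR_ge0.
(* Homogeneity: the Borel bound is applied to the functions divided by [Nf i + e], of norm at most
   1. *)
have scaled e : 0 < e <= 1 ->
    (\int[leb R n]_x (J x `^ q * (u_weight q w' x)%:E) <=
     ((Bc * Kp * \prod_i (Nf i + e)) `^ q)%:E)%E.
  move=> /andP[e0 _]; have c0 i : 0 < Nf i + e by rewrite ltr_wpDl.
  set P := \prod_i (Nf i + e); have P0 : 0 < P by exact: prodr_gt0.
  pose g i x := (Nf i + e)^-1 * f' i x.
  have mg i : measurable_fun setT (g i) by exact: measurable_funM.
  have g0 i x : 0 <= g i x by rewrite mulr_ge0 ?invr_ge0 ?(ltW (c0 i)).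
  have ng i : (\int[leb R n]_x (g i x `^ p i * w' i x `^ p i)%:E <= 1)%E.
    rewrite (eq_integral (fun x => ((Nf i + e)^-1 `^ p i *
        (f' i x `^ p i * w' i x `^ p i))%:E)); last first.
      by move=> x _; rewrite /g powRM ?invr_ge0 ?(ltW (c0 i))// mulrA.
    rewrite integral_EFinZ ?powR_ge0//; last first.
      by move=> x; rewrite mulr_ge0 ?powR_ge0.
    rewrite int_f -EFinM lee_fin -powRM ?invr_ge0 ?(ltW (c0 i))//.
    rewrite [leRHS](_ : 1 = 1 `^ p i); last by rewrite powR1.
    apply: ge0_ler_powR; rewrite ?nnegrE ?(ltW (p0 i))//.
      by rewrite mulr_ge0 ?invr_ge0 ?(ltW (c0 i)).
    by rewrite mulrC ler_pdivrMr// mul1r lerDl ltW.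
  have := upper_bound_borel m_gt0 n_gt0 alpha_gt0 alpha_ltn q_gt0 p_gt1 sum_s dom
    mw' w'0 cubeA mg g0 ng.
  rewrite -/gam -/Bc -powRrM expE -/Kp => H.
  have gE x : (J x = P%:E * \int[lebm R m n]_y
      ((\prod_(i < m) g i (tnth y i)) / spread x y `^ gam)%:E)%E.
    rewrite -integral_EFinZ ?(ltW P0)//; last 2 first.
    - apply: measurable_funM; first exact: measurable_tuple_prod.
      have -> : (fun y : m.-tuple (euclid n) => (spread x y `^ gam)^-1) =
          (fun y => spread x y `^ (- gam)).
        by apply/funext => y; rewrite powRN.
      exact: measurableT_comp (measurable_powR _) (measurable_spread x).
    - by move=> y; rewrite divr_ge0 ?powR_ge0 ?prodr_ge0.
    apply: eq_integral => y _; rewrite mulrA -big_split /=; congr (_ / _)%:E.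
    by apply: eq_bigr => i _; rewrite /g mulrA divff ?mul1r// gt_eqF.
  rewrite (eq_integral (fun x => ((P `^ q)%:E * ((\int[lebm R m n]_y
      ((\prod_(i < m) g i (tnth y i)) / spread x y `^ gam)%:E) `^ q *
      (u_weight q w' x)%:E))%E)); last first.
    move=> x _; rewrite gE poweRM ?lee_fin ?(ltW P0)//.
      by rewrite poweR_EFin muleA.
    by apply: integral_EFin_ge0 => y _; rewrite divr_ge0 ?powR_ge0 ?prodr_ge0.
  rewrite mulrC (powRM q (ltW P0) (mulr_ge0 Bc0 K0)) EFinM.
  apply: le_trans (lee_wpmul2l _ H); last by rewrite lee_fin powR_ge0.
  apply: integral_scale_le; first exact: powR_gt0.
  by move=> x; rewrite mule_ge0 ?poweR_ge0// lee_fin powR_ge0.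
have XE e : 0 < e <= 1 -> (wnorm q (u_weight q w) (Ialpha alpha f) <=
    (Bc * Kp * \prod_i (Nf i + e))%:E)%E.
  move=> /[dup] /scaled H /andP[e0 _].
  have B0 : 0 <= Bc * Kp * \prod_i (Nf i + e).
    apply: mulr_ge0 (mulr_ge0 Bc0 K0) _; apply: prodr_ge0 => i _.
    exact: addr_ge0 (Nf0 i) (ltW e0).
  have ZE : Bc * Kp * \prod_i (Nf i + e) =
      ((Bc * Kp * \prod_i (Nf i + e)) `^ q) `^ q^-1.
    by rewrite -powRrM divff ?gt_eqF// powRr1.
  rewrite ZE -[leRHS]poweR_EFin /wnorm; apply: gt0_ler_poweR.
  - by rewrite invr_ge0 ltW.
  - rewrite in_itv /= leey andbT integral_ge0// => x _.
    by rewrite mule_ge0 ?poweR_ge0// lee_fin u_weight_ge0.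
  - by rewrite in_itv /= leey lee_fin powR_ge0.
  apply: le_trans H; apply: ae_le_integral_nonmeas.
  - by move=> x; rewrite mule_ge0 ?poweR_ge0// lee_fin u_weight_ge0.
  - by move=> x; rewrite mule_ge0 ?poweR_ge0// lee_fin u_weight_ge0.
  apply: filterS aeu => x ->; apply: lee_wpmul2r; first by rewrite lee_fin u_weight_ge0.
  apply: gt0_ler_poweR; rewrite ?in_itv /= ?leey ?andbT ?(ltW q_gt0) ?abse_ge0 ?J0 ?IJ//.
rewrite AE poweR_EFin -/Kp -EFinM (eq_bigr (fun i => (Nf i)%:E)); last by move=> i _; exact: NfE.
rewrite prodEFin -EFinM.
have Xfin : wnorm q (u_weight q w) (Ialpha alpha f) \is a fin_num.
  rewrite ge0_fin_numE ?poweR_ge0//; apply: le_lt_trans (XE 1 _) (ltry _).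
  by rewrite ltr01 lexx.
rewrite -(fineK Xfin) lee_fin; apply: le_prod_of_add => //; first exact: mulr_ge0.
by move=> e e01; rewrite -lee_fin fineK//; exact: XE.
Qed.

End upper_half.

(** * Radial power weights *)

Section radial.
Variables (R : realType) (n : nat).
Hypothesis n_gt0 : (0 < n)%N.
Local Notation euclid n := (n.-tuple (measurableTypeR R)).
Implicit Types (x a : euclid n) (r s : R).

Definition cheb x : R := \big[Num.max/0]_(k < n) `|tnth x k|.

(* [0 ^ s] is [1] here, so that exponents add and multiply at every point. *)
Definition chebX s x : R := expR (s * ln (cheb x)).

Lemma cheb_ge0 x : 0 <= cheb x.
Proof. exact: bigmax_ge_id. Qed.

Lemma coord_le_cheb x k : `|tnth x k| <= cheb x.
Proof. exact: (le_bigmax _ (fun k => `|tnth x k|)). Qed.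

Lemma cheb_leP x r : 0 <= r -> reflect (forall k, `|tnth x k| <= r) (cheb x <= r).
Proof.
move=> r0; apply: (iffP idP) => [xr k|xr]; first exact: le_trans (coord_le_cheb x k) xr.
by apply: bigmax_le.
Qed.

Lemma cheb_le_add x a r : 0 <= r -> (forall k, `|tnth x k - tnth a k| <= r) ->
  cheb x <= cheb a + r.
Proof.
move=> r0 xa; apply/cheb_leP => [|k]; first by rewrite addr_ge0 ?cheb_ge0.
rewrite -[tnth x k](subrK (tnth a k)) addrC (le_trans (ler_normD _ _))//.
by rewrite lerD ?coord_le_cheb.
Qed.

Lemma cheb_ball_cube r : 0 <= r ->
  [set x | cheb x <= r] = cube [tuple - r | _ < n] (2 * r).
Proof.
move=> r0; apply/seteqP; split=> x /=.
  move=> /(cheb_leP x r0) xr k; rewrite tnth_mktuple.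
  by have := xr k; rewrite ler_norml (_ : - r + 2 * r = r)//; ring.
move=> xr; apply/(cheb_leP x r0) => k; rewrite ler_norml.
by have := xr k; rewrite tnth_mktuple (_ : - r + 2 * r = r)//; ring.
Qed.

Lemma measurable_cheb : measurable_fun setT cheb.
Proof.
rewrite /cheb; elim: (index_enum _) => [|k s ih].
  by under eq_fun do rewrite big_nil; exact: measurable_cst.
under eq_fun do rewrite big_cons.
apply: measurable_maxr ih; apply: measurableT_comp => //.
exact: (@measurable_tnth _ (measurableTypeR R) n k).
Qed.

Lemma measurable_chebX s : measurable_fun setT (chebX s).
Proof.
apply: measurableT_comp => //; apply: measurable_funM => //.
by apply: measurableT_comp measurable_cheb; exact: measurable_ln.
Qed.

Lemma measurable_cheb_ball r : measurable [set x | cheb x <= r].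
Proof.
have := measurable_cheb measurableT (measurable_itv `]-oo, r]).
by rewrite setTI; congr measurable; apply/seteqP; split=> x /=; rewrite in_itv.
Qed.

Lemma leb_cheb_ball r : 0 < r -> leb R n [set x | cheb x <= r] = ((2 * r) ^+ n)%:E.
Proof. by move=> r0; rewrite cheb_ball_cube ?leb_cube ?mulr_gt0// ltW. Qed.

Lemma ae_cheb_gt0 : {ae leb R n, forall x, 0 < cheb x}.
Proof.
exists [set x | cheb x <= 0]; split; first exact: measurable_cheb_ball.
  apply/eqP; rewrite eq_le measure_ge0 andbT; apply/lee_addgt0Pr => e e0.
  rewrite add0e; pose d := Num.min e 1 / 2.
  have d0 : 0 < d by rewrite divr_gt0// lt_min e0 ltr01.
  have d1 : 2 * d <= 1 by rewrite mulrC divfK// ge_min lexx orbT.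
  have de : 2 * d <= e by rewrite mulrC divfK// ge_min lexx.
  apply: (@le_trans _ _ (leb R n [set x | cheb x <= d])).
    apply: le_measure; rewrite ?inE; [exact: measurable_cheb_ball..|].
    by move=> x /= /le_trans; apply; exact: ltW.
  rewrite leb_cheb_ball// lee_fin -(prednK n_gt0) exprS.
  have d20 : 0 <= 2 * d by exact: mulr_ge0 (ler0n _ 2) (ltW d0).
  by apply: le_trans de; apply: ler_piMr => //; apply: exprn_ile1.
by move=> x /= /negP; rewrite -leNgt.
Qed.

Lemma chebX_gt0 s x : 0 < chebX s x. Proof. exact: expR_gt0. Qed.

Lemma chebX_ge0 s x : 0 <= chebX s x. Proof. exact: expR_ge0. Qed.

Lemma chebX0 x : chebX 0 x = 1. Proof. by rewrite /chebX mul0r expR0. Qed.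

Lemma chebXD s t x : chebX (s + t) x = chebX s x * chebX t x.
Proof. by rewrite /chebX mulrDl expRD. Qed.

Lemma chebX_powR s t x : chebX s x `^ t = chebX (t * s) x.
Proof. by rewrite powR_expR ?expR_gt0// expRK mulrA. Qed.

Lemma prod_chebX m (s : 'I_m -> R) x : \prod_i chebX (s i) x = chebX (\sum_i s i) x.
Proof. by rewrite /chebX -expR_sum mulr_suml. Qed.

Lemma chebXE s x : 0 < cheb x -> chebX s x = cheb x `^ s.
Proof. by move=> x0; rewrite powR_expR. Qed.

Definition shell r : set (euclid n) := [set x | r / 2 < cheb x <= r].

Lemma measurable_shell r : measurable (shell r).
Proof.
have := measurable_cheb measurableT (measurable_itv `]r / 2, r]).
by rewrite setTI; congr measurable; apply/seteqP; split=> x /=; rewrite in_itv.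
Qed.

Lemma leb_shell r : 0 < r ->
  ((r ^+ n)%:E <= leb R n (shell r) <= ((2 * r) ^+ n)%:E)%E.
Proof.
move=> r0; have r20 : 0 < r / 2 by rewrite divr_gt0.
have -> : shell r = [set x | cheb x <= r] `\` [set x | cheb x <= r / 2].
  apply/seteqP; split=> x; rewrite /shell /= ltNge; first by case/andP => /negP ? ?.
  by case=> -> /negP ->.
rewrite measureD; [|exact: measurable_cheb_ball..|]; last first.
  by change (leb R n [set x | (cheb x <= r)%R] < +oo)%E; rewrite leb_cheb_ball// ltry.
rewrite setIidr; last by move=> x /= /le_trans; apply; rewrite ler_pdivrMr// ler_peMr ?ltW// ltr1n.
change ((r ^+ n)%:E <= leb R n [set x | (cheb x <= r)%R] - leb R n [set x | (cheb x <= r / 2)%R] <= ((2 * r) ^+ n)%:E)%E.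
rewrite !leb_cheb_ball// -EFinB !lee_fin [2 * (r / 2)]mulrC divfK//.
rewrite gerBl exprn_ge0 ?(ltW r0)// andbT exprMn.
have n2 : 2 <= 2 ^+ n :> R by rewrite -natrX ler_nat -{1}(expn1 2) leq_pexp2l.
have rn : 0 < r ^+ n by exact: exprn_gt0.
move: (r ^+ n) (2 ^+ n) n2 rn => b a *; nra.
Qed.

Lemma shell_chebX r s x : 0 < r -> shell r x ->
  2 `^ (- `|s|) * r `^ s <= chebX s x <= 2 `^ `|s| * r `^ s.
Proof.
move=> r0 /= /andP[xr rx]; have x0 : 0 < cheb x by apply: lt_trans xr; rewrite divr_gt0.
rewrite !powR_expR// -!expRD !ler_expR.
have l1 : ln (cheb x) <= ln r by rewrite ler_ln ?posrE.
have l2 : ln r - ln 2 <= ln (cheb x).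
  by rewrite -ln_div ?posrE// ler_ln ?posrE ?divr_gt0// ltW.
have l3 : 0 <= ln 2 :> R by rewrite ln_ge0// ler1n.
have d : `|s * (ln (cheb x) - ln r)| <= `|s| * ln 2.
  by rewrite normrM ler_wpM2l// ler_norml; lra.
by move: d; rewrite ler_norml; lra.
Qed.

Lemma integral_shell r s : 0 < r ->
  ((2 `^ (- `|s|) * r `^ (s + n%:R))%:E <= \int[leb R n]_(x in shell r) (chebX s x)%:E
   <= (2 `^ `|s| * 2 ^+ n * r `^ (s + n%:R))%:E)%E.
Proof.
move=> r0; have /andP[m1 m2] := leb_shell r0.
have rn : r `^ (s + n%:R) = r `^ s * r ^+ n.
  by rewrite -powR_mulrn ?(ltW r0)// -powRD//; apply/implyP => _; rewrite gt_eqF.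
apply/andP; split.
  apply: (@le_trans _ _ (\int[leb R n]_(x in shell r) (2 `^ (- `|s|) * r `^ s)%:E)%E).
    rewrite integral_cst; last exact: measurable_shell.
rewrite rn mulrA EFinM lee_wpmul2l//.
    by rewrite lee_fin mulr_ge0 ?powR_ge0.
  apply: le_integral_EFin => x xr; first by rewrite mulr_ge0 ?powR_ge0.
  by have /andP[] := shell_chebX s r0 xr.
apply: (@le_trans _ _ (\int[leb R n]_(x in shell r) (2 `^ `|s| * r `^ s)%:E)%E).
  apply: le_integral_EFin => x xr; first exact: chebX_ge0.
  by have /andP[] := shell_chebX s r0 xr.
rewrite integral_cst; last exact: measurable_shell.
have -> : 2 `^ `|s| * 2 ^+ n * r `^ (s + n%:R) = 2 `^ `|s| * r `^ s * (2 * r) ^+ n.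
  by rewrite rn exprMn; ring.
rewrite EFinM; apply: lee_wpmul2l m2.
by rewrite lee_fin mulr_ge0 ?powR_ge0.
Qed.

End radial.

Arguments shell {R} n r _.

Section radial_integral.
Variables (R : realType) (n : nat).
Hypothesis n_gt0 : (0 < n)%N.
Local Notation euclid n := (n.-tuple (measurableTypeR R)).
Implicit Types (x : euclid n) (r s : R) (k l J : nat).

Definition dy k : R := 2 `^ (- k%:R).

Lemma dy_gt0 k : 0 < dy k. Proof. exact: powR_gt0. Qed.

Lemma dyS k : dy k.+1 = dy k / 2.
Proof.
rewrite /dy -[k.+1%:R]natr1 opprD powRD; last by apply/implyP => _; rewrite gt_eqF.
by rewrite -powR_inv1.
Qed.

Lemma dy_anti k l : (k <= l)%N -> dy l <= dy k.
Proof. by move=> kl; rewrite ler_powR ?ler1n// lerN2 ler_nat. Qed.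

Lemma dy_le1 k : dy k <= 1.
Proof. by have := dy_anti (leq0n k); rewrite [dy 0]/dy oppr0 powRr0. Qed.

Lemma powR_dy r s k : 0 < r -> (r * dy k) `^ s = r `^ s * (2 `^ (- s)) ^+ k.
Proof.
move=> r0; rewrite powRM ?(ltW r0) ?(ltW (dy_gt0 k))//; congr (_ * _).
rewrite -powR_mulrn; last exact: powR_ge0.
rewrite /dy -powRrM -[RHS]powRrM; have -> // : - k%:R * s = - s * k%:R by ring.
Qed.

Lemma trivIset_shell r : 0 < r -> trivIset setT (fun k => shell n (r * dy k)).
Proof.
move=> r0; apply/trivIsetP => k l _ _; wlog kl : k l / (k < l)%N.
  move=> H kl; have /orP[lt|lt] : (k < l)%N || (l < k)%N by rewrite -neq_ltn.
    exact: H.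
  by rewrite setIC; apply: H => //; rewrite eq_sym.
move=> _; apply/seteqP; split=> x //= -[/andP[a _] /andP[_ b]].
have := lt_le_trans a b; rewrite -mulrA -dyS ltr_pM2l//.
by rewrite ltNge dy_anti.
Qed.

Lemma shell_cover r x : 0 < cheb x -> cheb x <= r ->
  exists k, shell n (r * dy k) x.
Proof.
move=> x0 xr; have r0 : 0 < r by exact: lt_le_trans xr.
have ex : exists k, r * dy k.+1 < cheb x.
  exists (Num.truncn (r / cheb x)); rewrite /dy powRN -ltr_pdivlMr ?invr_gt0 ?powR_gt0//.
  rewrite invrK mulrC -ltr_pdivrMr// powR_mulrn//.
  apply: (@lt_le_trans _ _ (Num.truncn (r / cheb x)).+1%:R).
    by have /andP[] := truncn_itv (divr_ge0 (ltW r0) (ltW x0)).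
  by rewrite -natrX ler_nat ltnW// ltn_expl.
case: (ex_minnP ex) => k kx kmin; exists k; rewrite /shell /=.
rewrite -mulrA -dyS kx /=; case: k kx kmin => [|k] kx kmin.
  by rewrite /dy oppr0 powRr0 mulr1.
by rewrite leNgt; apply/negP => /kmin; rewrite ltnn.
Qed.

Lemma geometric_partial (z : R) J : 0 <= z < 1 -> \sum_(k < J) z ^+ k <= (1 - z)^-1.
Proof.
move=> /andP[z0 z1]; have z10 : 0 < 1 - z by rewrite subr_gt0.
rewrite -[leRHS]mul1r ler_pdivlMr// (_ : _ * _ = 1 - z ^+ J).
  by rewrite gerBl exprn_ge0.
elim: J => [|J ih]; first by rewrite big_ord0 expr0; ring.
by rewrite big_ord_recr mulrDl ih exprS /=; ring.
Qed.

(** The shells of radii r 2^(-k) cover the ball up to the origin and contribute a geometric series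
    of ratio 2^(-s). *)
Lemma integral_cheb_ball_le r s : 0 < r -> 0 < s ->
  (\int[leb R n]_(x in [set x | (cheb x <= r)%R]) (chebX (s - n%:R) x)%:E <=
   (2 `^ `|s - n%:R| * 2 ^+ n * r `^ s / (1 - 2 `^ (- s)))%:E)%E.
Proof.
move=> r0 s0; pose t := s - n%:R; rewrite -/t.
pose U := \bigcup_k shell n (r * dy k).
have mU : measurable U by apply: bigcup_measurable => k _; exact: measurable_shell.
apply: (@le_trans _ _ (\int[leb R n]_(x in U) (chebX t x)%:E)%E).
  rewrite -[leLHS]integral_EFin_indic -[leRHS]integral_EFin_indic; apply: ae_le_integral_nonmeas.
  - by move=> x; rewrite lee_fin mulr_ge0 ?chebX_ge0.
  - by move=> x; rewrite lee_fin mulr_ge0 ?chebX_ge0.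
  apply: filterS (ae_cheb_gt0 R n_gt0) => x x0; rewrite lee_fin.
  rewrite ler_wpM2r ?chebX_ge0// indicE; case: (boolP (x \in _)) => //.
  rewrite inE /= => xr; have [k kx] := shell_cover x0 xr.
  by rewrite indicE mem_set//; exists k.
rewrite ge0_integral_bigcup//; last 4 first.
- by move=> k; exact: measurable_shell.
- by apply/measurable_EFinP; exact: measurable_funTS (measurable_chebX _).
- by move=> x _; rewrite lee_fin chebX_ge0.
- exact: trivIset_shell.
apply: lime_le.
  by apply: is_cvg_nneseries => k _ _; apply: integral_EFin_ge0 => x _; exact: chebX_ge0.
apply: nearW => J; set M := 2 `^ `|t| * 2 ^+ n.
have M0 : 0 <= M by rewrite mulr_ge0 ?powR_ge0 ?exprn_ge0.
apply: (@le_trans _ _ (\sum_(0 <= k < J) (M * r `^ s * (2 `^ (- s)) ^+ k)%:E)%E).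
  apply: lee_sum => k _.
  have rk : 0 < r * dy k by rewrite mulr_gt0 ?dy_gt0.
  have /andP[_] := integral_shell n_gt0 t rk; rewrite -/M (_ : t + n%:R = s) ?subrK//.
  by rewrite powR_dy// mulrA.
rewrite sumEFin lee_fin -mulr_sumr ler_wpM2l ?mulr_ge0 ?powR_ge0// big_mkord.
apply: geometric_partial; rewrite powR_ge0 /=.
by rewrite powRN invf_lt1 ?powR_gt0// powR_expR// expR_gt1 mulr_gt0// ln_gt0// ltr1n.
Qed.

(** Only the first [J] shells are kept. For [s] of order 1/J each of them contributes a fixed
    amount, and the integral is at least of order J. *)
Lemma integral_cheb_ball_ge r s J : 0 < r -> 0 <= s ->
  ((J%:R * (2 `^ (- `|s - n%:R|) * r `^ s * 2 `^ (- (J%:R * s))))%:E <=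
   \int[leb R n]_(x in [set x | (cheb x <= r)%R]) (chebX (s - n%:R) x)%:E)%E.
Proof.
move=> r0 s0; pose t := s - n%:R; rewrite -/t.
pose U := \big[setU/set0]_(k < J) shell n (r * dy k).
have mU : measurable U by apply: bigsetU_measurable => k _; exact: measurable_shell.
apply: (@le_trans _ _ (\int[leb R n]_(x in U) (chebX t x)%:E)%E); last first.
  apply: ge0_subset_integral => //.
  - exact: measurable_cheb_ball.
  - by apply/measurable_EFinP; exact: measurable_funTS (measurable_chebX _).
  - by move=> x _; rewrite lee_fin chebX_ge0.
  rewrite /U -(bigcup_mkord J (fun k => shell n (r * dy k))) => x [k _] /andP[_ /le_trans]; apply.
  by rewrite ler_piMr ?(ltW r0) ?dy_le1.
rewrite /U ge0_integral_bigsetU//; last 5 first.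
- by move=> k; exact: measurable_shell.
- exact: index_enum_uniq.
- by move/trivIsetP: (trivIset_shell r0) => H; apply/trivIsetP => i j _ _ ij; exact: H.
- by apply/measurable_EFinP; exact: measurable_funTS (measurable_chebX _).
- by move=> x _; rewrite lee_fin chebX_ge0.
set c : R := 2 `^ _ * _ * _.
have -> : (J%:R * c)%:E = (\sum_(k < J) c%:E)%E.
  by rewrite sumEFin sumr_const card_ord mulr_natl.
apply: lee_sum => k _; have rk : 0 < r * dy k by rewrite mulr_gt0 ?dy_gt0.
have /andP[H _] := integral_shell n_gt0 t rk; apply: le_trans H.
rewrite lee_fin (_ : t + n%:R = s) ?subrK// powR_dy// /c -mulrA.
apply: ler_wpM2l; first exact: powR_ge0.
apply: ler_wpM2l; first exact: powR_ge0.
rewrite -powR_mulrn; last exact: powR_ge0.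
rewrite -powRrM ler_powR ?ler1n// mulNr lerN2 mulrC ler_wpM2r//.
by rewrite ler_nat ltnW.
Qed.

(** With y = ln 2 / J, the inequality 2^(1/J) >= 1 + y gives 1 - 2^(-1/J) >= y / (1 + y). *)
Lemma inv_one_sub_powR_le J : (0 < J)%N ->
  (1 - 2 `^ (- J%:R^-1))^-1 <= J%:R * (1 + (ln 2)^-1) :> R.
Proof.
move=> J0; have Jr : 1 <= J%:R :> R by rewrite ler1n.
have l0 : 0 < ln 2 :> R by rewrite ln_gt0// ltr1n.
set y := J%:R^-1 * ln 2 : R; have y0 : 0 < y by rewrite mulr_gt0 ?invr_gt0 ?ltr0n.
have h : 2 `^ (- J%:R^-1) <= (1 + y)^-1 :> R.
  rewrite powRN lef_pV2 ?posrE ?powR_gt0 ?addr_gt0// powR_expR// -/y.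
  exact: expR_ge1Dx.
have h1 : y / (1 + y) <= 1 - 2 `^ (- J%:R^-1).
  apply: le_trans (lerB (lexx 1) h); rewrite le_eqVlt; apply/orP; left; apply/eqP.
  by field; rewrite gt_eqF// addr_gt0.
have h2 : 0 < y / (1 + y) by rewrite divr_gt0 ?addr_gt0.
apply: (@le_trans _ _ (y / (1 + y))^-1).
  by rewrite lef_pV2 ?posrE ?(lt_le_trans h2 h1).
have -> : (y / (1 + y))^-1 = 1 + J%:R / ln 2.
  by rewrite invf_div mulrDl mul1r divff ?(gt_eqF y0)// addrC /y invfM invrK.
by rewrite mulrDr mulr1 lerD2r.
Qed.

End radial_integral.

(** * Averages of radial powers over cubes *)

Section power_weights.
Variables (R : realType) (n : nat).
Hypothesis n_gt0 : (0 < n)%N.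
Local Notation euclid n := (n.-tuple (measurableTypeR R)).
Implicit Types (x a : euclid n) (l s t : R) (J : nat).

Lemma cube_cheb_le x a l : 0 < l -> cube a l x -> cheb x <= cheb a + l /\ cheb a <= cheb x + l.
Proof.
move=> l0 xa; have d k : `|tnth x k - tnth a k| <= l.
  by have /andP[] := xa k; rewrite ler_norml; lra.
split; apply: cheb_le_add (ltW l0) _ => // k; rewrite distrC; exact: d.
Qed.

Lemma integral_cube_cst a l c : 0 < l ->
  (\int[leb R n]_(x in cube a l) c%:E = (c * l ^+ n)%:E)%E.
Proof.
move=> l0; rewrite integral_cst; last exact: measurable_cube.
by rewrite EFinM; congr (_ * _)%E; exact: leb_cube.
Qed.

Lemma average_le a l (g : euclid n -> R) c : 0 < l ->
  (forall x, 0 <= g x) -> 0 <= c ->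
  {ae leb R n, forall x, cube a l x -> g x <= c} -> (average (cube a l) g <= c%:E)%E.
Proof.
move=> l0 g0 c0 gc; rewrite /average leb_cube//=.
have ln0 : 0 < l ^+ n by exact: exprn_gt0.
rewrite lee_pdivrMl// -EFinM.
apply: (@le_trans _ _ (\int[leb R n]_(x in cube a l) c%:E)%E); last first.
  by rewrite integral_cube_cst// mulrC.
rewrite -[leLHS]integral_EFin_indic -[leRHS]integral_EFin_indic.
apply: ae_le_integral_nonmeas.
- by move=> x; rewrite lee_fin mulr_ge0.
- by move=> x; rewrite lee_fin mulr_ge0.
apply: filterS gc => x xc; rewrite lee_fin indicE.
by case: (boolP (x \in _)); rewrite ?mul0r// inE !mul1r.
Qed.

Lemma average_ge a l (g : euclid n -> R) c : 0 < l -> 0 <= c ->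
  (forall x, cube a l x -> c <= g x) -> (c%:E <= average (cube a l) g)%E.
Proof.
move=> l0 c0 gc; rewrite /average leb_cube//=.
have ln0 : 0 < l ^+ n by exact: exprn_gt0.
rewrite lee_pdivlMl// -EFinM.
apply: (@le_trans _ _ (\int[leb R n]_(x in cube a l) c%:E)%E).
  by rewrite integral_cube_cst// mulrC.
by apply: le_integral_EFin => x xa; [|exact: gc].
Qed.

Lemma average_cst1 a l : 0 < l -> average (cube a l) (fun=> 1) = 1%E.
Proof.
by move=> l0; apply/eqP; rewrite eq_le average_le ?average_ge//; exact: nearW.
Qed.

Lemma average_ge0 (Q : set (euclid n)) (g : euclid n -> R) :
  (forall x, 0 <= g x) -> (0 <= average Q g)%E.
Proof.
move=> g0; rewrite mule_ge0 ?lee_fin ?invr_ge0 ?fine_ge0//.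
by apply: integral_EFin_ge0 => x _.
Qed.

Lemma integral_cube_chebX_lty a l s : 0 < l -> - n%:R < s ->
  (\int[leb R n]_(x in cube a l) (chebX s x)%:E < +oo)%E.
Proof.
move=> l0 sn; have sn0 : 0 < s + n%:R by lra.
have r0 : 0 < cheb a + l by rewrite ltr_wpDl ?cheb_ge0.
have := integral_cheb_ball_le n_gt0 r0 sn0; rewrite addrK => H.
apply: le_lt_trans (ltry _); apply: le_trans H; apply: ge0_subset_integral.
- exact: measurable_cube.
- exact: measurable_cheb_ball.
- by apply/measurable_EFinP; exact: measurable_funTS (measurable_chebX _).
- by move=> x _; rewrite lee_fin chebX_ge0.
by move=> x /(cube_cheb_le l0)[].
Qed.

Definition log2C : R := 1 + (ln 2)^-1.

Lemma log2C_ge1 : 1 <= log2C.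
Proof. by rewrite lerDl invr_ge0 ln_ge0// ler1n. Qed.

(** One factor 2^n is the volume of the shells, the other bounds 2^|1/J - n|, and [log2C] comes from
    summing the geometric series. *)
Definition ballC : R := 4 ^+ n * log2C.

Lemma ballC_ge1 : 1 <= ballC.
Proof. by rewrite -[1]mulr1 ler_pM ?log2C_ge1// exprn_ege1// ler1n. Qed.

Lemma integral_cheb_ball_log r J : (0 < J)%N -> 0 < r ->
  (\int[leb R n]_(x in [set x | (cheb x <= r)%R]) (chebX (J%:R^-1 - n%:R) x)%:E <=
   (ballC * r `^ J%:R^-1 * J%:R)%:E)%E.
Proof.
move=> J0 r0; have Ji : 0 < J%:R^-1 :> R by rewrite invr_gt0 ltr0n.
apply: le_trans (integral_cheb_ball_le n_gt0 r0 Ji) _.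
have Ji1 : J%:R^-1 <= 1 :> R by rewrite invf_le1 ?ltr0n// ler1n.
have n1 : 1 <= n%:R :> R by rewrite ler1n.
have H := inv_one_sub_powR_le R J0; rewrite -/log2C in H.
have D0 : 0 < 1 - 2 `^ (- J%:R^-1) :> R.
  by rewrite subr_gt0 powRN invf_lt1 ?powR_gt0// powR_expR// expR_gt1 mulr_gt0// ln_gt0// ltr1n.
have P : 2 `^ `|J%:R^-1 - n%:R| <= 2 ^+ n :> R.
  rewrite -powR_mulrn// ler_powR ?ler1n// ler_norml; lra.
rewrite lee_fin /ballC (_ : 4 = 2 * 2); last by rewrite -natrM.
have p0 : 0 <= r `^ J%:R^-1 by exact: powR_ge0.
have A0 : 0 <= 2 `^ `|J%:R^-1 - n%:R| :> R by exact: powR_ge0.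
have B0 : 0 <= 2 ^+ n :> R by exact: exprn_ge0.
rewrite exprMn; set D := 1 - 2 `^ _ in H D0 *; set A := 2 `^ _ in P A0 *.
set B := 2 ^+ n in P B0 *; set C := r `^ _ in p0 *.
rewrite [leRHS](_ : _ = B * B * C * (J%:R * log2C)); last by ring.
have AB : A * B <= B * B by rewrite ler_wpM2r.
apply: ler_pM => //; [exact: (mulr_ge0 (mulr_ge0 A0 B0) p0)|by rewrite invr_ge0 ltW|].
by rewrite ler_wpM2r.
Qed.

Definition muckC : R := 3 ^+ n * ballC.

Lemma muckC_ge1 : 1 <= muckC.
Proof. by rewrite -[1]mulr1 ler_pM ?ballC_ge1// exprn_ege1// ler1n. Qed.

(** Far from the origin the norm varies over the cube by a factor at most 4, and the two powers
    cancel up to 4^n. Otherwise the cube lies in the ball of radius 3l, where the singular integral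
    is of order J; the powers of 3l combine to (3l)^n, whence the 3^n in [muckC]. *)
Lemma cube_chebX_product a l t J : 0 < l -> 0 < t <= 1 -> (0 < J)%N ->
  (average (cube a l) (chebX ((n%:R - J%:R^-1) * t)) *
   average (cube a l) (chebX (J%:R^-1 - n%:R)) `^ t <= (muckC * J%:R `^ t)%:E)%E.
Proof.
move=> l0 /andP[t0 t1] J0; set d : R := J%:R^-1; set k := (n%:R - d) * t.
have d0 : 0 < d by rewrite invr_gt0 ltr0n.
have d1 : d <= 1 by rewrite invf_le1 ?ltr0n// ler1n.
have n1 : 1 <= n%:R :> R by rewrite ler1n.
have k0 : 0 <= k by rewrite mulr_ge0 ?(ltW t0)//; lra.
have kn : k <= n%:R by rewrite /k; nra.
have J1 : 1 <= J%:R `^ t by rewrite -[leLHS](powRr0 J%:R) ler_powR ?ler1n ?(ltW t0).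
suff [A [B [A0 B0 HA HB HAB]]] : exists A B : R, [/\ 0 <= A, 0 <= B,
    (average (cube a l) (chebX k) <= A%:E)%E,
    (average (cube a l) (chebX (d - n%:R)) <= B%:E)%E & A * B `^ t <= muckC * J%:R `^ t].
  apply: (@le_trans _ _ (A%:E * B%:E `^ t)%E); last by rewrite poweR_EFin -EFinM lee_fin.
  apply: lee_pmul => //; first by apply: average_ge0 => x; exact: chebX_ge0.
    exact: poweR_ge0.
  apply: gt0_ler_poweR => //; rewrite ?in_itv/= ?leey ?andbT ?(ltW t0)//.
  by apply: average_ge0 => x; exact: chebX_ge0.
have [al|al] := leP (2 * l) (cheb a).
- have r0 : 0 < cheb a by apply: lt_le_trans al; rewrite mulr_gt0.
  have bd x : cube a l x -> [/\ 0 < cheb x, cheb x <= 2 * cheb a & cheb a / 2 <= cheb x].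
    by move=> /(cube_cheb_le l0)[h1 h2]; split; lra.
  exists ((2 * cheb a) `^ k), ((cheb a / 2) `^ (d - n%:R)); split; try exact: powR_ge0.
  + apply: average_le; rewrite ?powR_ge0//; first by move=> x; exact: chebX_ge0.
    apply: nearW => x /bd[x0 x1 _]; rewrite chebXE// ge0_ler_powR ?nnegrE ?(ltW x0)//.
    by rewrite mulr_ge0 ?ltW.
  + apply: average_le; rewrite ?powR_ge0//; first by move=> x; exact: chebX_ge0.
    apply: nearW => x /bd[x0 _ x1]; rewrite chebXE// -(opprB n%:R) !powRN lef_pV2 ?posrE ?powR_gt0// ?divr_gt0//.
    by rewrite ge0_ler_powR ?nnegrE ?(ltW x0) ?divr_ge0 ?(ltW r0)//; lra.
  rewrite -powRrM (_ : (d - n%:R) * t = - k); last by rewrite /k; ring.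
  have c20 : 0 < cheb a / 2 by rewrite divr_gt0.
  rewrite powRN (_ : 2 * cheb a = 4 * (cheb a / 2)); last by field.
  rewrite powRM ?(ltW c20)// mulfK ?gt_eqF ?powR_gt0//.
  apply: (@le_trans _ _ (4 `^ n%:R)); first by rewrite ler_powR// ler1n.
  have h1 : 4 ^+ n <= ballC by rewrite ler_peMr ?exprn_ge0 ?log2C_ge1.
  have h2 : ballC <= muckC.
    by rewrite ler_peMl ?exprn_ege1 ?ler1n// (le_trans _ ballC_ge1).
  rewrite powR_mulrn//; apply: (le_trans (le_trans h1 h2)).
  by rewrite ler_peMr// (le_trans _ muckC_ge1).
- have bd x : cube a l x -> cheb x <= 3 * l.
    by move=> /(cube_cheb_le l0)[h1 h2]; lra.
  have B0 : 0 <= l ^- n * (ballC * (3 * l) `^ d * J%:R).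
    apply: mulr_ge0; first by rewrite invr_ge0 exprn_ge0 ?(ltW l0).
    apply: (mulr_ge0 _ (ler0n _ _)); apply: (mulr_ge0 _ (powR_ge0 _ _)).
    exact: le_trans ler01 ballC_ge1.
  exists ((3 * l) `^ k), (l ^- n * (ballC * (3 * l) `^ d * J%:R)); split.
  + exact: powR_ge0.
  + exact: B0.
  + apply: average_le; rewrite ?powR_ge0//; first by move=> x; exact: chebX_ge0.
    apply: filterS (ae_cheb_gt0 R n_gt0) => x x0 /bd xl.
    rewrite chebXE// ge0_ler_powR ?nnegrE ?(ltW x0)//.
    by rewrite mulr_ge0 ?ltW.
  + rewrite /average leb_cube//= EFinM lee_wpmul2l ?lee_fin ?invr_ge0 ?exprn_ge0 ?(ltW l0)//.
    have l30 : 0 < 3 * l by rewrite mulr_gt0.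
    apply: le_trans (integral_cheb_ball_log J0 l30); apply: ge0_subset_integral.
    - exact: measurable_cube.
    - exact: measurable_cheb_ball.
    - by apply/measurable_EFinP; exact: measurable_funTS (measurable_chebX _).
    - by move=> x _; rewrite lee_fin chebX_ge0.
    - by move=> x /bd.
  have l30 : 0 < 3 * l by rewrite mulr_gt0.
  have b1 := ballC_ge1; have m1 := muckC_ge1.
  rewrite /k powRrM -powRM//; last exact: powR_ge0.
  have E : (3 * l) `^ (n%:R - d) * (3 * l) `^ d = 3 ^+ n * l ^+ n.
    rewrite -powRD; last by apply/implyP => _; rewrite gt_eqF.
    by rewrite subrK powR_mulrn ?exprMn// ltW.
  have -> : (3 * l) `^ (n%:R - d) * (l ^- n * (ballC * (3 * l) `^ d * J%:R)) =
      (3 * l) `^ (n%:R - d) * (3 * l) `^ d / l ^+ n * (ballC * J%:R) by ring.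
  rewrite E mulfK ?gt_eqF ?exprn_gt0// mulrA -/muckC powRM//; last exact: le_trans m1.
  rewrite ler_wpM2r ?powR_ge0// -[leRHS]powRr1; last exact: le_trans m1.
  by rewrite ler_powR.
Qed.

End power_weights.

Section power_weight_family.
Variables (R : realType) (m n : nat) (q : R) (p : 'I_m -> R).
Hypotheses (n_gt0 : (0 < n)%N) (q_gt0 : 0 < q) (p_gt1 : forall i, 1 < p i).
Local Notation euclid n := (n.-tuple (measurableTypeR R)).
Variables (j : 'I_m) (om : R).

Definition pow_exp (i : 'I_m) : R := if i == j then om else 0.

Definition pow_weight (i : 'I_m) : euclid n -> R := chebX (pow_exp i).

Lemma sum_pow_exp : \sum_i pow_exp i = om.
Proof.
rewrite (bigD1 j)//= /pow_exp eqxx big1 ?addr0// => i ij.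
by rewrite (negbTE ij).
Qed.

Lemma u_pow_weight : u_weight q pow_weight = chebX (q * om).
Proof. by apply/funext => x; rewrite /u_weight prod_chebX sum_pow_exp chebX_powR. Qed.

Lemma sigma_pow_weight i :
  sigma_weight p pow_weight i = chebX (- conj_exp (p i) * pow_exp i).
Proof. by apply/funext => x; rewrite /sigma_weight chebX_powR. Qed.

Lemma pow_weight_product (a : euclid n) l : 0 < l ->
  (average (cube a l) (u_weight q pow_weight) *
   \prod_(i < m) (average (cube a l) (sigma_weight p pow_weight i) `^ (q / conj_exp (p i))) =
   average (cube a l) (chebX (q * om)) *
   average (cube a l) (chebX (- (conj_exp (p j) * om))) `^ (q / conj_exp (p j)))%E.
Proof.
move=> l0; rewrite u_pow_weight; congr (_ * _)%E.
rewrite (bigD1 j)//= big1.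
  by rewrite mule1 sigma_pow_weight /pow_exp eqxx mulNr.
move=> i ij; rewrite sigma_pow_weight /pow_exp (negbTE ij) mulr0.
have -> : chebX 0 = (fun=> 1) :> (euclid n -> R) by apply/funext => x; rewrite chebX0.
by rewrite average_cst1// poweR_EFin powR1.
Qed.

Lemma ApqC_pow_weight_le (A : \bar R) :
  (forall (a : euclid n) l, 0 < l -> (average (cube a l) (chebX (q * om)) *
   average (cube a l) (chebX (- (conj_exp (p j) * om))) `^ (q / conj_exp (p j)) <= A)%E) ->
  (ApqC p q pow_weight <= A)%E.
Proof.
by move=> H; apply: ge_ereal_sup => _ [_ [a [l l0 ->]] <-]; rewrite pow_weight_product//; exact: H.
Qed.

(** On the cube [1,2]^n the norm lies between 1 and 2, so a power with exponent at least -n is at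
    least 2^(-n). The bound is uniform in the exponent, as needed when the exponent of the
    characteristic is negative. *)
Lemma ApqC_pow_weight_ge :
  - n%:R <= q * om -> conj_exp (p j) * om <= n%:R ->
  ((2 `^ (- n%:R) * (2 `^ (- n%:R)) `^ (q / conj_exp (p j)))%:E <= ApqC p q pow_weight)%E.
Proof.
move=> h1 h2; pose a : euclid n := [tuple 1 | _ < n].
have bd x : cube a 1 x -> 1 <= cheb x <= 2.
  move=> xa; have xk k : 1 <= tnth x k <= 2.
    by have := xa k; rewrite tnth_mktuple.
  apply/andP; split.
    have := xk (Ordinal n_gt0) => /andP[/le_trans H _]; apply: H.
    exact: le_trans (ler_norm _) (coord_le_cheb _ _).
  by apply/cheb_leP => // k; have /andP[x1 x2] := xk k; rewrite ger0_norm// (le_trans _ x1).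
have bnd s x : - n%:R <= s -> cube a 1 x -> 2 `^ (- n%:R) <= chebX s x.
  move=> sn /bd /andP[x1 x2]; have x0 : 0 < cheb x by exact: lt_le_trans x1.
  rewrite chebXE//; have [s0|s0] := leP 0 s.
    apply: (@le_trans _ _ 1).
      by rewrite -[leRHS](powRr0 2) ler_powR ?ler1n// oppr_le0.
    by rewrite -[leLHS](powRr0 (cheb x)) ler_powR.
  apply: (@le_trans _ _ (2 `^ s)); first by rewrite ler_powR ?ler1n.
  have N (t : R) : t `^ s = (t `^ (- s))^-1 by rewrite powRN invrK.
  rewrite (N 2) (N (cheb x)) lef_pV2 ?posrE ?powR_gt0//.
  by rewrite ge0_ler_powR ?nnegrE ?(ltW x0)// oppr_ge0 ltW.
have E0 : 0 <= 2 `^ (- n%:R) :> R by exact: powR_ge0.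
apply: (@le_trans _ _ (average (cube a 1) (u_weight q pow_weight) *
   \prod_(i < m) (average (cube a 1) (sigma_weight p pow_weight i) `^ (q / conj_exp (p i))))%E).
  rewrite pow_weight_product// EFinM -(poweR_EFin (2 `^ (- n%:R))); apply: lee_pmul; rewrite ?lee_fin ?poweR_ge0//.
  - by apply: average_ge => // x; exact: bnd.
  have cj : 0 < conj_exp (p j) by exact: lt_trans ltr01 (conj_exp_gt1 p_gt1 j).
  apply: gt0_ler_poweR => //; rewrite ?in_itv/= ?leey ?andbT ?lee_fin ?E0 ?(ltW (divr_gt0 q_gt0 cj))//.
    by apply: average_ge0 => x; exact: chebX_ge0.
  by apply: average_ge => // x; apply: bnd; rewrite lerN2.
by apply: ereal_sup_ubound; exists (cube a 1) => //; exists a, 1.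
Qed.

Lemma weight_pow_weight i : - n%:R < om -> weight (pow_weight i).
Proof.
move=> omn; split.
- by exists (pow_weight i); [exact: measurable_chebX|exact: nearW].
- by move=> x; exact: chebX_ge0.
- by apply: nearW => x; exact: chebX_gt0.
move=> _ [a [l l0 ->]]; apply: integral_cube_chebX_lty => //.
by rewrite /pow_exp; case: ifP => // _; rewrite oppr_lt0 ltr0n.
Qed.

Variable J : nat.
Hypothesis J_gt0 : (0 < J)%N.

Definition pow_fun (i : 'I_m) (x : euclid n) : R :=
  \1_[set x : euclid n | cheb x <= 1] x *
  chebX ((J%:R^-1 - n%:R) / p i - pow_exp i) x.

Lemma pow_fun_ge0 i x : 0 <= pow_fun i x.
Proof. by rewrite mulr_ge0 ?chebX_ge0. Qed.

Lemma measurable_pow_fun i : measurable_fun setT (pow_fun i).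
Proof.
apply: measurable_funM; last exact: measurable_chebX.
by apply: measurable_indic; exact: measurable_cheb_ball.
Qed.

Lemma wnorm_pow_fun i :
  (wnorm (p i) (fun x => pow_weight i x `^ p i)%R (EFin \o pow_fun i) <=
   ((ballC R n * J%:R) `^ (p i)^-1)%:E)%E.
Proof.
have p0 : 0 < p i by exact: lt_trans ltr01 (p_gt1 i).
rewrite wnorm_EFin -[leRHS]poweR_EFin.
have E : (\int[leb R n]_x (`|pow_fun i x| `^ p i * pow_weight i x `^ p i)%:E =
    \int[leb R n]_(x in [set x | (cheb x <= 1)%R]) (chebX (J%:R^-1 - n%:R) x)%:E)%E.
  rewrite -[RHS]integral_EFin_indic; apply: eq_integral => x _; congr EFin.
  rewrite (ger0_norm (pow_fun_ge0 i x)) /pow_fun powRM ?chebX_ge0//.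
  rewrite /pow_weight !chebX_powR -mulrA -chebXD; congr (_ * chebX _ x).
    by rewrite indicE; case: (x \in _); rewrite ?powR1// powR0// gt_eqF.
  by move: J%:R^-1 => d; field; rewrite gt_eqF.
rewrite E; apply: gt0_ler_poweR; rewrite ?in_itv/= ?leey ?andbT ?invr_ge0 ?(ltW p0)//.
- by apply: integral_EFin_ge0 => x _; exact: chebX_ge0.
- by rewrite lee_fin mulr_ge0// (le_trans ler01 (ballC_ge1 R n)).
have := @integral_cheb_ball_log R n n_gt0 1 J J_gt0 ltr01.
have -> : 1 `^ J%:R^-1 = 1 :> R by rewrite powR1.
by rewrite mulr1.
Qed.

Lemma in_wLp_pow_fun i : in_wLp (p i) (fun x => pow_weight i x `^ p i) (pow_fun i).
Proof.
split; last exact: le_lt_trans (wnorm_pow_fun i) (ltry _).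
by exists (pow_fun i); [exact: measurable_pow_fun|exact: nearW].
Qed.

Lemma prod_wnorm_pow_fun :
  (\prod_i wnorm (p i) (fun x => pow_weight i x `^ p i)%R (EFin \o pow_fun i) <=
   ((ballC R n * J%:R) `^ (\sum_i (p i)^-1))%:E)%E.
Proof.
rewrite powR_sum; last by rewrite mulr_gt0 ?ltr0n// (lt_le_trans ltr01 (ballC_ge1 R n)).
by rewrite -prodEFin; apply: le_prode => i; rewrite poweR_ge0 wnorm_pow_fun.
Qed.

End power_weight_family.

Section characteristic.
Variables (R : realType) (m n : nat) (q : R) (p : 'I_m -> R).
Hypotheses (n_gt0 : (0 < n)%N) (q_gt0 : 0 < q) (p_gt1 : forall i, 1 < p i).
Variables (j : 'I_m) (J : nat).
Hypothesis J_gt0 : (0 < J)%N.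
Local Notation c := (conj_exp (p j)).

Let c_gt0 : 0 < c. Proof. exact: lt_trans ltr01 (conj_exp_gt1 p_gt1 j). Qed.

Lemma ApqC_sigma_singular : q <= c ->
  (ApqC p q (pow_weight (n := n) j ((n%:R - J%:R^-1) / c)) <= (muckC R n * J%:R `^ (q / c))%:E)%E.
Proof.
move=> qc; apply: ApqC_pow_weight_le => // a l l0.
have -> : - (c * ((n%:R - J%:R^-1) / c)) = J%:R^-1 - n%:R.
  by move: J%:R^-1 => d; field; rewrite gt_eqF.
have -> : q * ((n%:R - J%:R^-1) / c) = (n%:R - J%:R^-1) * (q / c).
  by move: J%:R^-1 => d; field; rewrite gt_eqF.
by apply: cube_chebX_product => //; rewrite divr_gt0//= ler_pdivrMr// mul1r.
Qed.

(** The roles of u_w and sigma_j are exchanged: [cube_chebX_product] with t = c/q, raised to the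
    power q/c. *)
Lemma ApqC_u_singular : c <= q ->
  (ApqC p q (pow_weight (n := n) j ((J%:R^-1 - n%:R) / q)) <= ((muckC R n) `^ (q / c) * J%:R)%:E)%E.
Proof.
move=> cq; apply: ApqC_pow_weight_le => // a l l0.
have -> : q * ((J%:R^-1 - n%:R) / q) = J%:R^-1 - n%:R.
  by move: J%:R^-1 => d; field; rewrite gt_eqF.
have -> : - (c * ((J%:R^-1 - n%:R) / q)) = (n%:R - J%:R^-1) * (c / q).
  by move: J%:R^-1 => d; field; rewrite gt_eqF.
set X := average _ _; set Y := average _ _.
have X0 : (0 <= X)%E by apply: average_ge0 => x; exact: chebX_ge0.
have Y0 : (0 <= Y)%E by apply: average_ge0 => x; exact: chebX_ge0.
have qc0 : 0 < q / c by rewrite divr_gt0.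
have H : (Y * X `^ (c / q) <= (muckC R n * J%:R `^ (c / q))%:E)%E.
  by apply: cube_chebX_product => //; rewrite divr_gt0//= ler_pdivrMr// mul1r.
have -> : (X * Y `^ (q / c) = (Y * X `^ (c / q)) `^ (q / c))%E.
  rewrite poweRM ?poweR_ge0// -poweRrM (_ : c / q * (q / c) = 1) ?poweRe1//.
    by rewrite muleC.
  by field; rewrite !gt_eqF.
have -> : muckC R n `^ (q / c) * J%:R = (muckC R n * J%:R `^ (c / q)) `^ (q / c).
  rewrite powRM ?powR_ge0 ?(le_trans ler01 (muckC_ge1 R n))// -powRrM.
  rewrite (_ : c / q * (q / c) = 1) ?powRr1//.
  by field; rewrite !gt_eqF.
rewrite -poweR_EFin; apply: gt0_ler_poweR; rewrite ?in_itv/= ?leey ?andbT ?(ltW qc0)//.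
  by rewrite mule_ge0 ?poweR_ge0.
by rewrite lee_fin mulr_ge0 ?powR_ge0// (le_trans ler01 (muckC_ge1 R n)).
Qed.

End characteristic.

(** * Sharpness of the exponent *)

Section lower_bound.
Variables (R : realType) (m n : nat) (alpha : R).
Hypothesis n_gt0 : (0 < n)%N.
Local Notation euclid n := (n.-tuple (measurableTypeR R)).
Local Notation mn := ((m * n)%:R : R).

Lemma eucl_dist_le_cheb (x y : euclid n) r : cheb x <= r -> cheb y <= r ->
  eucl_dist x y <= 2 * n%:R * r.
Proof.
move=> xr yr; have r0 : 0 <= r by apply: le_trans xr; exact: cheb_ge0.
have n1 : 1 <= n%:R :> R by rewrite ler1n.
have N0 : 0 <= 2 * n%:R * r by rewrite !mulr_ge0.
rewrite -[leRHS](ger0_norm N0) -sqrtr_sqr ler_wsqrtr//.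
apply: (@le_trans _ _ (\sum_(k < n) (2 * r) ^+ 2)).
  apply: ler_sum => k _; rewrite -real_normK ?num_real// ler_sqr ?nnegrE ?mulr_ge0//.
  apply: le_trans (ler_normB _ _) _; rewrite mulr_natl mulr2n lerD//.
    exact: le_trans (coord_le_cheb _ _) xr.
  exact: le_trans (coord_le_cheb _ _) yr.
rewrite sumr_const card_ord -[_ *+ n]mulr_natl.
rewrite [leRHS](_ : _ = n%:R * (n%:R * (2 * r) ^+ 2)); last by ring.
by rewrite ler_wpM2l// ler_peMl// sqr_ge0.
Qed.

Lemma spread_le_cheb (x : euclid n) (y : m.-tuple (euclid n)) r :
  cheb x <= r -> (forall i, cheb (tnth y i) <= r) -> spread x y <= 2 * mn * r.
Proof.
move=> xr yr; rewrite /spread (_ : 2 * mn * r = \sum_(i < m) (2 * n%:R * r)).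
  by apply: ler_sum => i _; exact: eucl_dist_le_cheb.
by rewrite sumr_const card_ord -[_ *+ m]mulr_natl natrM; ring.
Qed.

Lemma eucl_dist_gt0 (x y : euclid n) : cheb x != cheb y -> 0 < eucl_dist x y.
Proof.
move=> xy; rewrite lt_neqAle eucl_dist_ge0 andbT eq_sym; apply: contra xy => /eqP d0.
suff -> : x = y by [].
apply: eq_from_tnth => k; apply/eqP; rewrite -subr_eq0 -normr_le0.
by rewrite -d0 coord_le_eucl_dist.
Qed.

(** Needed for lower bounds, since the kernel is 0 by convention where the spread vanishes;
    different norms of [x] and y_j exclude this. *)
Lemma spread_gt0 (x : euclid n) (y : m.-tuple (euclid n)) j :
  cheb x != cheb (tnth y j) -> 0 < spread x y.
Proof.
move=> xy; rewrite /spread (bigD1 j)//= ltr_pwDl ?eucl_dist_gt0//.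
by apply: sumr_ge0 => i _; exact: eucl_dist_ge0.
Qed.

Hypothesis alpha_lt_mn : alpha < mn.
Variables (f : 'I_m -> euclid n -> R) (j : 'I_m).
Hypotheses (mf : forall i, measurable_fun setT (f i)) (f_ge0 : forall i x, 0 <= f i x).

(** The integral is restricted to boxes that are disjoint because of their j-th sides. On the k-th
    box all points have norm at most [L k], which bounds the kernel below, and the integral of the
    product factorises. *)
Lemma Ialpha_ge (x : euclid n) J (A : nat -> 'I_m -> set (euclid n))
    (L : nat -> R) (b : nat -> 'I_m -> R) :
  (forall k i, measurable (A k i)) -> trivIset setT (fun k => A k j) ->
  (forall k i y, (k < J)%N -> A k i y -> cheb y <= L k) ->
  (forall k, (k < J)%N -> cheb x <= L k) ->
  (forall k y, (k < J)%N -> A k j y -> cheb x != cheb y) ->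
  (forall k i, 0 <= b k i) ->
  (forall k i, (k < J)%N -> ((b k i)%:E <= \int[leb R n]_(y in A k i) (f i y)%:E)%E) ->
  ((\sum_(k < J) (2 * mn * L k) `^ (alpha - mn) * \prod_i b k i)%:E <=
   Ialpha alpha f x)%E.
Proof.
move=> mA tA AL xL xA b0 bI.
pose F (y : m.-tuple (euclid n)) := (\prod_(i < m) f i (tnth y i)) / spread x y `^ (mn - alpha).
have F0 y : 0 <= F y by rewrite divr_ge0 ?powR_ge0 ?prodr_ge0.
have mF : measurable_fun setT F.
  apply: measurable_funM; first exact: measurable_tuple_prod.
  have -> : (fun y : m.-tuple (euclid n) => (spread x y `^ (mn - alpha))^-1) =
      (fun y => spread x y `^ (- (mn - alpha))).
    by apply/funext => y; rewrite powRN.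
  exact: measurableT_comp (measurable_powR _) (measurable_spread x).
pose B k := [set y : m.-tuple (euclid n) | forall i, A k i (tnth y i)].
have mB k : measurable (B k) by apply: (measurable_box (A := A k)).
have mU : measurable (\big[setU/set0]_(k < J) B k).
  by apply: bigsetU_measurable => k _.
have -> : Ialpha alpha f x = (\int[lebm R m n]_y (F y)%:E)%E by [].
apply: (@le_trans _ _ (\int[lebm R m n]_(y in \big[setU/set0]_(k < J) B k) (F y)%:E)%E); last first.
  apply: ge0_subset_integral => //.
    by apply/measurable_EFinP; exact: measurable_funTS.
  by move=> y _; rewrite lee_fin.
rewrite ge0_integral_bigsetU//; last 4 first.
- exact: index_enum_uniq.
- apply/trivIsetP => k l _ _ kl; apply/seteqP; split=> y //= -[/(_ j) yk /(_ j) yl].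
  move/trivIsetP : tA => /(_ k l Logic.I Logic.I kl) E.
  suff : set0 (tnth y j) by [].
  by rewrite -E.
- by apply/measurable_EFinP; exact: measurable_funTS.
- by move=> y _; rewrite lee_fin.
rewrite -sumEFin; apply: lee_sum => k _; have kJ := ltn_ord k.
pose c := (2 * mn * L k) `^ (alpha - mn).
have c0 : 0 <= c by exact: powR_ge0.
pose h i y := \1_(A k i) y * f i y.
have mh i : measurable_fun setT (h i).
  by apply: measurable_funM => //; exact: measurable_indic.
have h0 i y : 0 <= h i y by rewrite mulr_ge0.
apply: (@le_trans _ _ (\int[lebm R m n]_y (c * \prod_i h i (tnth y i))%:E)%E).
  rewrite integral_EFinZ//; last 2 first.
  - by apply: (measurable_tuple_prod (h := h)).
  - by move=> y; apply: prodr_ge0.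
  rewrite [lebm R m n]/lebm (integral_tuple_prod _ (h := h))// EFinM.
  apply: lee_wpmul2l; first by rewrite lee_fin.
  rewrite -prodEFin; apply: le_prode => i; rewrite lee_fin b0 /=.
  by rewrite /h integral_EFin_indic bI.
rewrite -[leRHS]integral_EFin_indic; apply: le_integral_EFin => y _.
  by rewrite mulr_ge0// prodr_ge0.
rewrite /h big_split /= -indic_box mulrCA indicE.
case: (boolP (y \in _)) => [|_]; last by rewrite mul0r mulr_ge0.
rewrite inE /= => yA; rewrite !mul1r /F mulrC ler_wpM2l ?prodr_ge0//.
have s0 : 0 < spread x y by apply: (@spread_gt0 _ _ j); exact: xA kJ (yA j).
rewrite /c -(opprB mn) powRN lef_pV2 ?posrE ?powR_gt0//; last first.
  apply: lt_le_trans s0 _; apply: spread_le_cheb; first exact: xL.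
  by move=> i; exact: AL kJ (yA i).
apply: ge0_ler_powR; rewrite ?nnegrE ?(ltW s0) ?subr_ge0 ?(ltW alpha_lt_mn)//.
  apply: le_trans (ltW s0) _; apply: spread_le_cheb; first exact: xL.
  by move=> i; exact: AL kJ (yA i).
apply: spread_le_cheb; first exact: xL.
by move=> i; exact: AL kJ (yA i).
Qed.

End lower_bound.

Section radial_lower_bound.
Variables (R : realType) (m n : nat) (alpha q : R).
Hypotheses (m_gt0 : (0 < m)%N) (n_gt0 : (0 < n)%N).
Hypotheses (alpha_ltn : alpha < n%:R) (q_gt0 : 0 < q).
Local Notation euclid n := (n.-tuple (measurableTypeR R)).
Local Notation mn := ((m * n)%:R : R).

Variables (f : 'I_m -> euclid n -> R) (phi : 'I_m -> R).
Hypothesis fE : forall i x, f i x = \1_[set x : euclid n | cheb x <= 1] x * chebX (phi i) x.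

Lemma Ialpha_shell_ge (j : 'I_m) (x : euclid n) J (r : nat -> 'I_m -> R) (L : nat -> R) (K : R) :
  0 <= K -> (forall k i, 0 < r k i) -> (forall k i, r k i <= 1) ->
  (forall k i, r k i <= L k) ->
  (forall k, (k < J)%N -> cheb x <= L k) ->
  (forall k, (k < J)%N -> ~ shell n (r k j) x) ->
  trivIset setT (fun k => shell n (r k j)) ->
  (forall k i, (k < J)%N -> K * L k `^ (phi i + n%:R) <=
     2 `^ (- `|phi i|) * r k i `^ (phi i + n%:R)) ->
  (((2 * mn) `^ (alpha - mn) * K ^+ m * \sum_(k < J) L k `^ (alpha + \sum_i phi i))%:E <=
   Ialpha alpha f x)%E.
Proof.
move=> K0 r0 r1 rL xL xr tr Kr.
have amn : alpha < mn by apply: lt_le_trans alpha_ltn _; rewrite ler_nat leq_pmull.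
have L0 k : 0 < L k by exact: lt_le_trans (r0 k j) (rL k j).
have mf i : measurable_fun setT (f i).
  rewrite (_ : f i = fun x => \1_[set x : euclid n | cheb x <= 1] x * chebX (phi i) x); last first.
    by apply/funext => y; exact: fE.
  apply: measurable_funM; last exact: measurable_chebX.
  by apply: measurable_indic; exact: measurable_cheb_ball.
have f0 i y : 0 <= f i y by rewrite fE mulr_ge0 ?chebX_ge0.
have := @Ialpha_ge R m n alpha n_gt0 amn f j mf f0 x J
  (fun k i => shell n (r k i)) L (fun k i => K * L k `^ (phi i + n%:R)).
have -> : \sum_(k < J) (2 * mn * L k) `^ (alpha - mn) * \prod_i (K * L k `^ (phi i + n%:R)) =
    (2 * mn) `^ (alpha - mn) * K ^+ m * \sum_(k < J) L k `^ (alpha + \sum_i phi i).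
  rewrite mulr_sumr; apply: eq_bigr => k _.
  rewrite powRM ?mulr_ge0 ?(ltW (L0 k))// big_split /= prodr_const card_ord.
  rewrite -powR_sum// mulrACA -powRD; last by apply/implyP => _; rewrite gt_eqF.
  congr (_ * _ `^ _); rewrite big_split /= sumr_const card_ord.
  by rewrite -[_ *+ m]mulr_natl -natrM; ring.
apply.
- by move=> k i; exact: measurable_shell.
- exact: tr.
- by move=> k i y _ /andP[_ yr]; exact: le_trans yr (rL k i).
- exact: xL.
- move=> k y kJ yk; apply/negP => /eqP xy; apply: (xr k kJ).
  by rewrite /shell /= xy.
- by move=> k i; rewrite mulr_ge0 ?powR_ge0.
move=> k i kJ; have /andP[H _] := integral_shell n_gt0 (phi i) (r0 k i).
apply: (@le_trans _ _ (2 `^ (- `|phi i|) * r k i `^ (phi i + n%:R))%:E).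
  by rewrite lee_fin Kr.
apply: le_trans H _; apply: le_integral_EFin => y yk; first exact: chebX_ge0.
rewrite fE indicE mem_set ?mul1r//=.
by move: yk => /andP[_ /le_trans]; apply.
Qed.

(** The q-th power of the pointwise bound times the weight is (K1 J)^q N^(s-n), whose integral over
    the ball gives another factor J; the q-th root yields J^(1 + 1/q). *)
Lemma wnorm_Ialpha_ge (om bet s r K1 K2 : R) J : 0 < r -> 0 <= s -> 0 <= K1 -> 0 <= K2 ->
  q * (bet + om) = s - n%:R ->
  (forall x : euclid n, 0 < cheb x <= r -> ((K1 * J%:R * chebX bet x)%:E <= Ialpha alpha f x)%E) ->
  K2 <= 2 `^ (- `|s - n%:R|) * r `^ s * 2 `^ (- (J%:R * s)) ->
  ((K1 * K2 `^ q^-1 * J%:R `^ (1 + q^-1))%:E <=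
   wnorm q (chebX (q * om)) (Ialpha alpha f))%E.
Proof.
move=> r0 s0 K10 K20 sE IK KK.
have qi0 : 0 < q^-1 by rewrite invr_gt0.
have -> : K1 * K2 `^ q^-1 * J%:R `^ (1 + q^-1) =
    ((K1 * J%:R) `^ q * (K2 * J%:R)) `^ q^-1.
  rewrite powRM ?powR_ge0 ?mulr_ge0// -powRrM divff ?gt_eqF// powRr1 ?mulr_ge0//.
  rewrite powRM//; have -> : J%:R `^ (1 + q^-1) = J%:R * J%:R `^ q^-1 :> R.
    rewrite powRD ?powRr1//; apply/implyP => /eqP; lra.
  by ring.
rewrite -[leLHS]poweR_EFin /wnorm; apply: gt0_ler_poweR.
- exact: ltW.
- by rewrite in_itv/= leey andbT lee_fin mulr_ge0 ?powR_ge0 ?mulr_ge0.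
- rewrite in_itv/= leey andbT integral_ge0// => x _.
  by rewrite mule_ge0 ?poweR_ge0// lee_fin chebX_ge0.
apply: (@le_trans _ _ (\int[leb R n]_x (((K1 * J%:R) `^ q) *
    (\1_[set x | (cheb x <= r)%R] x * chebX (s - n%:R) x))%:E)%E).
  rewrite integral_EFinZ ?powR_ge0//; last 2 first.
  - apply: measurable_funM; last exact: measurable_chebX.
    by apply: measurable_indic; exact: measurable_cheb_ball.
  - by move=> x; rewrite mulr_ge0 ?chebX_ge0.
  rewrite EFinM; apply: lee_wpmul2l; first by rewrite lee_fin powR_ge0.
  rewrite integral_EFin_indic; apply: le_trans (integral_cheb_ball_ge n_gt0 J r0 s0).
  by rewrite lee_fin mulrC ler_wpM2l.
apply: ae_le_integral_nonmeas.
- by move=> x; rewrite lee_fin mulr_ge0 ?powR_ge0// mulr_ge0 ?chebX_ge0.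
- by move=> x; rewrite mule_ge0 ?poweR_ge0// lee_fin chebX_ge0.
apply: filterS (ae_cheb_gt0 R n_gt0) => x x0; rewrite indicE.
case: (boolP (x \in _)) => [|_]; last first.
  by rewrite mul0r mulr0 mule_ge0 ?poweR_ge0// lee_fin chebX_ge0.
rewrite inE /= => xr; rewrite mul1r.
have c0 : 0 <= K1 * J%:R * chebX bet x by rewrite !mulr_ge0 ?chebX_ge0.
have -> : (K1 * J%:R) `^ q * chebX (s - n%:R) x =
    (K1 * J%:R * chebX bet x) `^ q * chebX (q * om) x.
  by rewrite [in RHS]powRM ?mulr_ge0 ?chebX_ge0// chebX_powR -mulrA -chebXD -sE mulrDr.
rewrite EFinM; apply: lee_wpmul2r; first by rewrite lee_fin chebX_ge0.
have IK' := IK x; rewrite x0 xr in IK'; have {}IK' := IK' isT.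
rewrite -[leLHS]poweR_EFin; apply: gt0_ler_poweR; rewrite ?in_itv/= ?leey ?andbT ?(ltW q_gt0) ?abse_ge0 ?lee_fin//.
by apply: le_trans IK' _; exact: lee_abs.
Qed.

End radial_lower_bound.

(** * From growth rates to the sharpness of the exponent *)

Section sharpness.
Variables (R : realType) (m n : nat) (alpha q : R) (p : 'I_m -> R).
Hypotheses (m_gt0 : (0 < m)%N) (n_gt0 : (0 < n)%N).
Hypotheses (alpha_gt0 : 0 < alpha) (alpha_ltn : alpha < n%:R).
Hypotheses (q_gt0 : 0 < q) (p_gt1 : forall i, 1 < p i).
Hypothesis scaling : \sum_(i < m) (p i)^-1 = q^-1 + alpha / n%:R.
Local Notation euclid n := (n.-tuple (measurableTypeR R)).
Local Notation mn := ((m * n)%:R : R).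
Local Notation b := (alpha / n%:R).
Local Notation sp := (\sum_(i < m) (p i)^-1).

Lemma gammaPq_max : exists j, gammaPq p q = Num.max 1 (conj_exp (p j) / q).
Proof.
pose j := [arg max_(i > Ordinal m_gt0) conj_exp (p i)]%O.
exists j; rewrite /gammaPq; apply/eqP; rewrite eq_le; apply/andP; split.
  apply: bigmax_le => [|i _]; first by rewrite le_max lexx.
  rewrite le_max ler_pM2r ?invr_gt0//; apply/orP; right.
  by rewrite /j; case: arg_maxP => // k _; apply.
rewrite ge_max bigmax_ge_id /=.
exact: (le_bigmax _ (fun i => conj_exp (p i) / q)).
Qed.

(** As the sum of the 1/p_i is 1/q + alpha/n, the quotient of the last two rates is J^(1 - alpha/n),
    which is the power (1 - alpha/n) g of the rate of the characteristic. *)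
Definition growth (g : R) : Prop := exists c A B K : R,
  [/\ 0 < c, 0 < A, 0 < B, 0 < K & forall J, (1 < J)%N ->
    exists w f : 'I_m -> euclid n -> R,
      [/\ Apq p q w,
          forall i, in_wLp (p i) (fun x => w i x `^ p i) (f i),
          (c%:E <= ApqC p q w <= (A * J%:R `^ g^-1)%:E)%E,
          (\prod_(i < m) wnorm (p i) (fun x => w i x `^ p i)%R (EFin \o f i) <=
             (B * J%:R `^ sp)%:E)%E &
          ((K * J%:R `^ (1 + q^-1))%:E <= wnorm q (u_weight q w) (Ialpha alpha f))%E]].

Lemma no_bound_of_growth (g r : R) : 0 < g -> growth g -> r < 1 ->
  ~ exists C, Ialpha_bound n alpha p q (r * (1 - b) * g) C.
Proof.
move=> g0 [c [A [B [K [c0 A0 B0 K0 H]]]]] r1 [C bound].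
have n0 : 0 < n%:R :> R by rewrite ltr0n.
have b1 : 0 < 1 - b by rewrite subr_gt0 ltr_pdivrMr// mul1r.
pose e := r * (1 - b) * g; pose D := A `^ e + c `^ e.
have D0 : 0 < D by rewrite addr_gt0 ?powR_gt0.
(* A negative r is treated like 0, with the lower bound [c] of the characteristic in place of the
   upper one; [D] covers both signs of the exponent. A bound would then give J^eta <= M for all J,
   with eta > 0. *)
pose rho := Num.max r 0.
have rho1 : rho < 1 by rewrite gt_max r1 ltr01.
pose eta := (1 - rho) * (1 - b).
have eta0 : 0 < eta by rewrite (mulr_gt0 _ b1)// subr_gt0.
pose M := (`|C| + 1) * D * B / K.
have C1 : 0 < `|C| + 1 by rewrite ltr_wpDl.
have M0 : 0 < M by exact: divr_gt0 (mulr_gt0 (mulr_gt0 C1 D0) B0) K0.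
suff key J : (1 < J)%N -> J%:R `^ eta <= M.
  pose J := (Num.truncn (M `^ eta^-1)).+2.
  have := key J isT; rewrite leNgt => /negP; apply.
  have -> : M = (M `^ eta^-1) `^ eta by rewrite -powRrM mulVf ?gt_eqF// powRr1 ?ltW.
  apply: gt0_ltr_powR; rewrite ?nnegrE ?powR_ge0//.
  have /andP[_ h] := truncn_itv (powR_ge0 M eta^-1).
  by apply: lt_le_trans h _; rewrite ler_nat.
move=> J1; have Jr : 0 < J%:R :> R by rewrite ltr0n ltnW.
have J1r : 1 <= J%:R :> R by rewrite ler1n ltnW.
have [w [f [wA fL /andP[cA AA] fB IK]]] := H J J1.
have := bound w f wA fL; rewrite -/e => bd.
have Afin : ApqC p q w \is a fin_num.
  by rewrite fin_numElt (lt_le_trans (ltNyr c) cA) (le_lt_trans AA (ltry _)).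
pose a := fine (ApqC p q w).
have aE : ApqC p q w = a%:E by rewrite /a fineK.
have ca : c <= a by rewrite -lee_fin -aE.
have aA : a <= A * J%:R `^ g^-1 by rewrite -lee_fin -aE.
have a0 : 0 < a by exact: lt_le_trans c0 ca.
have Ae : a `^ e <= D * J%:R `^ (rho * (1 - b)).
  have P1 : 1 <= J%:R `^ (rho * (1 - b)).
    rewrite -[leLHS](powRr0 J%:R) ler_powR// mulr_ge0 ?(ltW b1)//.
    by rewrite le_max lexx orbT.
  have [r0|r0] := leP 0 r.
    have e0 : 0 <= e by exact: mulr_ge0 (mulr_ge0 r0 (ltW b1)) (ltW g0).
    apply: (@le_trans _ _ ((A * J%:R `^ g^-1) `^ e)).
      by apply: ge0_ler_powR => //; rewrite nnegrE ltW// mulr_gt0 ?powR_gt0.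
    rewrite powRM ?powR_ge0 ?(ltW A0)// -powRrM.
    have -> : g^-1 * e = rho * (1 - b).
      have -> : rho = r by rewrite /rho max_l.
      by rewrite /e mulrC mulfK ?gt_eqF.
    by rewrite ler_wpM2r ?powR_ge0// lerDl powR_ge0.
  have e0 : e <= 0.
    have := mulr_gt0 b1 g0; rewrite /e -mulrA; move: ((1 - b) * g) => z z0; nra.
  apply: (@le_trans _ _ (c `^ e)).
    have N (t : R) : t `^ e = (t `^ (- e))^-1 by rewrite powRN invrK.
    rewrite (N a) (N c) lef_pV2 ?posrE ?powR_gt0//.
    by apply: ge0_ler_powR; rewrite ?nnegrE ?oppr_ge0 ?(ltW a0) ?(ltW c0).
  apply: (@le_trans _ _ (D * 1)); first by rewrite mulr1 lerDr powR_ge0.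
  by rewrite ler_wpM2l// ltW.
have P0 : (0 <= \prod_(i < m) wnorm (p i) (fun x => w i x `^ p i)%R (EFin \o f i))%E.
  by apply: prode_ge0 => i _; exact: poweR_ge0.
have bd2 : K * J%:R `^ (1 + q^-1) <=
    (`|C| + 1) * (D * J%:R `^ (rho * (1 - b))) * (B * J%:R `^ sp).
  rewrite -lee_fin; apply: (le_trans IK); apply: (le_trans bd).
  rewrite aE poweR_EFin -EFinM [leRHS]EFinM.
  apply: (@le_trans _ _ (((`|C| + 1) * (D * J%:R `^ (rho * (1 - b))))%:E *
    \prod_(i < m) wnorm (p i) (fun x => w i x `^ p i)%R (EFin \o f i))%E).
    apply: lee_wpmul2r => //; rewrite lee_fin.
    apply: (@le_trans _ _ ((`|C| + 1) * a `^ e)).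
      by rewrite ler_wpM2r ?powR_ge0// (le_trans (ler_norm C))// lerDl.
    by rewrite ler_wpM2l// addr_ge0.
  apply: lee_wpmul2l => //.
  by rewrite lee_fin (mulr_ge0 (ltW C1) (mulr_ge0 (ltW D0) (powR_ge0 _ _))).
have E : J%:R `^ (1 + q^-1) = J%:R `^ eta * J%:R `^ (rho * (1 - b)) * J%:R `^ sp :> R.
  have nz (t : R) : (t == 0) ==> (J%:R != 0 :> R) by apply/implyP => _; rewrite gt_eqF.
  rewrite -!powRD//; congr (_ `^ _); rewrite scaling /eta; ring.
rewrite E in bd2.
have X0 : 0 < J%:R `^ (rho * (1 - b)) * J%:R `^ sp :> R by rewrite mulr_gt0 ?powR_gt0.
rewrite /M ler_pdivlMr// -(ler_pM2r X0).
have -> : J%:R `^ eta * K * (J%:R `^ (rho * (1 - b)) * J%:R `^ sp) =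
    K * (J%:R `^ eta * J%:R `^ (rho * (1 - b)) * J%:R `^ sp) :> R.
  by move: (J%:R `^ eta) (J%:R `^ (rho * _)) (J%:R `^ sp) (K) => x y z t; ring.
apply: le_trans bd2 _; rewrite le_eqVlt; apply/orP; left; apply/eqP.
by move: (J%:R `^ (rho * _)) (J%:R `^ sp) (`|C| + 1) (D) (B) => x y z t v; ring.
Qed.

End sharpness.

Section growth.
Variables (R : realType) (m n : nat) (alpha q : R) (p : 'I_m -> R).
Hypotheses (m_gt0 : (0 < m)%N) (n_gt0 : (0 < n)%N).
Hypotheses (alpha_gt0 : 0 < alpha) (alpha_ltn : alpha < n%:R).
Hypotheses (q_gt0 : 0 < q) (p_gt1 : forall i, 1 < p i).
Hypothesis scaling : \sum_(i < m) (p i)^-1 = q^-1 + alpha / n%:R.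
Variable j : 'I_m.
Local Notation euclid n := (n.-tuple (measurableTypeR R)).
Local Notation mn := ((m * n)%:R : R).
Local Notation b := (alpha / n%:R).
Local Notation c := (conj_exp (p j)).

Lemma growth_of_pow (g A K : R) (om : nat -> R) : 0 < A -> 0 < K ->
  (forall J, (1 < J)%N -> [/\ - n%:R < om J, - n%:R <= q * om J & c * om J <= n%:R]) ->
  (forall J, (1 < J)%N ->
     (ApqC p q (pow_weight (n := n) j (om J)) <= (A * J%:R `^ g^-1)%:E)%E) ->
  (forall J, (1 < J)%N -> ((K * J%:R `^ (1 + q^-1))%:E <=
     wnorm q (chebX (q * om J)) (Ialpha alpha (pow_fun (n := n) p j (om J) J)))%E) ->
  growth n alpha q p g.
Proof.
move=> A0 K0 omJ AJ KJ.
exists (2 `^ (- n%:R) * (2 `^ (- n%:R)) `^ (q / c)), A,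
  (ballC R n `^ \sum_(i < m) (p i)^-1), K.
have bC0 : 0 < ballC R n by exact: lt_le_trans ltr01 (ballC_ge1 R n).
split=> //; try by rewrite ?mulr_gt0 ?powR_gt0.
move=> J J1; have J0 := ltnW J1; have [h1 h2 h3] := omJ J J1.
exists (pow_weight (n := n) j (om J)), (pow_fun (n := n) p j (om J) J); split.
- split; first by move=> i; exact: weight_pow_weight.
  exact: le_lt_trans (AJ J J1) (ltry _).
- by move=> i; exact: in_wLp_pow_fun.
- by rewrite ApqC_pow_weight_ge// AJ.
- rewrite -powRM ?(ltW bC0)//; exact: prod_wnorm_pow_fun.
by rewrite u_pow_weight; exact: KJ.
Qed.

Let n1 : 1 <= n%:R :> R. Proof. by rewrite ler1n. Qed.

Let n0 : 0 < n%:R :> R. Proof. by rewrite ltr0n. Qed.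

Let c_gt1 : 1 < c. Proof. exact: conj_exp_gt1. Qed.

Let b0 : 0 < b. Proof. by rewrite divr_gt0. Qed.

Let b1 : b < 1. Proof. by rewrite ltr_pdivrMr// mul1r. Qed.

Let inv_J J : (1 < J)%N -> 0 < (J%:R^-1 : R) < 1.
Proof. by move=> J1; rewrite invr_gt0 ltr0n ltnW//= invf_lt1 ?ltr1n// ltr0n ltnW. Qed.

(** The power of 2 bounds 2^(-|phi|) (r / L)^(phi + n) below, generously and for both test families,
    with [r] the radius of a shell and [L] the bound on the norms. *)
Definition shell_const : R :=
  (2 * mn) `^ (alpha - mn) * (2 `^ (- (2 * n%:R + 1))) ^+ m.

Lemma shell_const_gt0 : 0 < shell_const.
Proof.
apply: mulr_gt0; last by rewrite exprn_gt0 ?powR_gt0.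
by rewrite powR_gt0// mulr_gt0// ltr0n muln_gt0 m_gt0.
Qed.

Let phi (om : R) (J : nat) i : R := (J%:R^-1 - n%:R) / p i - pow_exp j om i.

Let phi_sum om J : \sum_i phi om J i = (J%:R^-1 - n%:R) * (q^-1 + b) - om.
Proof. by rewrite /phi sumrB sum_pow_exp -mulr_sumr scaling. Qed.

Let p_inv i : 0 < (p i)^-1 < 1.
Proof.
have p0 : 0 < p i by exact: lt_trans ltr01 (p_gt1 i).
by rewrite invr_gt0 p0 invf_lt1 ?p_gt1.
Qed.

Let c_inv : c^-1 = 1 - (p j)^-1. Proof. exact: inv_conj_exp. Qed.

(* The characteristic is attained on a singularity of [sigma_j]: on
   [cheb x = r] all the shells of radii [r 2^-k] contribute equally. *)
Lemma growth_sigma_singular : q <= c -> growth n alpha q p (c / q).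
Proof.
(* This is q times (alpha plus the sum of the exponents of the f_i, plus the exponent of w_j), plus
   n. Since [J * s J] is bounded, J shells count in the norm of the output. *)
move=> qc; pose s J : R := J%:R^-1 * (1 + q * b).
have qb0 : 0 < q * b by exact: mulr_gt0.
pose K2 : R := 2 `^ (- (n%:R + 2 * (1 + q * b))).
apply: (@growth_of_pow _ (muckC R n) (shell_const * K2 `^ q^-1)
  (fun J => (n%:R - J%:R^-1) / c)).
- exact: lt_le_trans ltr01 (muckC_ge1 R n).
- by rewrite mulr_gt0 ?shell_const_gt0 ?powR_gt0.
- move=> J /inv_J/andP[d0 d1]; have om0 : 0 < (n%:R - J%:R^-1) / c.
    apply: divr_gt0; last exact: lt_trans ltr01 c_gt1.
    by rewrite subr_gt0 (lt_le_trans d1 n1).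
  split; first by apply: lt_trans om0; rewrite oppr_lt0.
    by apply: ltW; apply: lt_trans (mulr_gt0 q_gt0 om0); rewrite oppr_lt0.
  rewrite mulrC divfK; last by rewrite gt_eqF// (lt_trans ltr01).
  by rewrite gerBl ltW.
- move=> J J1; have -> : (c / q)^-1 = q / c by rewrite invf_div.
  exact: (ApqC_sigma_singular n_gt0 q_gt0 p_gt1 (ltnW J1) qc).
move=> J J1; have /andP[d0 d1] := inv_J J1.
have J0 : J%:R != 0 :> R by rewrite gt_eqF// ltr0n ltnW.
set om := _ / c.
have phiE i : phi om J i = (if i == j then 1 else (p i)^-1) * (J%:R^-1 - n%:R).
  rewrite /phi /pow_exp; case: eqP => [->|_]; last by rewrite subr0 mulrC.
  by rewrite /om c_inv; ring.
apply: (@wnorm_Ialpha_ge _ m _ _ _ n_gt0 q_gt0 _ om (alpha + \sum_i phi om J i) (s J) 1 shell_const K2 J).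
- by [].
- by rewrite /s mulr_ge0 ?(ltW d0)// addr_ge0// ltW.
- exact: ltW shell_const_gt0.
- exact: powR_ge0.
- rewrite phi_sum /s; move: (J%:R^-1) => d; field; rewrite !gt_eqF//.
- move=> x /andP[x0 x1].
  (* In slot j, f_j is N^(1/J - n), with comparable integrals over the first J shells; these start
     at |x|/2 so as not to contain x. The other variables stay in the single shell of radius
     |x|/2. *)
  have := @Ialpha_shell_ge R m n alpha m_gt0 n_gt0 alpha_ltn (pow_fun p j om J) (phi om J)
    (fun _ _ => erefl) j x J
    (fun k i => cheb x * dy R (if i == j then k.+1 else 1)) (fun=> cheb x)
    (2 `^ (- (2 * n%:R + 1))).
  rewrite sumr_const card_ord -/shell_const -(chebXE _ x0) -[_ *+ J]mulr_natl.
  rewrite mulrA; apply.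
  + exact: powR_ge0.
  + by move=> k i; rewrite mulr_gt0 ?dy_gt0.
  + by move=> k i; rewrite mulr_ile1 ?dy_le1 ?cheb_ge0// ltW// dy_gt0.
  + by move=> k i; rewrite ler_piMr ?cheb_ge0 ?dy_le1.
  + by [].
  + move=> k _ /andP[_]; rewrite eqxx leNgt dyS => /negP; apply.
    by rewrite gtr_pMr//; have := dy_le1 R k; lra.
  + have -> : (fun k => shell n (cheb x * dy R (if j == j then k.+1 else 1))) =
        (fun k => shell n (cheb x / 2 * dy R k)).
      by apply/funext => k; rewrite eqxx dyS mulrA mulrAC.
    by apply: trivIset_shell; rewrite divr_gt0.
  move=> k i kJ; rewrite powRM ?cheb_ge0 ?(ltW (dy_gt0 R _))// mulrCA [leLHS]mulrC.
  apply: ler_wpM2l; first exact: powR_ge0.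
  rewrite /dy -powRrM -powRD; last by apply/implyP => _; rewrite gt_eqF.
  rewrite ler_powR ?ler1n// phiE normrM (ler0_norm (_ : J%:R^-1 - n%:R <= 0)); last first.
    by rewrite subr_le0 ltW// (lt_le_trans d1 n1).
  have dn : J%:R^-1 < n%:R :> R by exact: lt_le_trans d1 n1.
  have /andP[pi0 pi1] := p_inv i.
  have kd : k.+1%:R * J%:R^-1 <= 1 :> R.
    by rewrite ler_pdivrMr ?mul1r ?ler_nat// lt_neqAle eq_sym J0 ler0n.
  case: eqP => _; first by rewrite normr1; lra.
  rewrite ger0_norm ?(ltW pi0)//.
  have : 0 <= (p i)^-1 * (n%:R - J%:R^-1) <= n%:R by apply/andP; split; nra.
  by move: ((p i)^-1 * (n%:R - J%:R^-1)) (opprB (J%:R^-1 : R) n%:R) => z; lra.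
have T0 : 0 <= 1 + q * b by rewrite addr_ge0// ltW.
have JsE : J%:R * s J = 1 + q * b by rewrite /s mulVKf.
have sT : 0 <= s J <= 1 + q * b.
  by rewrite /s mulr_ge0 ?(ltW d0)//= ler_piMl// ltW.
rewrite powR1 mulr1 JsE -powRD; last by apply/implyP => _; rewrite gt_eqF.
rewrite ler_powR ?ler1n//.
have : `|s J - n%:R| <= n%:R + (1 + q * b).
  by rewrite ler_norml; have := ltW n0; move: (s J) (1 + _) sT => u T; lra.
by move: (`|_|) (1 + _) => u T; lra.
Qed.

(* The characteristic is attained on a singularity of [u]: near the origin
   each of the shells of radii [2^-k] contributes about one to [I_alpha f]. *)
Lemma growth_u_singular : c <= q -> growth n alpha q p 1.
Proof.
move=> cq; have q1 : 1 < q by exact: lt_le_trans c_gt1 cq.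
pose K2 : R := 2 `^ (- (n%:R + 2)).
apply: (@growth_of_pow _ (muckC R n `^ (q / c)) (shell_const / 2 * K2 `^ q^-1)
  (fun J => (J%:R^-1 - n%:R) / q)).
- by rewrite powR_gt0// (lt_le_trans ltr01 (muckC_ge1 R n)).
- by rewrite mulr_gt0 ?divr_gt0 ?shell_const_gt0 ?powR_gt0.
- move=> J /inv_J/andP[d0 d1].
  have dn : J%:R^-1 - n%:R < 0 :> R by rewrite subr_lt0 (lt_le_trans d1 n1).
  have qo : q * ((J%:R^-1 - n%:R) / q) = J%:R^-1 - n%:R by rewrite mulrC divfK// gt_eqF.
  split.
  + rewrite ltr_pdivlMr//; apply: (@lt_trans _ _ (- n%:R)); last by rewrite ltrDr.
    by rewrite mulNr ltrN2 ltr_pMr.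
  + by rewrite qo lerDr ltW.
  apply: (@le_trans _ _ 0) => //; rewrite pmulr_rle0 ?(lt_trans ltr01)//.
  by rewrite pmulr_lle0 ?invr_gt0// ltW.
- move=> J J1; rewrite invr1 powRr1//.
  exact: (ApqC_u_singular n_gt0 q_gt0 p_gt1 (ltnW J1) cq).
move=> J J1; have /andP[d0 d1] := inv_J J1.
have J0 : J%:R != 0 :> R by rewrite gt_eqF// ltr0n ltnW.
have dn : J%:R^-1 < n%:R :> R by exact: lt_le_trans d1 n1.
set om := _ / q.
have q_inv : 0 < q^-1 < 1 by rewrite invr_gt0 q_gt0 invf_lt1.
have phi_le i : `|phi om J i| <= n%:R.
  have -> : phi om J i = ((p i)^-1 - (i == j)%:R * q^-1) * (J%:R^-1 - n%:R).
    by rewrite /phi /pow_exp /om; case: (i == j) => /=; ring.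
  have [/andP[pi0 pi1] /andP[qi0 qi1]] := (p_inv i, q_inv).
  rewrite normrM -[leRHS]mul1r ler_pM//.
    by rewrite ler_norml; case: (i == j) => /=; rewrite ?mul1r ?mul0r; apply/andP; split; lra.
  by rewrite ler_norml; lra.
(* On the ball of radius 2^(-J) all the shells with k < J lie outside |x|. The radius is harmless
   because its power 1/J is 1/2. *)
apply: (@wnorm_Ialpha_ge _ m _ _ _ n_gt0 q_gt0 _ om 0 J%:R^-1 (dy R J) (shell_const / 2) K2 J).
- exact: dy_gt0.
- exact: ltW.
- by rewrite divr_ge0// ltW// shell_const_gt0.
- exact: powR_ge0.
- by rewrite add0r /om mulrC divfK// gt_eqF.
- move=> x /andP[x0 xr].
  have := @Ialpha_shell_ge R m n alpha m_gt0 n_gt0 alpha_ltn (pow_fun p j om J) (phi om J)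
    (fun _ _ => erefl) j x J (fun k i => dy R k) (fun k => dy R k)
    (2 `^ (- (2 * n%:R + 1))).
  rewrite -/shell_const => H; apply: le_trans (H _ _ _ _ _ _ _ _).
  + rewrite lee_fin chebX0 mulr1 -mulrA ler_wpM2l ?(ltW shell_const_gt0)//.
    have -> : 2^-1 * J%:R = \sum_(k < J) (2^-1 : R).
      by rewrite sumr_const card_ord mulr_natr.
    apply: ler_sum => k _; rewrite phi_sum.
    (* The exponents cancel up to b/J, so the k-th shell contributes 2^(-kb/J), at least 1/2 for k <
       J. *)
    have -> : alpha + ((J%:R^-1 - n%:R) * (q^-1 + b) - om) = J%:R^-1 * b.
      by rewrite /om; move: (J%:R^-1) => d; field; rewrite !gt_eqF//.
    rewrite -powR_inv1// /dy -powRrM ler_powR ?ler1n// mulNr lerN2 mulrA.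
    have kd : k%:R * J%:R^-1 <= 1 :> R.
      by rewrite ler_pdivrMr ?mul1r ?ler_nat; [exact: ltnW|rewrite lt_neqAle eq_sym J0 ler0n].
    by apply: mulr_ile1 => //; rewrite ?(ltW b0) ?(ltW b1)// mulr_ge0// ltW.
  + exact: powR_ge0.
  + by move=> k i; exact: dy_gt0.
  + by move=> k i; exact: dy_le1.
  + by [].
  + by move=> k kJ; apply: le_trans xr _; apply: dy_anti; exact: ltnW.
  + move=> k kJ /andP[xk _]; move: xk; rewrite -dyS ltNge => /negP; apply.
    by apply: le_trans xr _; exact: dy_anti.
  + have -> : (fun k => shell n (dy R k)) = (fun k => shell n (1 * dy R k)).
      by apply/funext => k; rewrite mul1r.
    exact: trivIset_shell.
  move=> k i kJ; rewrite ler_wpM2r ?powR_ge0// ler_powR ?ler1n//.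
  by have := phi_le i; have := n1; lra.
rewrite /dy -powRrM mulNr mulfV// -!powRD; try by apply/implyP => _; rewrite gt_eqF.
rewrite ler_powR ?ler1n//.
have : `|J%:R^-1 - n%:R| <= n%:R :> R by rewrite ler_norml; lra.
by lra.
Qed.

End growth.

Section sharp_half.
Variables (R : realType) (m n : nat) (alpha q : R) (p : 'I_m -> R).
Hypotheses (m_gt0 : (0 < m)%N) (n_gt0 : (0 < n)%N).
Hypotheses (alpha_gt0 : 0 < alpha) (alpha_ltn : alpha < n%:R).
Hypotheses (q_gt0 : 0 < q) (p_gt1 : forall i, 1 < p i).
Hypothesis scaling : \sum_(i < m) (p i)^-1 = q^-1 + alpha / n%:R.

Lemma exponent_sharp (r : R) : r < 1 ->
  ~ exists C : R, Ialpha_bound n alpha p q (r * (1 - alpha / n%:R) * gammaPq p q) C.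
Proof.
have [j ->] := gammaPq_max p m_gt0 q_gt0.
have c0 : 0 < conj_exp (p j) by exact: lt_trans ltr01 (conj_exp_gt1 p_gt1 j).
have [cq|qc] := leP (conj_exp (p j)) q.
  rewrite max_l; last by rewrite ler_pdivrMr// mul1r.
  apply: (no_bound_of_growth n_gt0 alpha_ltn scaling) => //.
  exact: growth_u_singular cq.
rewrite max_r; last by rewrite ler_pdivlMr// mul1r ltW.
apply: (no_bound_of_growth n_gt0 alpha_ltn scaling); first exact: divr_gt0.
exact: growth_sigma_singular (ltW qc).
Qed.

End sharp_half.

Theorem theorem1p2 (R : realType) (m n : nat) (alpha q : R) (p : 'I_m -> R)
    (m_gt0 : (0 < m)%N) (n_gt0 : (0 < n)%N)
    (alpha_gt0 : 0 < alpha) (alpha_ltn : alpha < n%:R)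
    (q_gt0 : 0 < q) (p_gt1 : forall i, 1 < p i)
    (scaling : \sum_(i < m) (p i)^-1 = q^-1 + alpha / n%:R)
    (ratio_le : min_ratio p q <= 1 - alpha / n%:R) :
  (exists C : R,
      Ialpha_bound n alpha p q ((1 - alpha / n%:R) * gammaPq p q) C) /\
  (forall r : R, r < 1 ->
      ~ exists C : R,
          Ialpha_bound n alpha p q (r * (1 - alpha / n%:R) * gammaPq p q) C).
Proof.
split; first exact: upper_half.
by move=> r; exact: exponent_sharp.
Qed.
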